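(* For every real $t$, \[ Z(t)=2\,\Re\bigl\{e^{i\vartheta(t)}U(t)\bigr\}. \]
   Context: Let $\Omega$ be the complex plane with the two cuts $\{iy: y\ge \tfrac12\}$ and $\{iy: y\le -\tfrac12\}$ removed. $\vartheta$ is the Riemann–Siegel theta function: the holomorphic function on $\Omega$ with $\vartheta(0)=0$ and \[ e^{i\vartheta(t)}=\pi^{-it/2}\sqrt{\frac{\Gamma(\frac14+\frac{it}{2})}{\Gamma(\frac14-\frac{it}{2})}}, \] which for real $t$ equals $\pi^{-it/2}\Gamma(\frac14+\frac{it}2)/|\Gamma(\frac14+\frac{it}2)|$. The function $Z(t)=e^{i\vartheta(t)}\zeta(\frac12+it)$ (real for real $t$), where $\zeta$ is the Riemann zeta function. For real $t$ define \[ U(t)=\frac{1}{2\pi i}\int_{-i\sigma-\infty}^{-i\sigma+\infty} e^{i\vartheta(t+x)-i\vartheta(t)}\,\zeta\bigl(\tfrac12+i(t+x)\bigr)\,\frac{\pi}{2\sinh\frac{\pi x}{2}}\,dx, \] with $0<\sigma<\frac12$ (the integration is along the horizontal line $\Im x=-\sigma$; the value is independent of $\sigma\in(0,\frac12)$). *)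

(* Defs.v *)
From Stdlib Require Import Reals.
From Coquelicot Require Import Coquelicot.
Open Scope R_scope.

Definition cexp (z : C) : C := (exp (Re z) * cos (Im z), exp (Re z) * sin (Im z)).

Definition csinh (z : C) : C := ((cexp z - cexp (- z)) / RtoC 2)%C.

(* Sum of a complex series (real and imaginary parts summed separately;
   equals the sum of the series whenever it converges). *)
Definition CSeries (a : nat -> C) : C :=
  (Series (fun n => Re (a n)), Series (fun n => Im (a n))).

Definition Rcpow (b : R) (z : C) : C := cexp (z * RtoC (ln b))%C.

(* Euler's Gamma integral, valid (and used only) for Re z > 0:
   Gamma(z) = \int_0^oo u^(z-1) e^(-u) du. *)
Definition CGamma (z : C) : C :=
  RInt_gen (V := C_R_CompleteNormedModule)
    (fun u : R => (Rcpow u (z - RtoC 1) * RtoC (exp (- u)))%C)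
    (at_right 0) (Rbar_locally p_infty).

(* Dirichlet eta function eta(s) = sum_{n>=1} (-1)^(n-1) n^(-s), convergent for Re s > 0. *)
Definition eta (s : C) : C :=
  CSeries (fun n : nat => (RtoC ((-1) ^ n) * Rcpow (INR (S n)) (- s))%C).

(* Riemann zeta function for Re s > 0, s <> 1 (away from the zeros of 1 - 2^(1-s)),
   via its standard analytic continuation zeta(s) = eta(s) / (1 - 2^(1-s)).
   It is only used here on the strip 0 < Re s < 1. *)
Definition zeta (s : C) : C := (eta s / (RtoC 1 - Rcpow 2 (RtoC 1 - s)))%C.

(* The horizontal strip |Im z| < 1/2 (a connected subset of Omega containing
   every point where theta is evaluated in the statement). *)
Definition strip (z : C) : Prop := Rabs (Im z) < / 2.

Definition is_RS_theta (th : C -> C) : Prop :=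
  (forall z, strip z -> ex_derive (K := C_AbsRing) (V := C_NormedModule) th z) /\
  th (RtoC 0) = RtoC 0 /\
  (forall z, strip z ->
     (cexp (Ci * th z) * cexp (Ci * th z))%C =
     (Rcpow PI (- (Ci * z)) *
        (CGamma (RtoC (/ 4) + Ci * z / RtoC 2) /
         CGamma (RtoC (/ 4) - Ci * z / RtoC 2)))%C).

Definition U (th : C -> C) (sigma t : R) : C :=
  (/ (RtoC (2 * PI) * Ci) *
   RInt_gen (V := C_R_CompleteNormedModule)
     (fun s : R =>
        let x : C := (s, Ropp sigma) in
        (cexp (Ci * th (RtoC t + x) - Ci * th (RtoC t)) *
         zeta (RtoC (/ 2) + Ci * (RtoC t + x)) *
         (RtoC PI / (RtoC 2 * csinh (RtoC PI * x / RtoC 2))))%C)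
     (Rbar_locally m_infty) (Rbar_locally p_infty))%C.

Definition Zfun (th : C -> C) (t : R) : C :=
  (cexp (Ci * th (RtoC t)) * zeta (RtoC (/ 2) + Ci * RtoC t))%C.

(* Main.v *)
Require Import Defs.
From Stdlib Require Import Reals Ranalysis5 Lra Lia ZArith ClassicalEpsilon.
From Coquelicot Require Import Coquelicot.
Open Scope R_scope.

(* Write [s = 1/2 + i z] and [Z z = exp (i theta z) * zeta s]. By the definition of [theta] the
   functional equation of zeta reads [exp (2 i theta z) * zeta s = zeta (1 - s)]. Hence
   [Z z ^ 2 = zeta s * zeta (1 - s)], so that [Z] grows at most linearly, and [Z] commutes with
   conjugation, first up to a sign and then exactly, by continuity from [z = 0]. The function
   [pi * Z (t + x) / (2 sinh (pi x / 2))] of [x] therefore decays exponentially in the strip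
   [|Im x| < 1/2]; its only pole there is [0], with residue [Z t]. Divided by [2 pi i], its integral
   over [Im x = - sigma] is [exp (i theta t) * U t]; its integral over [Im x = sigma] is the
   conjugate one, so twice the real part of [exp (i theta t) * U t] is the residue.

   The functional equation is proved as Riemann did: Poisson summation of a Gaussian gives the
   modularity of [omega x = sum_(n >= 1) exp (- pi n^2 x)], and the Mellin transform of the
   alternating series [omega x - 2 omega (4 x)] is [pi^(-s/2) Gamma (s/2) eta s]. *)

(** * Complex numbers and limits *)

Lemma Cmod_minus_sym (z w : C) : Cmod (z - w) = Cmod (w - z).
Proof. rewrite <- Cmod_opp. f_equal. ring. Qed.

Lemma Cmod_triangle_minus (z w : C) : Cmod (z - w) <= Cmod z + Cmod w.
Proof. rewrite <- (Cmod_opp w). apply Cmod_triangle. Qed.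

Lemma Cmod_triangle_inv (z w : C) : Cmod z - Cmod w <= Cmod (z - w).
Proof.
  eapply Rle_trans; [apply Rle_abs|]. exact (norm_triangle_inv (V := C_NormedModule) z w).
Qed.

Lemma re_minus (z w : C) : Re (z - w) = Re z - Re w.
Proof. reflexivity. Qed.

Lemma im_minus (z w : C) : Im (z - w) = Im z - Im w.
Proof. reflexivity. Qed.

Lemma Re_le_Cmod (z : C) : Re z <= Cmod z.
Proof. eapply Rle_trans; [apply Rle_abs|apply re_le_Cmod]. Qed.

Lemma Im_le_Cmod (z : C) : Rabs (Im z) <= Cmod z.
Proof. eapply Rle_trans; [|apply Rmax_Cmod]. apply Rmax_r. Qed.

Lemma Cmod_le_Re_Im (z : C) : Cmod z <= Rabs (Re z) + Rabs (Im z).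
Proof.
  destruct z as [x y]. change (Cmod (x, y) <= Rabs x + Rabs y).
  replace ((x, y) : C) with (RtoC x + Ci * RtoC y)%C
    by (apply injective_projections; simpl; ring).
  eapply Rle_trans; [apply Cmod_triangle|].
  rewrite Cmod_mult, Cmod_Ci, !Cmod_R, Rmult_1_l. apply Rle_refl.
Qed.

Lemma RtoC_neq_0 (x : R) : x <> 0 -> RtoC x <> RtoC 0.
Proof. intros Hx E. now apply Hx, RtoC_inj. Qed.

Lemma Cconj_RtoC (x : R) : Cconj (RtoC x) = RtoC x.
Proof. apply injective_projections; simpl; ring. Qed.

Lemma locally_C_Cmod (z : C) (P : C -> Prop) :
  locally z P <-> exists d : posreal, forall w, Cmod (w - z) < d -> P w.
Proof. split; intros H; apply locally_C; exact H. Qed.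

Lemma filterlim_C_Cmod {T : Type} {F : (T -> Prop) -> Prop} {FF : Filter F} (f : T -> C) (l : C) :
  filterlim f F (locally l) <-> forall eps, 0 < eps -> F (fun x => Cmod (f x - l) < eps).
Proof.
  split.
  - intros H eps He.
    exact (proj1 (filterlim_locally_ball_norm (U := C_NormedModule) f l) H (mkposreal eps He)).
  - intros H. apply (filterlim_locally_ball_norm (U := C_NormedModule) f l).
    intros eps. exact (H eps (cond_pos eps)).
Qed.

Lemma filterlim_Cplus {T : Type} {F : (T -> Prop) -> Prop} {FF : Filter F}
    (f g : T -> C) (l m : C) :
  filterlim f F (locally l) -> filterlim g F (locally m) ->
  filterlim (fun x => f x + g x)%C F (locally (l + m)%C).
Proof.
  intros Hf Hg. exact (filterlim_comp_2 f g Cplus Hf Hg (filterlim_plus (V := C_NormedModule) l m)).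
Qed.

Lemma filterlim_to_C_AbsRing {T : Type} {F : (T -> Prop) -> Prop} (f : T -> C) (l : C) :
  filterlim f F (locally l) <-> filterlim f F (locally (T := AbsRing_UniformSpace C_AbsRing) l).
Proof. split; intros H P HP; apply H; apply locally_C; exact HP. Qed.

Lemma filterlim_Cmult {T : Type} {F : (T -> Prop) -> Prop} {FF : Filter F}
    (f g : T -> C) (l m : C) :
  filterlim f F (locally l) -> filterlim g F (locally m) ->
  filterlim (fun x => f x * g x)%C F (locally (l * m)%C).
Proof.
  rewrite 3!filterlim_to_C_AbsRing. intros Hf Hg.
  exact (filterlim_comp_2 f g Cmult Hf Hg (filterlim_mult (K := C_AbsRing) l m)).
Qed.

Lemma filterlim_C_0_le {T : Type} {F : (T -> Prop) -> Prop} {FF : Filter F} (f : T -> C)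
    (g : T -> R) :
  (forall x, Cmod (f x) <= g x) -> filterlim g F (locally 0) -> filterlim f F (locally (RtoC 0)).
Proof.
  intros Hfg Hg. apply filterlim_C_Cmod. intros eps He.
  generalize (proj1 (filterlim_locally g 0) Hg (mkposreal eps He)). apply filter_imp. intros x Hx.
  change (Rabs (g x - 0) < eps) in Hx. rewrite Rminus_0_r in Hx.
  replace (f x - 0)%C with (f x) by ring.
  eapply Rle_lt_trans; [apply Hfg|]. eapply Rle_lt_trans; [apply Rle_abs|exact Hx].
Qed.

Lemma filterlim_exp_decay {T : Type} {F : (T -> Prop) -> Prop} {FF : Filter F} (K c : R)
    (u : T -> R) :
  0 < c -> filterlim u F (Rbar_locally p_infty) ->
  filterlim (fun x => K * exp (- (c * u x))) F (locally 0).
Proof.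
  intros Hc Hu. replace 0 with (K * 0) by ring.
  apply (filterlim_comp _ _ _ (fun x => exp (- (c * u x))) (Rmult K) _ (locally 0)).
  2: exact (filterlim_scal_r (V := R_NormedModule) K 0).
  apply filterlim_locally. intros eps.
  assert (Hlarge := Hu (fun t => - ln eps / c < t) (ex_intro _ _ (fun _ Ht => Ht))).
  unfold filtermap in *.
  apply filter_imp with (2 := Hlarge). intros x Hx. apply Rlt_div_l in Hx; [|exact Hc].
  change (Rabs (exp (- (c * u x)) - 0) < eps).
  rewrite Rminus_0_r, Rabs_pos_eq by apply Rlt_le, exp_pos.
  rewrite <- (exp_ln eps) by apply cond_pos. apply exp_increasing. lra.
Qed.

Lemma Cmod_filterlim_le {T : Type} {F : (T -> Prop) -> Prop} {FF : ProperFilter F}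
    (f : T -> C) (k l : C) (B : R) :
  filterlim f F (locally l) -> F (fun x => Cmod (f x - k) <= B) -> Cmod (l - k) <= B.
Proof.
  intros Hf HB. apply Rnot_lt_le. intros Hlt.
  assert (Hclose := proj1 (filterlim_C_Cmod f l) Hf (Cmod (l - k) - B) ltac:(lra)).
  destruct (filter_ex (F := F) _ (filter_and _ _ Hclose HB)) as [x [Hnear Hbound]].
  rewrite Cmod_minus_sym in Hnear. assert (Htri := Cmod_triangle (l - f x) (f x - k)).
  replace (l - f x + (f x - k))%C with (l - k)%C in Htri by ring. lra.
Qed.

Lemma continuous_Cmult {T : UniformSpace} (f g : T -> C) (x : T) :
  continuous f x -> continuous g x -> continuous (fun y => f y * g y)%C x.
Proof. apply filterlim_Cmult. Qed.

Lemma continuous_pair {T U V : UniformSpace} (f : T -> U) (g : T -> V) (x : T) :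
  continuous f x -> continuous g x ->
  continuous (U := prod_UniformSpace U V) (fun y => (f y, g y)) x.
Proof.
  intros Hf Hg. apply filterlim_locally. intros eps.
  generalize (filter_and _ _ (proj1 (filterlim_locally f _) Hf eps)
    (proj1 (filterlim_locally g _) Hg eps)).
  now apply filter_imp.
Qed.

Lemma continuous_RtoC {T : UniformSpace} (f : T -> R) (x : T) :
  continuous f x -> continuous (fun y => RtoC (f y)) x.
Proof. intros H. apply (continuous_pair f (fun _ => 0)); [exact H|apply continuous_const]. Qed.

Lemma continuous_Cconj (z : C) : continuous Cconj z.
Proof.
  apply filterlim_C_Cmod. intros eps He. apply locally_C_Cmod. exists (mkposreal eps He).
  intros w Hw. now rewrite <- Cminus_conj, Cmod_conj.
Qed.

Lemma continuous_horizontal {V : UniformSpace} (f : C -> V) (x y : R) :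
  continuous f (x, y) -> continuous (fun s : R => f (s, y)) x.
Proof.
  intros H. apply (continuous_comp (fun s : R => (s, y) : C) f); [|exact H].
  apply (continuous_pair (fun s => s) (fun _ => y)); [apply continuous_id|apply continuous_const].
Qed.

Lemma continuous_vertical {V : UniformSpace} (f : C -> V) (x y : R) :
  continuous f (x, y) -> continuous (fun s : R => f (x, s)) y.
Proof.
  intros H. apply (continuous_comp (fun s : R => (x, s) : C) f); [|exact H].
  apply (continuous_pair (fun _ => x) (fun s => s)); [apply continuous_const|apply continuous_id].
Qed.

Lemma continuous_locally_uniform_limit {T : UniformSpace} {K : AbsRing} {V : NormedModule K}
    (f : nat -> T -> V) (g : T -> V) (x : T) :
  (forall n, continuous (f n) x) ->
  (forall eps : posreal, exists n, locally x (fun y => norm (minus (f n y) (g y)) < eps)) ->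
  continuous g x.
Proof.
  intros Hf Hlim. apply filterlim_locally_ball_norm. intros eps.
  assert (Heps : 0 < eps / 3) by (pose proof (cond_pos eps); lra).
  destruct (Hlim (mkposreal _ Heps)) as [n Hn].
  assert (Hc := proj1 (filterlim_locally_ball_norm _ _) (Hf n) (mkposreal _ Heps)).
  pose proof (locally_singleton _ _ Hn).
  generalize (filter_and _ _ Hn Hc). apply filter_imp. intros y [Hy Hfy].
  unfold ball_norm in *. simpl in *.
  rewrite (minus_trans (f n y) (g y)), (minus_trans (f n x) (f n y)).
  eapply Rle_lt_trans; [apply norm_triangle|].
  eapply Rle_lt_trans; [apply Rplus_le_compat_l, norm_triangle|].
  rewrite <- (norm_opp (minus (g y) _)), opp_minus. lra.
Qed.

(** * Integrals of complex-valued functions of a real variable *)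

Notation is_RInt_C := (is_RInt (V := C_R_NormedModule)).
Notation ex_RInt_C := (ex_RInt (V := C_R_NormedModule)).
Notation RInt_C := (RInt (V := C_R_CompleteNormedModule)).

Lemma norm_C_R (z : C) : norm (V := C_R_NormedModule) z = Cmod z.
Proof.
  change (sqrt (Rabs (fst z) ^ 2 + Rabs (snd z) ^ 2) = Cmod z).
  unfold Cmod. now rewrite !pow2_abs.
Qed.

Lemma RInt_C_correct (f : R -> C) (a b : R) : ex_RInt_C f a b -> is_RInt_C f a b (RInt_C f a b).
Proof. exact (RInt_correct (V := C_R_CompleteNormedModule) f a b). Qed.

Lemma is_RInt_C_unique (f : R -> C) (a b : R) (l : C) : is_RInt_C f a b l -> RInt_C f a b = l.
Proof. exact (is_RInt_unique (V := C_R_CompleteNormedModule) f a b l). Qed.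

Lemma is_RInt_C_ext (f g : R -> C) (a b : R) (l : C) :
  (forall x, f x = g x) -> is_RInt_C f a b l -> is_RInt_C g a b l.
Proof. intros H. apply is_RInt_ext. auto. Qed.

Lemma is_RInt_C_pair (f : R -> C) (a b : R) (l : C) :
  is_RInt (fun x => Re (f x)) a b (Re l) -> is_RInt (fun x => Im (f x)) a b (Im l) ->
  is_RInt_C f a b l.
Proof.
  destruct l as [x y].
  exact (is_RInt_fct_extend_pair (U := R_NormedModule) (V := R_NormedModule) f a b x y).
Qed.

Lemma is_RInt_C_Re (f : R -> C) (a b : R) (l : C) :
  is_RInt_C f a b l -> is_RInt (fun x => Re (f x)) a b (Re l).
Proof. exact (is_RInt_fct_extend_fst (U := R_NormedModule) (V := R_NormedModule) f a b l). Qed.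

Lemma is_RInt_C_Im (f : R -> C) (a b : R) (l : C) :
  is_RInt_C f a b l -> is_RInt (fun x => Im (f x)) a b (Im l).
Proof. exact (is_RInt_fct_extend_snd (U := R_NormedModule) (V := R_NormedModule) f a b l). Qed.

Lemma is_RInt_Cminus (f g : R -> C) (a b : R) (l m : C) :
  is_RInt_C f a b l -> is_RInt_C g a b m -> is_RInt_C (fun x => f x - g x)%C a b (l - m)%C.
Proof. exact (is_RInt_minus (V := C_R_NormedModule) f g a b l m). Qed.

Lemma is_RInt_Cmult_l (k : C) (f : R -> C) (a b : R) (l : C) :
  is_RInt_C f a b l -> is_RInt_C (fun x => k * f x)%C a b (k * l)%C.
Proof.
  intros H. assert (HRe := is_RInt_C_Re _ _ _ _ H). assert (HIm := is_RInt_C_Im _ _ _ _ H).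
  apply is_RInt_C_pair.
  - exact (is_RInt_minus _ _ _ _ _ _
      (is_RInt_scal _ _ _ (Re k) _ HRe) (is_RInt_scal _ _ _ (Im k) _ HIm)).
  - exact (is_RInt_plus _ _ _ _ _ _
      (is_RInt_scal _ _ _ (Re k) _ HIm) (is_RInt_scal _ _ _ (Im k) _ HRe)).
Qed.

Lemma is_RInt_Cconj (f : R -> C) (a b : R) (l : C) :
  is_RInt_C f a b l -> is_RInt_C (fun x => Cconj (f x)) a b (Cconj l).
Proof.
  intros H. apply is_RInt_C_pair; [exact (is_RInt_C_Re _ _ _ _ H)|].
  exact (is_RInt_opp _ _ _ _ (is_RInt_C_Im _ _ _ _ H)).
Qed.

Lemma is_RInt_RtoC (f : R -> R) (a b l : R) :
  is_RInt f a b l -> is_RInt_C (fun x => RtoC (f x)) a b (RtoC l).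
Proof.
  intros H. apply is_RInt_C_pair; [exact H|].
  replace (Im (RtoC l)) with (scal (b - a) 0) by apply Rmult_0_r.
  exact (is_RInt_const a b 0).
Qed.

Lemma is_RInt_C_const (k : C) (a b : R) : is_RInt_C (fun _ => k) a b (RtoC (b - a) * k)%C.
Proof. rewrite <- scal_R_Cmult. exact (is_RInt_const (V := C_R_NormedModule) a b k). Qed.

Lemma is_RInt_comp_plus {V : NormedModule R_AbsRing} (f : R -> V) (v a b : R) (l : V) :
  is_RInt f (a + v) (b + v) l -> is_RInt (fun x => f (x + v)) a b l.
Proof.
  intros H. apply is_RInt_ext with (fun x => scal 1 (f (1 * x + v))).
  - intros x _. now rewrite Rmult_1_l, (scal_one (K := R_AbsRing)).
  - apply is_RInt_comp_lin. now rewrite !Rmult_1_l.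
Qed.

Lemma RInt_C_ext (f g : R -> C) (a b : R) :
  (forall x, f x = g x) -> RInt_C f a b = RInt_C g a b.
Proof. intros H. apply RInt_ext. auto. Qed.

Lemma RInt_Cminus (f g : R -> C) (a b : R) : ex_RInt_C f a b -> ex_RInt_C g a b ->
  RInt_C (fun x => f x - g x)%C a b = (RInt_C f a b - RInt_C g a b)%C.
Proof. intros. apply is_RInt_C_unique, is_RInt_Cminus; now apply RInt_C_correct. Qed.

Lemma RInt_Cmult_l (k : C) (f : R -> C) (a b : R) : ex_RInt_C f a b ->
  RInt_C (fun x => k * f x)%C a b = (k * RInt_C f a b)%C.
Proof. intros. now apply is_RInt_C_unique, is_RInt_Cmult_l, RInt_C_correct. Qed.

Lemma RInt_C_Chasles (f : R -> C) (a b c : R) : ex_RInt_C f a b -> ex_RInt_C f b c ->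
  RInt_C f a c = (RInt_C f a b + RInt_C f b c)%C.
Proof. intros. symmetry. now apply (RInt_Chasles (V := C_R_CompleteNormedModule)). Qed.

Lemma ex_RInt_C_continuous (f : R -> C) (a b : R) :
  a <= b -> (forall x, a <= x <= b -> continuous f x) -> ex_RInt_C f a b.
Proof.
  intros Hab H. apply (ex_RInt_continuous (V := C_R_CompleteNormedModule)).
  now rewrite Rmin_left, Rmax_right by auto.
Qed.

Lemma Cmod_is_RInt_le (f : R -> C) (g : R -> R) (a b : R) (l : C) (m : R) : a <= b ->
  (forall x, a <= x <= b -> Cmod (f x) <= g x) ->
  is_RInt_C f a b l -> is_RInt g a b m -> Cmod l <= m.
Proof.
  intros Hab Hfg Hf Hg. rewrite <- norm_C_R.
  apply (norm_RInt_le (V := C_R_NormedModule) f g a b); auto.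
  intros x Hx. rewrite norm_C_R. auto.
Qed.

Lemma Cmod_is_RInt_le_const (f : R -> C) (M a b : R) (l : C) : a <= b ->
  (forall x, a <= x <= b -> Cmod (f x) <= M) -> is_RInt_C f a b l -> Cmod l <= (b - a) * M.
Proof.
  intros Hab HM Hf. apply (Cmod_is_RInt_le f (fun _ => M) a b l); auto.
  exact (is_RInt_const a b M).
Qed.

Lemma Cmod_RInt_le_const (f : R -> C) (M a b : R) : a <= b -> ex_RInt_C f a b ->
  (forall x, a <= x <= b -> Cmod (f x) <= M) -> Cmod (RInt_C f a b) <= (b - a) * M.
Proof. intros Hab Hf HM. apply (Cmod_is_RInt_le_const f); auto. now apply RInt_C_correct. Qed.

(** * The complex exponential *)

Lemma cexp_plus (z w : C) : cexp (z + w) = (cexp z * cexp w)%C.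
Proof.
  unfold cexp. rewrite re_plus, im_plus, exp_plus, cos_plus, sin_plus.
  apply injective_projections; simpl; ring.
Qed.

Lemma cexp_0 : cexp 0 = 1.
Proof.
  unfold cexp. simpl. rewrite exp_0, cos_0, sin_0.
  apply injective_projections; simpl; ring.
Qed.

Lemma cexp_RtoC (x : R) : cexp (RtoC x) = RtoC (exp x).
Proof.
  unfold cexp. simpl. rewrite cos_0, sin_0. apply injective_projections; simpl; ring.
Qed.

Lemma cexp_conj (z : C) : Cconj (cexp z) = cexp (Cconj z).
Proof.
  unfold cexp. rewrite re_conj, im_conj, cos_neg, sin_neg.
  apply injective_projections; simpl; ring.
Qed.

Lemma Cmod_cexp (z : C) : Cmod (cexp z) = exp (Re z).
Proof.
  unfold cexp, Cmod. simpl fst; simpl snd.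
  replace ((exp (Re z) * cos (Im z)) ^ 2 + (exp (Re z) * sin (Im z)) ^ 2)
    with ((exp (Re z))²).
  - apply sqrt_Rsqr, Rlt_le, exp_pos.
  - rewrite <- (Rmult_1_r (exp (Re z))²), <- (sin2_cos2 (Im z)). unfold Rsqr. ring.
Qed.

Lemma cexp_neq_0 (z : C) : cexp z <> 0.
Proof. apply Cmod_gt_0. rewrite Cmod_cexp. apply exp_pos. Qed.

Lemma cexp_opp (z : C) : cexp (- z) = (/ cexp z)%C.
Proof.
  replace (cexp (- z)) with (/ cexp z * cexp (z + - z))%C
    by (rewrite cexp_plus; field; apply cexp_neq_0).
  rewrite Cplus_opp_r, cexp_0. ring.
Qed.

Lemma cexp_minus (z w : C) : cexp (z - w) = (cexp z / cexp w)%C.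
Proof. unfold Cminus, Cdiv. now rewrite cexp_plus, cexp_opp. Qed.

Lemma exp_le_compat (x y : R) : x <= y -> exp x <= exp y.
Proof. intros [H| ->]; [left; now apply exp_increasing|apply Rle_refl]. Qed.

Lemma is_RInt_cexp (k : C) (a b : R) :
  is_RInt_C (fun v => k * cexp (RtoC v * k))%C a b (cexp (RtoC b * k) - cexp (RtoC a * k))%C.
Proof.
  destruct k as [x y].
  assert (Hcexp : forall v, cexp (RtoC v * (x, y)) =
    (exp (v * x) * cos (v * y), exp (v * x) * sin (v * y))).
  { intros v. unfold cexp. simpl. now rewrite !Rmult_0_l, Rminus_0_r, Rplus_0_r. }
  rewrite !Hcexp. apply is_RInt_C_pair.
  - apply (is_RInt_ext
      (fun v => x * (exp (v * x) * cos (v * y)) - y * (exp (v * x) * sin (v * y)))).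
    { intros v _. now rewrite Hcexp. }
    apply (is_RInt_derive (fun v => exp (v * x) * cos (v * y))); intros v _.
    + auto_derive; auto. ring.
    + apply (ex_derive_continuous (V := R_NormedModule)). now auto_derive.
  - apply (is_RInt_ext
      (fun v => x * (exp (v * x) * sin (v * y)) + y * (exp (v * x) * cos (v * y)))).
    { intros v _. now rewrite Hcexp. }
    apply (is_RInt_derive (fun v => exp (v * x) * sin (v * y))); intros v _.
    + auto_derive; auto. ring.
    + apply (ex_derive_continuous (V := R_NormedModule)). now auto_derive.
Qed.

Lemma Cmod_cexp_minus_1_le (w : C) : Cmod w <= 1 -> Cmod (cexp w - 1) <= 3 * Cmod w.
Proof.
  intros Hw. assert (Hint := is_RInt_cexp w 0 1). rewrite Cmult_1_l, Cmult_0_l, cexp_0 in Hint.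
  replace (3 * Cmod w) with ((1 - 0) * (Cmod w * 3)) by ring.
  apply (Cmod_is_RInt_le_const _ _ _ _ _ Rle_0_1) with (2 := Hint). intros v Hv.
  rewrite Cmod_mult, Cmod_cexp, re_scal_l. apply Rmult_le_compat_l; [apply Cmod_ge_0|].
  eapply Rle_trans; [|apply exp_le_3]. apply exp_le_compat.
  assert (Hre := re_le_Cmod w). apply Rabs_le_between in Hre. nra.
Qed.

Lemma Cmod_cexp_minus_1_minus_id_le (w : C) :
  Cmod w <= 1 -> Cmod (cexp w - 1 - w) <= 3 * Cmod w * Cmod w.
Proof.
  intros Hw. assert (Hw_nonneg := Cmod_ge_0 w).
  assert (Hint := is_RInt_Cminus _ _ _ _ _ _ (is_RInt_cexp w 0 1) (is_RInt_C_const w 0 1)).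
  rewrite Cmult_1_l, Cmult_0_l, cexp_0, Rminus_0_r, Cmult_1_l in Hint.
  replace (3 * Cmod w * Cmod w) with ((1 - 0) * (Cmod w * (3 * Cmod w))) by ring.
  apply (Cmod_is_RInt_le_const _ _ _ _ _ Rle_0_1) with (2 := Hint). intros v Hv.
  replace (w * cexp (RtoC v * w) - w)%C with (w * (cexp (RtoC v * w) - 1))%C by ring.
  rewrite Cmod_mult. apply Rmult_le_compat_l; [exact Hw_nonneg|].
  assert (Hv' : Cmod (RtoC v * w) <= Cmod w) by (rewrite Cmod_mult, Cmod_R, Rabs_pos_eq; nra).
  eapply Rle_trans; [apply Cmod_cexp_minus_1_le|]; lra.
Qed.

(** * Complex differentiability *)

Lemma is_derive_C_Cmod (f : C -> C) (z l : C) :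
  is_derive f z l <-> forall eps, 0 < eps -> exists d : posreal, forall w, Cmod (w - z) < d ->
    Cmod (f w - f z - l * (w - z)) <= eps * Cmod (w - z).
Proof.
  split.
  - intros [_ H] eps He. destruct (H z (fun P HP => HP) (mkposreal eps He)) as [d Hd].
    exists d. intros w Hw. rewrite (Cmult_comm l). exact (Hd w Hw).
  - intros H. split; [apply is_linear_scal_l|]. intros x Hx.
    rewrite <- (is_filter_lim_locally_unique (V := AbsRing_NormedModule C_AbsRing) z x Hx).
    intros eps. destruct (H eps (cond_pos eps)) as [d Hd].
    exists d. intros w Hw. specialize (Hd w Hw). rewrite (Cmult_comm l) in Hd. exact Hd.
Qed.

Lemma ex_derive_continuous_C (f : C -> C) (z : C) : ex_derive f z -> continuous f z.
Proof.
  intros H P HP. apply locally_C. exact (ex_derive_continuous f z H P HP).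
Qed.

Lemma is_derive_to_C_AbsRing (f : C -> C) (z l : C) :
  is_derive f z l <-> is_derive (V := AbsRing_NormedModule C_AbsRing) f z l.
Proof. split; intros [_ H]; (split; [apply is_linear_scal_l|exact H]). Qed.

Lemma is_derive_Cmult (f g : C -> C) (z l m : C) :
  is_derive f z l -> is_derive g z m ->
  is_derive (fun w => f w * g w)%C z (l * g z + f z * m)%C.
Proof.
  rewrite 3!is_derive_to_C_AbsRing. intros Hf Hg.
  eapply filterdiff_ext_lin.
  - exact (filterdiff_mult_fct (U := AbsRing_NormedModule C_AbsRing) f g z _ _ Cmult_comm Hf Hg).
  - intros w. change (w * l * g z + f z * (w * m) = w * (l * g z + f z * m))%C. ring.
Qed.

Lemma is_derive_Cinv (z : C) : z <> 0 -> is_derive Cinv z (- / (z * z))%C.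
Proof.
  intros Hz. apply is_derive_C_Cmod. intros eps He.
  set (M := Cmod z). assert (HM : 0 < M) by now apply Cmod_gt_0.
  assert (Hd : 0 < Rmin (M / 2) (eps * (M * M * M / 2))).
  { apply Rmin_pos; [lra|]. repeat apply Rmult_lt_0_compat; lra. }
  exists (mkposreal _ Hd). simpl. intros w Hw.
  pose proof (Rlt_le_trans _ _ _ Hw (Rmin_l _ _)).
  assert (Hw_eps := Rlt_le_trans _ _ _ Hw (Rmin_r _ _)).
  assert (HMw : M / 2 <= Cmod w).
  { replace w with (z - (z - w))%C by ring. eapply Rle_trans; [|apply Cmod_triangle_inv].
    rewrite (Cmod_minus_sym z). fold M. lra. }
  assert (Hw0 : w <> 0) by (apply Cmod_gt_0; lra).
  assert (Hzzw : (z * z * w)%C <> 0) by (repeat apply Cmult_neq_0; auto).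
  replace (/ w - / z - - / (z * z) * (w - z))%C with ((w - z) / (z * z * w) * (w - z))%C
    by (field; auto).
  rewrite Cmod_mult. apply Rmult_le_compat_r; [apply Cmod_ge_0|].
  rewrite Cmod_div, !Cmod_mult by auto. fold M.
  apply Rle_div_l; [repeat apply Rmult_lt_0_compat; lra|].
  apply Rlt_le, (Rlt_le_trans _ _ _ Hw_eps), Rmult_le_compat_l; [lra|].
  unfold Rdiv. rewrite (Rmult_assoc (M * M)). apply Rmult_le_compat_l; [nra|lra].
Qed.

Lemma is_derive_cexp (z : C) : is_derive cexp z (cexp z).
Proof.
  apply is_derive_C_Cmod. intros eps He. pose proof (exp_pos (Re z)).
  assert (Hd : 0 < Rmin 1 (eps / (3 * exp (Re z)))).
  { apply Rmin_pos; [lra|]. apply Rdiv_lt_0_compat; lra. }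
  exists (mkposreal _ Hd). simpl. intros w Hw.
  pose proof (Rlt_le_trans _ _ _ Hw (Rmin_l _ _)).
  assert (Hw_eps := Rlt_le_trans _ _ _ Hw (Rmin_r _ _)).
  apply Rlt_div_r in Hw_eps; [|lra].
  replace (cexp w) with (cexp z * cexp (w - z))%C by (rewrite <- cexp_plus; f_equal; ring).
  replace (cexp z * cexp (w - z) - cexp z - cexp z * (w - z))%C
    with (cexp z * (cexp (w - z) - 1 - (w - z)))%C by ring.
  rewrite Cmod_mult, Cmod_cexp.
  eapply Rle_trans; [apply Rmult_le_compat_l, Cmod_cexp_minus_1_minus_id_le; lra|].
  pose proof (Cmod_ge_0 (w - z)). nra.
Qed.

Lemma ex_derive_Cplus (f g : C -> C) (z : C) :
  ex_derive f z -> ex_derive g z -> ex_derive (fun w => f w + g w)%C z.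
Proof. exact (ex_derive_plus (V := C_NormedModule) f g z). Qed.

Lemma ex_derive_Cminus (f g : C -> C) (z : C) :
  ex_derive f z -> ex_derive g z -> ex_derive (fun w => f w - g w)%C z.
Proof. exact (ex_derive_minus (V := C_NormedModule) f g z). Qed.

Lemma ex_derive_Copp (f : C -> C) (z : C) : ex_derive f z -> ex_derive (fun w => - f w)%C z.
Proof. exact (ex_derive_opp (V := C_NormedModule) f z). Qed.

Lemma ex_derive_Cmult (f g : C -> C) (z : C) :
  ex_derive f z -> ex_derive g z -> ex_derive (fun w => f w * g w)%C z.
Proof. intros [l Hf] [m Hg]. eexists. exact (is_derive_Cmult f g z l m Hf Hg). Qed.

Lemma ex_derive_Ccomp (f g : C -> C) (z : C) :
  ex_derive f (g z) -> ex_derive g z -> ex_derive (fun w => f (g w)) z.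
Proof.
  intros Hf [l Hg]. apply (ex_derive_comp (V := C_NormedModule) f g z Hf).
  exists l. now apply is_derive_to_C_AbsRing.
Qed.

Lemma ex_derive_cexp (f : C -> C) (z : C) : ex_derive f z -> ex_derive (fun w => cexp (f w)) z.
Proof. intros H. apply (ex_derive_Ccomp cexp f); [|exact H]. eexists. apply is_derive_cexp. Qed.

Lemma ex_derive_Cdiv (f g : C -> C) (z : C) : ex_derive f z -> ex_derive g z -> g z <> 0 ->
  ex_derive (fun w => f w / g w)%C z.
Proof.
  intros Hf Hg H0. apply ex_derive_Cmult; [exact Hf|].
  apply (ex_derive_Ccomp Cinv g); [|exact Hg]. eexists. now apply is_derive_Cinv.
Qed.

Lemma ex_derive_C_const (k z : C) : ex_derive (fun _ : C => k) z.
Proof. exact (ex_derive_const (V := C_NormedModule) k z). Qed.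

Lemma is_derive_C_id (z : C) : is_derive (fun w : C => w) z (RtoC 1).
Proof. apply is_derive_to_C_AbsRing. exact (is_derive_id (K := C_AbsRing) z). Qed.

Lemma ex_derive_C_id (z : C) : ex_derive (fun w : C => w) z.
Proof. eexists. apply is_derive_C_id. Qed.

Lemma is_derive_C_linear (k z : C) : is_derive (fun w : C => k * w)%C z k.
Proof.
  assert (H := is_derive_Cmult (fun _ => k) (fun w => w) z 0 1
    (is_derive_const (V := C_NormedModule) k z) (is_derive_C_id z)).
  now rewrite Cmult_0_l, Cplus_0_l, Cmult_1_r in H.
Qed.

Lemma is_derive_cexp_linear (k z : C) : is_derive (fun w : C => cexp (k * w)) z
    (k * cexp (k * z))%C.
Proof.
  apply (is_derive_comp (V := C_NormedModule) cexp); [apply is_derive_cexp|].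
  apply is_derive_to_C_AbsRing, is_derive_C_linear.
Qed.

Lemma is_derive_Cminus_const (f : C -> C) (k z l : C) :
  is_derive f z l -> is_derive (fun w => f w - k)%C z l.
Proof.
  intros H. rewrite <- (minus_zero_r l).
  exact (is_derive_minus (V := C_NormedModule) f (fun _ => k) z l zero H (is_derive_const k z)).
Qed.

Create HintDb holomorphic.
Hint Resolve ex_derive_Cplus ex_derive_Cminus ex_derive_Copp ex_derive_Cmult ex_derive_cexp
  ex_derive_Cdiv ex_derive_C_const ex_derive_C_id : holomorphic.

(** * Integration along the boundary of a rectangle *)

Definition rect (a b c d : R) (z : C) : Prop := a <= Re z <= b /\ c <= Im z <= d.

Definition rect_boundary (a b c d : R) (z : C) : Prop :=
  rect a b c d z /\ (Re z = a \/ Re z = b \/ Im z = c \/ Im z = d).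

Definition rect_int (f : C -> C) (a b c d : R) : C :=
  (RInt_C (fun s : R => f (s, c)) a b - RInt_C (fun s : R => f (s, d)) a b
   + Ci * (RInt_C (fun s : R => f (b, s)) c d - RInt_C (fun s : R => f (a, s)) c d))%C.

Definition ex_rect_int (f : C -> C) (a b c d : R) : Prop :=
  (ex_RInt_C (fun s : R => f (s, c)) a b /\ ex_RInt_C (fun s : R => f (s, d)) a b) /\
  (ex_RInt_C (fun s : R => f (b, s)) c d /\ ex_RInt_C (fun s : R => f (a, s)) c d).

Lemma ex_RInt_horizontal (f : C -> C) (a b y : R) :
  a <= b -> (forall x, a <= x <= b -> continuous f (x, y)) -> ex_RInt_C (fun s : R => f (s, y)) a b.
Proof.
  intros Hab H. apply ex_RInt_C_continuous; [exact Hab|].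
  intros x Hx. now apply continuous_horizontal, H.
Qed.

Lemma ex_RInt_vertical (f : C -> C) (x c d : R) :
  c <= d -> (forall y, c <= y <= d -> continuous f (x, y)) -> ex_RInt_C (fun s : R => f (x, s)) c d.
Proof.
  intros Hcd H. apply ex_RInt_C_continuous; [exact Hcd|].
  intros y Hy. now apply continuous_vertical, H.
Qed.

Lemma ex_rect_int_continuous (f : C -> C) (a b c d : R) : a <= b -> c <= d ->
  (forall z, rect_boundary a b c d z -> continuous f z) -> ex_rect_int f a b c d.
Proof.
  intros Hab Hcd Hf. repeat split.
  1, 2: apply (ex_RInt_horizontal f); [exact Hab|].
  3, 4: apply (ex_RInt_vertical f); [exact Hcd|].
  all: intros s Hs; apply Hf; unfold rect_boundary, rect; simpl; lra.
Qed.

Lemma ex_rect_int_minus (f g : C -> C) (a b c d : R) :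
  ex_rect_int f a b c d -> ex_rect_int g a b c d -> ex_rect_int (fun z => f z - g z)%C a b c d.
Proof. intros [[] []] [[] []]. repeat split; now apply @ex_RInt_minus. Qed.

Lemma ex_rect_int_Cmult_l (k : C) (f : C -> C) (a b c d : R) :
  ex_rect_int f a b c d -> ex_rect_int (fun z => k * f z)%C a b c d.
Proof.
  intros [[] []]. repeat split; eexists; apply is_RInt_Cmult_l, RInt_C_correct; assumption.
Qed.

Lemma rect_int_minus (f g : C -> C) (a b c d : R) : ex_rect_int f a b c d ->
  ex_rect_int g a b c d ->
  rect_int (fun z => f z - g z)%C a b c d = (rect_int f a b c d - rect_int g a b c d)%C.
Proof.
  intros [[] []] [[] []]. unfold rect_int. rewrite 4!RInt_Cminus by assumption. ring.
Qed.

Lemma rect_int_Cmult_l (k : C) (f : C -> C) (a b c d : R) : ex_rect_int f a b c d ->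
  rect_int (fun z => k * f z)%C a b c d = (k * rect_int f a b c d)%C.
Proof.
  intros [[] []]. unfold rect_int. rewrite 4!RInt_Cmult_l by assumption. ring.
Qed.

Lemma Cmod_rect_int_le (f : C -> C) (a b c d M : R) : a <= b -> c <= d -> ex_rect_int f a b c d ->
  (forall z, rect_boundary a b c d z -> Cmod (f z) <= M) ->
  Cmod (rect_int f a b c d) <= 2 * ((b - a) + (d - c)) * M.
Proof.
  intros Hab Hcd [[] []] Hf. unfold rect_int.
  eapply Rle_trans; [apply Cmod_triangle|]. rewrite Cmod_mult, Cmod_Ci, Rmult_1_l.
  replace (2 * ((b - a) + (d - c)) * M)
    with (((b - a) * M + (b - a) * M) + ((d - c) * M + (d - c) * M)) by ring.
  apply Rplus_le_compat; (eapply Rle_trans; [apply Cmod_triangle_minus|]);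
    apply Rplus_le_compat; apply Cmod_RInt_le_const; auto.
  all: intros s Hs; apply Hf; unfold rect_boundary, rect; simpl; lra.
Qed.

Lemma ex_rect_int_bounded (f : C -> C) (a b c d : R) : a <= b -> c <= d -> ex_rect_int f a b c d ->
  exists M, 0 < M /\ forall z, rect_boundary a b c d z -> Cmod (f z) <= M.
Proof.
  intros Hab Hcd [[Hbottom Htop] [Hright Hleft]].
  destruct (ex_RInt_ub _ _ _ Hbottom) as [Mbottom HMbottom].
  destruct (ex_RInt_ub _ _ _ Htop) as [Mtop HMtop].
  destruct (ex_RInt_ub _ _ _ Hright) as [Mright HMright].
  destruct (ex_RInt_ub _ _ _ Hleft) as [Mleft HMleft].
  rewrite Rmin_left, Rmax_right in HMbottom, HMtop, HMright, HMleft by assumption.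
  exists (Rabs Mbottom + Rabs Mtop + Rabs Mright + Rabs Mleft + 1).
  pose proof (Rabs_pos Mbottom). pose proof (Rabs_pos Mtop).
  pose proof (Rabs_pos Mright). pose proof (Rabs_pos Mleft).
  split; [lra|]. intros [x y] [[Hx Hy] Hbd]. simpl in *. rewrite <- norm_C_R.
  destruct Hbd as [-> | [-> | [-> | ->]]].
  - specialize (HMleft y Hy). pose proof (Rle_abs Mleft). lra.
  - specialize (HMright y Hy). pose proof (Rle_abs Mright). lra.
  - specialize (HMbottom x Hx). pose proof (Rle_abs Mbottom). lra.
  - specialize (HMtop x Hx). pose proof (Rle_abs Mtop). lra.
Qed.

Lemma rect_int_split_x (f : C -> C) (a m b c d : R) : a <= m <= b ->
  (forall x, a <= x <= b -> continuous f (x, c)) ->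
  (forall x, a <= x <= b -> continuous f (x, d)) ->
  rect_int f a b c d = (rect_int f a m c d + rect_int f m b c d)%C.
Proof.
  intros Hm Hc Hd. unfold rect_int.
  assert (Chasles : forall y, (forall x, a <= x <= b -> continuous f (x, y)) ->
    RInt_C (fun s : R => f (s, y)) a b =
    (RInt_C (fun s : R => f (s, y)) a m + RInt_C (fun s : R => f (s, y)) m b)%C).
  { intros y Hy. apply RInt_C_Chasles; apply (ex_RInt_horizontal f); try lra;
      intros x Hx; apply Hy; lra. }
  rewrite (Chasles c Hc), (Chasles d Hd). ring.
Qed.

Lemma rect_int_split_y (f : C -> C) (a b c m d : R) : c <= m <= d ->
  (forall y, c <= y <= d -> continuous f (a, y)) ->
  (forall y, c <= y <= d -> continuous f (b, y)) ->
  rect_int f a b c d = (rect_int f a b c m + rect_int f a b m d)%C.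
Proof.
  intros Hm Ha Hb. unfold rect_int.
  assert (Chasles : forall x, (forall y, c <= y <= d -> continuous f (x, y)) ->
    RInt_C (fun s : R => f (x, s)) c d =
    (RInt_C (fun s : R => f (x, s)) c m + RInt_C (fun s : R => f (x, s)) m d)%C).
  { intros x Hx. apply RInt_C_Chasles; apply (ex_RInt_vertical f); try lra;
      intros y Hy; apply Hx; lra. }
  rewrite (Chasles a Ha), (Chasles b Hb). ring.
Qed.

Lemma rect_int_affine (k l : C) (a b c d : R) : a <= b -> c <= d ->
  rect_int (fun z => k + l * z)%C a b c d = 0.
Proof.
  intros Hab Hcd.
  assert (Hex : ex_rect_int (fun z => k + l * z)%C a b c d).
  { apply ex_rect_int_continuous; auto. intros. apply ex_derive_continuous_C.
    auto with holomorphic. }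
  destruct Hex as [[] []]. unfold rect_int.
  rewrite <- RInt_Cminus, <- RInt_Cminus by assumption.
  rewrite (RInt_C_ext _ (fun _ => l * (Ci * RtoC (c - d)))%C).
  2:{ intros s. apply injective_projections; simpl; ring. }
  rewrite (RInt_C_ext _ (fun _ => l * RtoC (b - a))%C c d).
  2:{ intros s. apply injective_projections; simpl; ring. }
  rewrite !(is_RInt_C_unique _ _ _ _ (is_RInt_C_const _ _ _)), !RtoC_minus. ring.
Qed.

(** * Cauchy's theorem *)

Lemma nested_segments (x w : nat -> R) : (forall n, 0 <= w n) ->
  (forall n, x n <= x (S n)) -> (forall n, x (S n) + w (S n) <= x n + w n) ->
  exists p, forall n, x n <= p <= x n + w n.
Proof.
  intros Hw Hl Hr.
  assert (Hlr : forall n m, x m <= x n + w n).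
  { intros n m. pose proof (Hw n). pose proof (Hw m). destruct (Nat.le_ge_cases m n) as [Hmn|Hmn].
    - assert (Hmono := growing_prop x n m Hl Hmn). lra.
    - assert (Hmono := decreasing_prop (fun k => x k + w k) n m Hr Hmn). simpl in Hmono. lra. }
  destruct (ex_finite_lim_seq_incr x (x 0%nat + w 0%nat) Hl (Hlr 0%nat)) as [p Hp].
  exists p. intros n. split.
  - exact (is_lim_seq_incr_compare x p Hp Hl n).
  - exact (is_lim_seq_le _ _ _ _ (Hlr n) Hp (is_lim_seq_const (x n + w n))).
Qed.

Lemma halving_nonneg (L : R) (n : nat) : 0 <= L -> 0 <= L / 2 ^ n.
Proof. intros. apply Rdiv_le_0_compat; [assumption|apply pow_lt; lra]. Qed.

Lemma halving_S (L : R) (n : nat) : L / 2 ^ n = L / 2 ^ S n + L / 2 ^ S n.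
Proof. simpl. field. apply pow_nonzero. lra. Qed.

(* Otherwise bisection yields nested rectangles on which [P] fails, against the local
   hypothesis at their common point. *)
Lemma quadrisection_ind (P : nat -> R -> R -> Prop) (a c L H : R) : 0 <= L -> 0 <= H ->
  (forall n x y, P (S n) x y -> P (S n) (x + L / 2 ^ S n) y -> P (S n) x (y + H / 2 ^ S n) ->
     P (S n) (x + L / 2 ^ S n) (y + H / 2 ^ S n) -> P n x y) ->
  (forall p q, a <= p <= a + L -> c <= q <= c + H -> exists n, forall x y,
     x <= p <= x + L / 2 ^ n -> y <= q <= y + H / 2 ^ n -> P n x y) ->
  P 0%nat a c.
Proof.
  intros HL HH Hsub Hloc. apply NNPP. intros HP.
  assert (Hstep : forall n (u : R * R), exists v, ~ P n (fst u) (snd u) ->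
    ~ P (S n) (fst v) (snd v) /\ fst u <= fst v <= fst u + L / 2 ^ S n /\
    snd u <= snd v <= snd u + H / 2 ^ S n).
  { intros n [x y]. simpl fst; simpl snd.
    pose proof (halving_nonneg L (S n) HL). pose proof (halving_nonneg H (S n) HH).
    destruct (classic (P n x y)) as [HPn|HPn]; [exists (x, y); tauto|].
    set (w := L / 2 ^ S n) in *. set (h := H / 2 ^ S n) in *.
    assert (Hfail : ~ P (S n) x y \/ ~ P (S n) (x + w) y \/ ~ P (S n) x (y + h) \/
      ~ P (S n) (x + w) (y + h)).
    { apply NNPP. intros Hfail. apply HPn, Hsub; apply NNPP; tauto. }
    destruct Hfail as [Hfail|[Hfail|[Hfail|Hfail]]];
      [exists (x, y)|exists (x + w, y)|exists (x, y + h)|exists (x + w, y + h)];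
      intros _; (split; [exact Hfail|simpl; lra]). }
  set (next := fun n u => proj1_sig (constructive_indefinite_description _ (Hstep n u))).
  set (u := nat_rect (fun _ => (R * R)%type) (a, c) next).
  assert (Hnext := fun n v => proj2_sig (constructive_indefinite_description _ (Hstep n v))).
  assert (Hu : forall n, ~ P n (fst (u n)) (snd (u n))).
  { induction n as [|n IH]; [exact HP|]. exact (proj1 (Hnext n (u n) IH)). }
  assert (Hu' : forall n, fst (u n) <= fst (u (S n)) <= fst (u n) + L / 2 ^ S n /\
    snd (u n) <= snd (u (S n)) <= snd (u n) + H / 2 ^ S n).
  { intros n. exact (proj2 (Hnext n (u n) (Hu n))). }
  destruct (nested_segments (fun n => fst (u n)) (fun n => L / 2 ^ n)) as [p Hp].
  1: intros n; now apply halving_nonneg.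
  1, 2: intros n; specialize (Hu' n); rewrite ?(halving_S L n); lra.
  destruct (nested_segments (fun n => snd (u n)) (fun n => H / 2 ^ n)) as [q Hq].
  1: intros n; now apply halving_nonneg.
  1, 2: intros n; specialize (Hu' n); rewrite ?(halving_S H n); lra.
  destruct (Hloc p q) as [n Hn].
  - specialize (Hp 0%nat). simpl in Hp. lra.
  - specialize (Hq 0%nat). simpl in Hq. lra.
  - apply (Hu n), Hn; [apply Hp|apply Hq].
Qed.

Lemma Cmod_rect_int_local_le (f : C -> C) (z0 : C) (eps : R) : ex_derive f z0 -> 0 < eps ->
  exists d : posreal, forall x y w h, x <= Re z0 <= x + w -> y <= Im z0 <= y + h -> w + h < d ->
    (forall z, rect_boundary x (x + w) y (y + h) z -> continuous f z) ->
    Cmod (rect_int f x (x + w) y (y + h)) <= eps * ((w + h) * (w + h)).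
Proof.
  intros [l Hl] He.
  destruct (proj1 (is_derive_C_Cmod f z0 l) Hl (eps / 2) ltac:(lra)) as [d Hd].
  exists d. intros x y w h Hx Hy Hwh Hc.
  set (g := fun z => (f z0 - l * z0 + l * z)%C).
  assert (Hg_ex : ex_rect_int g x (x + w) y (y + h)).
  { apply ex_rect_int_continuous; try lra. intros z _. apply ex_derive_continuous_C.
    unfold g. auto with holomorphic. }
  assert (Hf_ex : ex_rect_int f x (x + w) y (y + h)) by (apply ex_rect_int_continuous; auto; lra).
  replace (rect_int f x (x + w) y (y + h))
    with (rect_int (fun z => f z - g z)%C x (x + w) y (y + h)).
  2:{ rewrite rect_int_minus by assumption. unfold g. rewrite rect_int_affine by lra. ring. }
  replace (eps * ((w + h) * (w + h))) with
    (2 * ((x + w - x) + (y + h - y)) * (eps / 2 * (w + h))) by field.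
  apply Cmod_rect_int_le; try lra; [now apply ex_rect_int_minus|].
  intros z [[Hzx Hzy] _]. unfold g.
  replace (f z - (f z0 - l * z0 + l * z))%C with (f z - f z0 - l * (z - z0))%C by ring.
  assert (Hz : Cmod (z - z0) <= w + h).
  { eapply Rle_trans; [apply Cmod_le_Re_Im|]. rewrite re_minus, im_minus.
    apply Rplus_le_compat; apply Rabs_le; lra. }
  eapply Rle_trans; [apply Hd; lra|]. apply Rmult_le_compat_l; lra.
Qed.

Lemma Cmod_rect_int_quarters_le (f : C -> C) (x y w h B : R) : 0 <= w -> 0 <= h ->
  (forall z, rect x (x + (w + w)) y (y + (h + h)) z -> continuous f z) ->
  Cmod (rect_int f x (x + w) y (y + h)) <= B ->
  Cmod (rect_int f (x + w) (x + w + w) y (y + h)) <= B ->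
  Cmod (rect_int f x (x + w) (y + h) (y + h + h)) <= B ->
  Cmod (rect_int f (x + w) (x + w + w) (y + h) (y + h + h)) <= B ->
  Cmod (rect_int f x (x + (w + w)) y (y + (h + h))) <= 4 * B.
Proof.
  intros Hw Hh Hc. rewrite <- (Rplus_assoc x), <- (Rplus_assoc y) in *. intros Hsw Hse Hnw Hne.
  rewrite (rect_int_split_x f x (x + w)), (rect_int_split_y f x (x + w) y (y + h)),
    (rect_int_split_y f (x + w) _ y (y + h)) by (try lra; intros; apply Hc; split; simpl; lra).
  eapply Rle_trans; [apply Cmod_triangle|].
  eapply Rle_trans; [apply Rplus_le_compat; apply Cmod_triangle|]. lra.
Qed.

Lemma ex_halving_lt (L d : R) : 0 <= L -> 0 < d -> exists n, L / 2 ^ n < d.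
Proof.
  intros HL Hd.
  assert (Hhalf : Rabs (/ 2) < 1) by (rewrite Rabs_pos_eq; lra).
  destruct (is_lim_seq_geom (/ 2) Hhalf (fun t => t < d / (L + 1))) as [n Hn].
  { apply open_lt. apply Rdiv_lt_0_compat; lra. }
  exists n. specialize (Hn n (Nat.le_refl n)). rewrite pow_inv in Hn. apply Rlt_div_r in Hn; [|lra].
  assert (Hpow : 0 < / 2 ^ n) by (apply Rinv_0_lt_compat, pow_lt; lra). unfold Rdiv. nra.
Qed.

Lemma Goursat_estimate (f : C -> C) (a c L H k : R) : 0 <= L -> 0 <= H -> 0 < k ->
  (forall z, rect a (a + L) c (c + H) z -> ex_derive f z) ->
  Cmod (rect_int f a (a + L) c (c + H)) <= k * ((L + H) * (L + H)).
Proof.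
  intros HL HH Hk Hf.
  assert (Hc : forall z, rect a (a + L) c (c + H) z -> continuous f z).
  { intros z Hz. now apply ex_derive_continuous_C, Hf. }
  set (P := fun n x y => a <= x -> x + L / 2 ^ n <= a + L -> c <= y -> y + H / 2 ^ n <= c + H ->
    Cmod (rect_int f x (x + L / 2 ^ n) y (y + H / 2 ^ n)) <=
    k * ((L + H) / 2 ^ n * ((L + H) / 2 ^ n))).
  enough (HP : P 0%nat a c).
  { unfold P in HP. simpl in HP. rewrite !Rdiv_1_r in HP. apply HP; lra. }
  apply (quadrisection_ind P a c L H HL HH); unfold P.
  - intros n x y Psw Pse Pnw Pne Hx1 Hx2 Hy1 Hy2.
    assert (HLn := halving_nonneg L (S n) HL). assert (HHn := halving_nonneg H (S n) HH).
    rewrite (halving_S L n), (halving_S H n), (halving_S (L + H) n) in *.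
    set (w := L / 2 ^ S n) in *. set (h := H / 2 ^ S n) in *. set (s := (L + H) / 2 ^ S n) in *.
    replace (k * ((s + s) * (s + s))) with (4 * (k * (s * s))) by ring.
    apply Cmod_rect_int_quarters_le; [exact HLn|exact HHn| | | | |].
    + intros z [Hzx Hzy]. apply Hc. split; lra.
    + apply Psw; lra.
    + apply Pse; lra.
    + apply Pnw; lra.
    + apply Pne; lra.
  - intros p q Hp Hq.
    destruct (Cmod_rect_int_local_le f (p, q) k) as [r Hr]; auto.
    { apply Hf. split; simpl; lra. }
    destruct (ex_halving_lt (L + H) r) as [n Hn]; [lra|apply cond_pos|].
    exists n. intros x y Hx Hy Hx1 Hx2 Hy1 Hy2.
    replace ((L + H) / 2 ^ n) with (L / 2 ^ n + H / 2 ^ n) in * by (unfold Rdiv; ring).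
    apply Hr; auto. intros z [[Hzx Hzy] _]. apply Hc. split; lra.
Qed.

Theorem Goursat (f : C -> C) (a b c d : R) : a <= b -> c <= d ->
  (forall z, rect a b c d z -> ex_derive f z) -> rect_int f a b c d = 0.
Proof.
  intros Hab Hcd Hf. apply Cmod_eq_0, Rle_antisym; [|apply Cmod_ge_0].
  apply le_epsilon. intros eps He. rewrite Rplus_0_l.
  set (s := (b - a) + (d - c)). assert (Hs : 0 <= s * s) by apply Rle_0_sqr.
  replace b with (a + (b - a)) in * by ring. replace d with (c + (d - c)) in * by ring.
  assert (Hk : 0 < eps / (s * s + 1)) by (apply Rdiv_lt_0_compat; lra).
  eapply Rle_trans; [apply (Goursat_estimate f a c (b - a) (d - c) _ ltac:(lra) ltac:(lra) Hk Hf)|].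
  fold s. replace (eps / (s * s + 1) * (s * s)) with (eps * (s * s) / (s * s + 1)) by (field; lra).
  apply Rle_div_l; nra.
Qed.

(** * Residues and Cauchy's integral formula *)

Definition is_simple_residue (f : C -> C) (z0 A : C) : Prop :=
  filterlim (fun z => f z * (z - z0))%C (locally' z0) (locally A).

Lemma is_simple_residue_Cmod (f : C -> C) (z0 A : C) : is_simple_residue f z0 A ->
  forall eps, 0 < eps -> exists d : posreal, forall z, z <> z0 -> Cmod (z - z0) < d ->
    Cmod (f z * (z - z0) - A) < eps.
Proof.
  intros H eps He. apply filterlim_C_Cmod with (eps := eps) in H; [|exact He].
  apply locally_C_Cmod in H. destruct H as [d Hd]. exists d. auto.
Qed.

Lemma filterlim_slope (f : C -> C) (z0 l : C) : is_derive f z0 l ->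
  filterlim (fun z => (f z - f z0) / (z - z0))%C (locally' z0) (locally l).
Proof.
  intros H. apply filterlim_C_Cmod. intros eps He.
  destruct (proj1 (is_derive_C_Cmod f z0 l) H (eps / 2) ltac:(lra)) as [d Hd].
  apply locally_C_Cmod. exists d. intros z Hz Hne.
  assert (Hz0 : (z - z0)%C <> 0) by now apply Cminus_eq_contra.
  replace ((f z - f z0) / (z - z0) - l)%C with ((f z - f z0 - l * (z - z0)) / (z - z0))%C
    by (field; auto).
  rewrite Cmod_div by exact Hz0. pose proof (proj1 (Cmod_gt_0 _) Hz0).
  apply Rle_lt_trans with (eps / 2); [|lra]. apply Rle_div_l; auto.
Qed.

Lemma is_simple_residue_div (g h : C -> C) (z0 l : C) :
  continuous g z0 -> is_derive h z0 l -> h z0 = 0 -> l <> 0 ->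
  is_simple_residue (fun z => g z / h z)%C z0 (g z0 / l)%C.
Proof.
  intros Hg Hh Hh0 Hl. assert (Hslope := filterlim_slope h z0 l Hh).
  assert (Hinv : filterlim Cinv (locally l) (locally (/ l)%C)).
  { apply (ex_derive_continuous_C Cinv). eexists. now apply is_derive_Cinv. }
  assert (Hg' : filterlim g (locally' z0) (locally (g z0))).
  { apply (filterlim_filter_le_1 (F := locally z0)); [apply filter_le_within|exact Hg]. }
  apply filterlim_ext_loc with (fun z => g z * / ((h z - h z0) / (z - z0)))%C.
  2:{ apply filterlim_Cmult; [exact Hg'|]. exact (filterlim_comp _ _ _ _ _ _ _ _ Hslope Hinv). }
  apply filterlim_C_Cmod with (eps := Cmod l) in Hslope; [|now apply Cmod_gt_0].
  apply locally_C_Cmod in Hslope. destruct Hslope as [d Hd].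
  apply locally_C_Cmod. exists d. intros z Hz Hne. specialize (Hd z Hz Hne).
  rewrite Hh0 in *. assert (Hz_neq : (z - z0)%C <> 0) by now apply Cminus_eq_contra.
  assert (Hhz : h z <> 0).
  { intros Hvanish. rewrite Hvanish in Hd. replace ((0 - 0) / (z - z0) - l)%C with (- l)%C in Hd
      by (field; auto).
    rewrite Cmod_opp in Hd. lra. }
  field. auto.
Qed.

Lemma rect_interior_radius (a b c d x y delta : R) : a < x < b -> c < y < d -> 0 < delta ->
  exists r, 0 < r < delta /\ a + r <= x <= b - r /\ c + r <= y <= d - r.
Proof.
  intros Hx Hy Hd.
  assert (Hex : exists r,
    0 < r /\ r <= delta / 2 /\ r <= x - a /\ r <= b - x /\ r <= y - c /\ r <= d - y).
  { exists (Rmin (delta / 2) (Rmin (Rmin (x - a) (b - x)) (Rmin (y - c) (d - y)))).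
    unfold Rmin. repeat destruct Rle_dec; lra. }
  destruct Hex as [r Hr]. exists r. lra.
Qed.

Lemma rect_boundary_dist (a b c d r : R) (z0 z : C) :
  a + r <= Re z0 <= b - r -> c + r <= Im z0 <= d - r -> rect_boundary a b c d z ->
    r <= Cmod (z - z0).
Proof.
  intros Hx Hy [_ Hz].
  assert (HRe := re_le_Cmod (z - z0)). assert (HIm := Im_le_Cmod (z - z0)).
  apply Rabs_le_between in HRe, HIm. rewrite re_minus in HRe. rewrite im_minus in HIm. lra.
Qed.

Lemma rect_int_shrink (f : C -> C) (a b c d a' b' c' d' : R) :
  a <= a' <= b' -> b' <= b -> c <= c' <= d' -> d' <= d ->
  (forall z, rect a b c d z -> ~ (a' < Re z < b' /\ c' < Im z < d') -> ex_derive f z) ->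
  rect_int f a b c d = rect_int f a' b' c' d'.
Proof.
  intros Ha Hb Hc Hd Hf.
  assert (Hc' : forall z, rect a b c d z -> ~ (a' < Re z < b' /\ c' < Im z < d') -> continuous f z).
  { intros. now apply ex_derive_continuous_C, Hf. }
  rewrite (rect_int_split_x f a a' b), (rect_int_split_x f a' b' b),
    (rect_int_split_y f a' b' c c' d), (rect_int_split_y f a' b' c' d' d)
    by (try lra; (intros; apply Hc'; [split|intros [[] []]]; simpl in *; lra)).
  rewrite (Goursat f a a'), (Goursat f b' b), (Goursat f a' b' c c'), (Goursat f a' b' d' d)
    by (try lra; (intros z []; apply Hf; [split|intros [[] []]]; lra)).
  ring.
Qed.

Lemma is_RInt_atan_kernel (x r : R) : 0 < r ->
  is_RInt (fun s => 2 * r / ((s - x) * (s - x) + r * r)) (x - r) (x + r) PI.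
Proof.
  intros Hr.
  replace PI with (minus (2 * atan ((x + r - x) / r)) (2 * atan ((x - r - x) / r))).
  - apply (is_RInt_derive (fun s => 2 * atan ((s - x) / r))); intros s _;
      assert (Hs : 0 <= (s - x) * (s - x)) by apply Rle_0_sqr;
      assert (Hrr : 0 < r * r) by nra.
    + auto_derive; [lra|]. field. lra.
    + apply (ex_derive_continuous (V := R_NormedModule)). auto_derive. lra.
  - replace ((x + r - x) / r) with 1 by (field; lra).
    replace ((x - r - x) / r) with (- (1)) by (field; lra).
    rewrite atan_opp, atan_1. unfold minus, plus, opp. simpl. field.
Qed.

Lemma continuous_Cinv_minus (z0 z : C) : z <> z0 -> continuous (fun w => / (w - z0))%C z.
Proof.
  intros Hz. apply ex_derive_continuous_C, (ex_derive_Ccomp Cinv).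
  - eexists. now apply is_derive_Cinv, Cminus_eq_contra.
  - auto with holomorphic.
Qed.

Definition two_PI_i : C := (RtoC (2 * PI) * Ci)%C.

Lemma two_PI_i_neq_0 : two_PI_i <> 0.
Proof. apply Cmult_neq_0; [apply RtoC_neq_0|apply Ci_nz]. pose proof PI_RGT_0. lra. Qed.

Notation on_square F z0 r := (F (Re z0 - r) (Re z0 + r) (Im z0 - r) (Im z0 + r)).

Lemma rect_int_Cinv (z0 : C) (r : R) : 0 < r ->
  on_square (rect_int (fun z => / (z - z0))%C) z0 r = two_PI_i.
Proof.
  intros Hr.
  assert (Hex : on_square (ex_rect_int (fun z => / (z - z0))%C) z0 r).
  { apply ex_rect_int_continuous; try lra. intros z [_ Hz]. apply continuous_Cinv_minus.
    intros ->. lra. }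
  destruct z0 as [x y]. unfold rect_int, ex_rect_int in *. simpl Re in *. simpl Im in *.
  destruct Hex as [[] []]. rewrite <- 2!RInt_Cminus by assumption.
  assert (Hsq : forall s, 0 < s * s + r * r) by (intros; nra).
  rewrite (is_RInt_C_unique _ (x - r) (x + r) (Ci * RtoC PI)%C),
    (is_RInt_C_unique _ (y - r) (y + r) (RtoC PI)).
  - unfold two_PI_i. rewrite RtoC_mult. ring.
  - apply is_RInt_C_ext with (2 := is_RInt_RtoC _ _ _ _ (is_RInt_atan_kernel y r Hr)).
    intros s. specialize (Hsq (s - y)). apply injective_projections; simpl; field; nra.
  - apply is_RInt_C_ext with
      (2 := is_RInt_Cmult_l Ci _ _ _ _ (is_RInt_RtoC _ _ _ _ (is_RInt_atan_kernel x r Hr))).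
    intros s. specialize (Hsq (s - x)). apply injective_projections; simpl; field; nra.
Qed.

Lemma Cmod_rect_int_residue_le (f : C -> C) (z0 A : C) (r eps : R) : 0 < r ->
  on_square (ex_rect_int f) z0 r ->
  (forall z, on_square rect_boundary z0 r z ->
     Cmod (f z * (z - z0) - A) <= eps) ->
  Cmod (on_square (rect_int f) z0 r - two_PI_i * A) <= 8 * eps.
Proof.
  intros Hr Hf_ex Hz.
  assert (Hdist : forall z, on_square rect_boundary z0 r z ->
    r <= Cmod (z - z0)).
  { intros z. apply rect_boundary_dist; lra. }
  assert (Hinv_ex : on_square (ex_rect_int (fun z => / (z - z0))%C) z0 r).
  { apply ex_rect_int_continuous; try lra. intros z [_ Hbd]. apply continuous_Cinv_minus.
    intros ->. lra. }
  assert (HA_ex : on_square (ex_rect_int (fun z => A * / (z - z0))%C) z0 r).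
  { now apply ex_rect_int_Cmult_l. }
  rewrite <- (rect_int_Cinv z0 r Hr), Cmult_comm, <- rect_int_Cmult_l, <- rect_int_minus
    by assumption.
  replace (8 * eps) with (2 * ((Re z0 + r - (Re z0 - r)) + (Im z0 + r - (Im z0 - r))) * (eps / r))
    by (field; lra).
  apply Cmod_rect_int_le; try lra.
  - now apply ex_rect_int_minus.
  - intros z Hbd. pose proof (Hdist z Hbd).
    assert (Hne : (z - z0)%C <> 0) by (apply Cmod_gt_0; lra).
    replace (f z - A * / (z - z0))%C with ((f z * (z - z0) - A) / (z - z0))%C by (field; auto).
    rewrite Cmod_div by exact Hne. apply Rmult_le_compat; auto using Cmod_ge_0.
    + left. apply Rinv_0_lt_compat. lra.
    + apply Rinv_le_contravar; lra.
Qed.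

Theorem rect_int_residue (f : C -> C) (z0 A : C) (a b c d : R) : a < Re z0 < b -> c < Im z0 < d ->
  (forall z, rect a b c d z -> z <> z0 -> ex_derive f z) -> is_simple_residue f z0 A ->
  rect_int f a b c d = (two_PI_i * A)%C.
Proof.
  intros Hx Hy Hf HA. apply Ceq_minus, Cmod_eq_0, Rle_antisym; [|apply Cmod_ge_0].
  apply le_epsilon. intros eps He. rewrite Rplus_0_l.
  destruct (is_simple_residue_Cmod f z0 A HA (eps / 8) ltac:(lra)) as [delta Hdelta].
  destruct (rect_interior_radius a b c d (Re z0) (Im z0) (delta / 2) Hx Hy) as [r Hr].
  { pose proof (cond_pos delta). lra. }
  assert (Hne : forall z,
    ~ (Re z0 - r < Re z < Re z0 + r /\ Im z0 - r < Im z < Im z0 + r) -> z <> z0).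
  { intros z Hz ->. apply Hz. lra. }
  rewrite (rect_int_shrink f a b c d (Re z0 - r) (Re z0 + r) (Im z0 - r) (Im z0 + r))
    by (try lra; intros z Hz Hout; apply Hf, Hne; auto).
  replace eps with (8 * (eps / 8)) by field. apply Cmod_rect_int_residue_le; [lra| |].
  - apply ex_rect_int_continuous; try lra. intros z [[] Hbd].
    apply ex_derive_continuous_C, Hf; [unfold rect; lra|]. intros ->. lra.
  - intros z [[Hzx Hzy] Hbd]. apply Rlt_le, Hdelta; [intros ->; lra|].
    eapply Rle_lt_trans; [apply Cmod_le_Re_Im|]. rewrite re_minus, im_minus.
    apply Rle_lt_trans with (r + r); [|lra]. apply Rplus_le_compat; apply Rabs_le; lra.
Qed.

Theorem Cauchy_integral_formula (f : C -> C) (z0 : C) (a b c d : R) : a < Re z0 < b ->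
  c < Im z0 < d ->
  (forall z, rect a b c d z -> ex_derive f z) ->
  rect_int (fun z => f z / (z - z0))%C a b c d = (two_PI_i * f z0)%C.
Proof.
  intros Hx Hy Hf. apply rect_int_residue with z0; auto.
  - intros z Hz Hne. apply ex_derive_Cdiv; auto with holomorphic. now apply Cminus_eq_contra.
  - replace (f z0) with (f z0 / RtoC 1)%C by field.
    apply (is_simple_residue_div f (fun z => z - z0)%C).
    + apply ex_derive_continuous_C, Hf. unfold rect. lra.
    + apply (is_derive_Cminus_const (fun z => z)), is_derive_C_id.
    + ring.
    + exact C1_nz.
Qed.

(** * Locally uniform limits of holomorphic functions *)

Definition uniform_limit_on (D : C -> Prop) (f : nat -> C -> C) (g : C -> C) : Prop :=
  forall eps, 0 < eps -> exists N, forall n z, (N <= n)%nat -> D z -> Cmod (f n z - g z) < eps.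

Lemma uniform_limit_on_Cmult_r (D : C -> Prop) (f : nat -> C -> C) (g h : C -> C) (M : R) :
  (forall z, D z -> Cmod (h z) <= M) -> uniform_limit_on D f g ->
  uniform_limit_on D (fun n z => f n z * h z)%C (fun z => g z * h z)%C.
Proof.
  intros HM Hfg eps He.
  assert (HM' : 0 < Rabs M + 1) by (pose proof (Rabs_pos M); lra).
  destruct (Hfg (eps / (Rabs M + 1))) as [N HN]; [now apply Rdiv_lt_0_compat|].
  exists N. intros n z Hn Hz. specialize (HN n z Hn Hz). apply Rlt_div_r in HN; [|exact HM'].
  replace (f n z * h z - g z * h z)%C with ((f n z - g z) * h z)%C by ring. rewrite Cmod_mult.
  eapply Rle_lt_trans; [|exact HN]. apply Rmult_le_compat_l; [apply Cmod_ge_0|].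
  eapply Rle_trans; [now apply HM|]. pose proof (Rle_abs M). lra.
Qed.

Lemma filterlim_rect_int (f : nat -> C -> C) (g : C -> C) (a b c d : R) : a <= b -> c <= d ->
  (forall n, ex_rect_int (f n) a b c d) -> ex_rect_int g a b c d ->
  uniform_limit_on (rect_boundary a b c d) f g ->
  filterlim (fun n => rect_int (f n) a b c d) eventually (locally (rect_int g a b c d)).
Proof.
  intros Hab Hcd Hf_ex Hg_ex Hlim. apply filterlim_C_Cmod. intros eps He.
  set (p := 2 * ((b - a) + (d - c)) + 1). assert (Hp : 0 < p) by (unfold p; lra).
  destruct (Hlim (eps / p)) as [N HN]; [now apply Rdiv_lt_0_compat|].
  exists N. intros n Hn. rewrite <- rect_int_minus by auto.
  assert (Hep : 0 < eps / p) by now apply Rdiv_lt_0_compat.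
  apply Rle_lt_trans with (2 * ((b - a) + (d - c)) * (eps / p)).
  - apply Cmod_rect_int_le; auto.
    + now apply ex_rect_int_minus.
    + intros z Hz. apply Rlt_le. auto.
  - replace eps with (p * (eps / p)) at 2 by (field; lra).
    apply Rmult_lt_compat_r; [exact Hep|unfold p; lra].
Qed.

Lemma Cmod_Cauchy_kernel_remainder_le (k w z z0 : C) (r : R) :
  0 < r -> r <= Cmod (w - z0) -> Cmod (z - z0) <= r / 2 ->
  Cmod (k / (w - z) - k / (w - z0) - (z - z0) * (k / ((w - z0) * (w - z0)))) <=
  Cmod k * (2 / (r * r * r)) * (Cmod (z - z0) * Cmod (z - z0)).
Proof.
  intros Hr Hw0 Hz.
  assert (Hw : r / 2 <= Cmod (w - z)).
  { replace (w - z)%C with ((w - z0) - (z - z0))%C by ring.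
    eapply Rle_trans; [|apply Cmod_triangle_inv]. lra. }
  assert (Hn0 : (w - z0)%C <> 0) by (apply Cmod_gt_0; lra).
  assert (Hn : (w - z)%C <> 0) by (apply Cmod_gt_0; lra).
  assert (Hnn : ((w - z) * ((w - z0) * (w - z0)))%C <> 0) by (repeat apply Cmult_neq_0; auto).
  replace (k / (w - z) - k / (w - z0) - (z - z0) * (k / ((w - z0) * (w - z0))))%C
    with (k / ((w - z) * ((w - z0) * (w - z0))) * ((z - z0) * (z - z0)))%C by (field; auto).
  rewrite 2!Cmod_mult, Cmod_div, 2!Cmod_mult by exact Hnn.
  apply Rmult_le_compat_r; [apply Rmult_le_pos; apply Cmod_ge_0|].
  apply Rmult_le_compat_l; [apply Cmod_ge_0|].
  replace (2 / (r * r * r)) with (/ (r / 2 * (r * r))) by (field; lra).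
  apply Rinv_le_contravar; [repeat apply Rmult_lt_0_compat; lra|].
  apply Rmult_le_compat; [lra|nra|exact Hw|]. apply Rmult_le_compat; lra.
Qed.

Lemma ex_rect_int_Cauchy_kernel (phi h : C -> C) (a b c d : R) : a <= b -> c <= d ->
  (forall w, rect_boundary a b c d w -> continuous phi w /\ ex_derive h w /\ h w <> 0) ->
  ex_rect_int (fun w => phi w / h w)%C a b c d.
Proof.
  intros Hab Hcd Hker. apply ex_rect_int_continuous; auto. intros w Hw.
  destruct (Hker w Hw) as (Hphi & Hh & Hh_neq). apply continuous_Cmult; [exact Hphi|].
  apply ex_derive_continuous_C, (ex_derive_Ccomp Cinv); [|exact Hh].
  eexists. now apply is_derive_Cinv.
Qed.

Lemma Cmod_Cauchy_integral_remainder_le (phi : C -> C) (z z0 : C) (a b c d r M : R) :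
  a <= b -> c <= d -> 0 < r -> Cmod (z - z0) <= r / 2 ->
  (forall w, rect_boundary a b c d w ->
    continuous phi w /\ Cmod (phi w) <= M /\ r <= Cmod (w - z0)) ->
  Cmod (rect_int (fun w => phi w / (w - z))%C a b c d
    - rect_int (fun w => phi w / (w - z0))%C a b c d
    - rect_int (fun w => phi w / ((w - z0) * (w - z0)))%C a b c d * (z - z0)) <=
  2 * ((b - a) + (d - c)) * (M * (2 / (r * r * r)) * (Cmod (z - z0) * Cmod (z - z0))).
Proof.
  intros Hab Hcd Hr Hz Hw.
  assert (Hne : forall v w, Cmod (v - z0) <= r / 2 -> rect_boundary a b c d w -> (w - v)%C <> 0).
  { intros v w Hv Hbd. apply Cmod_gt_0. destruct (Hw w Hbd) as (_ & _ & Hdist).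
    replace (w - v)%C with ((w - z0) - (v - z0))%C by ring.
    eapply Rlt_le_trans; [|apply Cmod_triangle_inv]. lra. }
  assert (Hz0 : Cmod (z0 - z0) <= r / 2) by (unfold Cminus; rewrite Cplus_opp_r, Cmod_0; lra).
  assert (Hex : forall v, Cmod (v - z0) <= r / 2 ->
    ex_rect_int (fun w => phi w / (w - v))%C a b c d).
  { intros v Hv. apply ex_rect_int_Cauchy_kernel; auto. intros w Hbd.
    repeat split; [now apply Hw|auto with holomorphic|now apply Hne]. }
  assert (Hex_sq : ex_rect_int (fun w => phi w / ((w - z0) * (w - z0)))%C a b c d).
  { apply ex_rect_int_Cauchy_kernel; auto. intros w Hbd.
    repeat split; [now apply Hw|auto with holomorphic|]. apply Cmult_neq_0; now apply Hne. }
  rewrite (Cmult_comm (rect_int _ _ _ _ _)), <- rect_int_Cmult_l, <- !rect_int_minus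
    by auto using ex_rect_int_minus, ex_rect_int_Cmult_l.
  apply Cmod_rect_int_le; auto using ex_rect_int_minus, ex_rect_int_Cmult_l.
  intros w Hbd. destruct (Hw w Hbd) as (_ & HM & Hdist).
  eapply Rle_trans; [now apply (Cmod_Cauchy_kernel_remainder_le _ _ _ _ r)|].
  apply Rmult_le_compat_r; [apply Rmult_le_pos; apply Cmod_ge_0|].
  apply Rmult_le_compat_r; [|exact HM].
  apply Rlt_le, Rdiv_lt_0_compat; [lra|]. repeat apply Rmult_lt_0_compat; lra.
Qed.

Lemma is_derive_Cauchy_integral (phi : C -> C) (z0 : C) (a b c d : R) :
  a < Re z0 < b -> c < Im z0 < d -> (forall z, rect_boundary a b c d z -> continuous phi z) ->
  is_derive (fun z => rect_int (fun w => phi w / (w - z))%C a b c d) z0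
    (rect_int (fun w => phi w / ((w - z0) * (w - z0)))%C a b c d).
Proof.
  intros Hx Hy Hphi.
  destruct (rect_interior_radius a b c d (Re z0) (Im z0) 1 Hx Hy Rlt_0_1) as [r Hr].
  assert (Hphi_ex : ex_rect_int phi a b c d) by (apply ex_rect_int_continuous; auto; lra).
  destruct (ex_rect_int_bounded phi a b c d ltac:(lra) ltac:(lra) Hphi_ex) as [M [HM0 HM]].
  apply is_derive_C_Cmod. intros eps He.
  set (B := 2 * ((b - a) + (d - c)) * (M * (2 / (r * r * r)))).
  assert (HB : 0 < B).
  { repeat apply Rmult_lt_0_compat; try lra. apply Rinv_0_lt_compat.
    repeat apply Rmult_lt_0_compat; lra. }
  assert (Hd : 0 < Rmin (r / 2) (eps / B)) by (apply Rmin_pos; [lra|now apply Rdiv_lt_0_compat]).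
  exists (mkposreal _ Hd). simpl. intros z Hz.
  assert (Hz_r := Rlt_le_trans _ _ _ Hz (Rmin_l _ _)).
  assert (Hz_eps := Rlt_le_trans _ _ _ Hz (Rmin_r _ _)). apply Rlt_div_r in Hz_eps; [|exact HB].
  apply Rle_trans with (B * (Cmod (z - z0) * Cmod (z - z0))).
  - unfold B. rewrite Rmult_assoc. apply Cmod_Cauchy_integral_remainder_le; try lra.
    intros w Hw. repeat split; [auto|auto|]. apply (rect_boundary_dist a b c d); auto; lra.
  - pose proof (Cmod_ge_0 (z - z0)). nra.
Qed.

Lemma uniform_limit_on_subset (D E : C -> Prop) (f : nat -> C -> C) (g : C -> C) :
  (forall z, E z -> D z) -> uniform_limit_on D f g -> uniform_limit_on E f g.
Proof. intros HED H eps He. destruct (H eps He) as [N HN]. exists N. auto. Qed.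

Lemma uniform_limit_on_continuous (f : nat -> C -> C) (g : C -> C) (z0 : C) (r : R) : 0 < r ->
  (forall n, continuous (f n) z0) -> uniform_limit_on (fun z => Cmod (z - z0) < r) f g ->
  continuous g z0.
Proof.
  intros Hr Hf Hlim. apply (continuous_locally_uniform_limit (V := C_NormedModule) f); [exact Hf|].
  intros eps. destruct (Hlim eps (cond_pos eps)) as [N HN]. exists N.
  apply locally_C_Cmod. exists (mkposreal r Hr). intros z Hz. exact (HN N z (Nat.le_refl N) Hz).
Qed.

Lemma Cauchy_integral_formula_uniform_limit (f : nat -> C -> C) (g : C -> C) (z0 : C)
    (a b c d : R) :
  a < Re z0 < b -> c < Im z0 < d -> (forall n z, rect a b c d z -> ex_derive (f n) z) ->
  (forall z, rect_boundary a b c d z -> continuous g z) -> uniform_limit_on (rect a b c d) f g ->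
  rect_int (fun z => g z / (z - z0))%C a b c d = (two_PI_i * g z0)%C.
Proof.
  intros Hx Hy Hf Hg Hlim.
  assert (Hne : forall z, rect_boundary a b c d z -> (z - z0)%C <> 0).
  { intros z [_ Hz]. apply Cminus_eq_contra. intros ->. lra. }
  assert (Hker_ex : forall phi, (forall z, rect_boundary a b c d z -> continuous phi z) ->
    ex_rect_int (fun z => phi z / (z - z0))%C a b c d).
  { intros phi Hphi. apply ex_rect_int_Cauchy_kernel; try lra.
    intros z Hz. repeat split; auto with holomorphic. }
  assert (Hf_ex : forall n, ex_rect_int (fun z => f n z / (z - z0))%C a b c d).
  { intros n. apply Hker_ex. intros z [Hz _]. now apply ex_derive_continuous_C, Hf. }
  destruct (ex_rect_int_bounded (fun z => 1 / (z - z0))%C a b c d) as [M [_ HM]]; try lra.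
  { apply Hker_ex. intros. apply continuous_const. }
  apply (filterlim_locally_unique (V := C_NormedModule) (F := eventually)
    (fun n => rect_int (fun z => f n z / (z - z0))%C a b c d)).
  - apply filterlim_rect_int; try lra; auto.
    apply uniform_limit_on_Cmult_r with M.
    + intros z Hz. specialize (HM z Hz). unfold Cdiv in HM. now rewrite Cmult_1_l in HM.
    + apply (uniform_limit_on_subset (rect a b c d)); [now intros z []|exact Hlim].
  - apply filterlim_ext with (fun n => two_PI_i * f n z0)%C.
    { intros n. symmetry. apply Cauchy_integral_formula; auto. }
    apply filterlim_Cmult; [apply filterlim_const|]. apply filterlim_C_Cmod. intros eps He.
    destruct (Hlim eps He) as [N HN]. exists N. intros n Hn. apply HN; [exact Hn|]. split; lra.
Qed.

(* Weierstrass: the limit inherits Cauchy's formula on a square, and the integral in the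
   formula is differentiable whatever the continuous boundary values. *)
Theorem uniform_limit_ex_derive (f : nat -> C -> C) (g : C -> C) (z0 : C) (r : R) : 0 < r ->
  (forall n z, Cmod (z - z0) < r -> ex_derive (f n) z) ->
  uniform_limit_on (fun z => Cmod (z - z0) < r) f g -> ex_derive g z0.
Proof.
  intros Hr Hf Hlim. set (h := r / 3). assert (Hh : 0 < h) by (unfold h; lra).
  set (a := Re z0 - h). set (b := Re z0 + h). set (c := Im z0 - h). set (d := Im z0 + h).
  assert (Hball : forall z, rect a b c d z -> Cmod (z - z0) < r).
  { intros z [Hzx Hzy]. eapply Rle_lt_trans; [apply Cmod_le_Re_Im|]. rewrite re_minus, im_minus.
    apply Rle_lt_trans with (h + h); [|unfold h; lra].
    apply Rplus_le_compat; apply Rabs_le; unfold a, b, c, d in *; lra. }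
  assert (Hg : forall z, rect_boundary a b c d z -> continuous g z).
  { intros z [Hz _]. specialize (Hball z Hz).
    apply (uniform_limit_on_continuous f g z (r - Cmod (z - z0))); [lra| |].
    - intros n. now apply ex_derive_continuous_C, Hf.
    - apply (uniform_limit_on_subset (fun w => Cmod (w - z0) < r)); [|exact Hlim].
      intros w Hw. replace (w - z0)%C with ((w - z) + (z - z0))%C by ring.
      eapply Rle_lt_trans; [apply Cmod_triangle|]. lra. }
  apply ex_derive_ext_loc with
    (fun z => / two_PI_i * rect_int (fun w => g w / (w - z)) a b c d)%C.
  - exists (mkposreal h Hh). intros z Hz. change (Cmod (z - z0) < h) in Hz.
    assert (HRe := re_le_Cmod (z - z0)). assert (HIm := Im_le_Cmod (z - z0)).
    apply Rabs_le_between in HRe, HIm. rewrite re_minus in HRe. rewrite im_minus in HIm.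
    rewrite (Cauchy_integral_formula_uniform_limit f g); auto; try (unfold a, b, c, d; lra).
    + rewrite Cmult_assoc, Cinv_l by exact two_PI_i_neq_0. apply Cmult_1_l.
    + now apply (uniform_limit_on_subset (fun z => Cmod (z - z0) < r)).
  - apply ex_derive_Cmult; [apply ex_derive_C_const|]. eexists.
    apply is_derive_Cauchy_integral; [unfold a, b; lra|unfold c, d; lra|exact Hg].
Qed.

(** * Improper integrals *)

Lemma is_RInt_gen_filterlim {V : CompleteNormedModule R_AbsRing} {Fa Fb : (R -> Prop) -> Prop}
    {FFa : Filter Fa} {FFb : Filter Fb} (f : R -> V) (l : V) :
  (forall a b, ex_RInt f a b) ->
  (is_RInt_gen f Fa Fb l <->
   filterlim (fun ab => RInt f (fst ab) (snd ab)) (filter_prod Fa Fb) (locally l)).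
Proof.
  intros Hf. split; intros H P HP; specialize (H P HP); unfold filtermapi, filtermap in *.
  - apply filter_imp with (2 := H). intros [a b] [y [Hy HPy]].
    now rewrite (is_RInt_unique _ _ _ _ Hy).
  - apply filter_imp with (2 := H). intros [a b] HPy.
    exists (RInt f a b). split; [now apply RInt_correct|exact HPy].
Qed.

Lemma is_RInt_gen_comp {V : NormedModule R_AbsRing} {Fa Fb Ga Gb : (R -> Prop) -> Prop}
    {FFa : Filter Fa} {FFb : Filter Fb} (f g : R -> V) (u : R -> R) (l : V) :
  filterlim u Fa Ga -> filterlim u Fb Gb ->
  filter_prod Fa Fb (fun ab => forall y,
    is_RInt f (u (fst ab)) (u (snd ab)) y -> is_RInt g (fst ab) (snd ab) y) ->
  is_RInt_gen f Ga Gb l -> is_RInt_gen g Fa Fb l.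
Proof.
  intros Hua Hub Hfg Hf P HP. destruct (Hf P HP) as [Q S HQ HS HP'].
  assert (Hu : filter_prod Fa Fb (fun ab => Q (u (fst ab)) /\ S (u (snd ab)))).
  { exists (fun a => Q (u a)) (fun b => S (u b)); [now apply Hua|now apply Hub|auto]. }
  unfold filtermapi. generalize (filter_and _ _ Hfg Hu). apply filter_imp.
  intros [a b] [Hab [Ha Hb]].
  destruct (HP' _ _ Ha Hb) as [y [Hy HPy]]. exists y. split; [now apply Hab|exact HPy].
Qed.

Lemma is_RInt_gen_map {V W : NormedModule R_AbsRing} {Fa Fb : (R -> Prop) -> Prop}
    {FFa : Filter Fa} {FFb : Filter Fb} (T : V -> W) (f : R -> V) (g : R -> W) (l : V) :
  continuous T l -> (forall a b y, is_RInt f a b y -> is_RInt g a b (T y)) ->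
  is_RInt_gen f Fa Fb l -> is_RInt_gen g Fa Fb (T l).
Proof.
  intros HT Hfg Hf P HP. specialize (Hf _ (HT P HP)). unfold filtermapi in *.
  apply filter_imp with (2 := Hf).
  intros [a b] [y [Hy HPy]]. exists (T y). auto.
Qed.

Lemma norm_is_RInt_le_Rabs {V : NormedModule R_AbsRing} (f : R -> V) (g : R -> R) (a b : R)
    (l : V) (m : R) :
  (forall x, norm (f x) <= g x) -> is_RInt f a b l -> is_RInt g a b m -> norm l <= Rabs m.
Proof.
  intros Hfg Hf Hg. destruct (Rle_dec a b) as [Hab|Hab].
  - eapply Rle_trans; [|apply Rle_abs]. now apply (norm_RInt_le f g a b).
  - rewrite <- norm_opp, <- Rabs_Ropp. eapply Rle_trans; [|apply Rle_abs].
    apply (norm_RInt_le f g b a); [lra|auto|now apply is_RInt_swap|exact (is_RInt_swap _ _ _ _ Hg)].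
Qed.

Lemma minus_plus_common {G : AbelianGroup} (x y z : G) : minus (plus y z) (plus x y) = minus z x.
Proof.
  unfold minus. rewrite opp_plus, (plus_comm (opp x)), plus_assoc, (plus_comm y z).
  now rewrite <- (plus_assoc z), plus_opp_r, plus_zero_r.
Qed.

Lemma norm_minus_plus_is_RInt_le {V : NormedModule R_AbsRing} (f : R -> V) (g : R -> R)
    (a a' b b' : R) (x y z : V) (p q : R) :
  (forall t, norm (f t) <= g t) -> is_RInt f a a' x -> is_RInt f b b' z ->
  is_RInt g a a' p -> is_RInt g b b' q ->
  norm (minus (plus y z) (plus x y)) <= Rabs p + Rabs q.
Proof.
  intros Hfg Hx Hz Hp Hq.
  replace (minus (plus y z) (plus x y)) with (minus z x)
    by exact (eq_sym (minus_plus_common (G := NormedModule.AbelianGroup R_AbsRing V) x y z)).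
  eapply Rle_trans; [apply norm_triangle|]. rewrite norm_opp, Rplus_comm.
  apply Rplus_le_compat;
    [now apply (norm_is_RInt_le_Rabs f g a a')|now apply (norm_is_RInt_le_Rabs f g b b')].
Qed.

Lemma ex_RInt_gen_dominated {V : CompleteNormedModule R_AbsRing} {Fa Fb : (R -> Prop) -> Prop}
    {FFa : ProperFilter Fa} {FFb : ProperFilter Fb} (f : R -> V) (g : R -> R) :
  (forall a b, ex_RInt f a b) -> (forall a b, ex_RInt g a b) -> (forall x, norm (f x) <= g x) ->
  ex_RInt_gen g Fa Fb -> ex_RInt_gen f Fa Fb.
Proof.
  intros Hf Hg Hfg [m Hm]. apply (is_RInt_gen_filterlim (V := R_CompleteNormedModule)) in Hm;
    [|exact Hg].
  assert (HC := proj2 (filterlim_locally_cauchy (F := filter_prod Fa Fb) _) (ex_intro _ m Hm)).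
  destruct (proj1 (filterlim_locally_cauchy (F := filter_prod Fa Fb)
    (fun ab => RInt f (fst ab) (snd ab)))) as [l Hl].
  2:{ exists l. now apply is_RInt_gen_filterlim. }
  intros eps. assert (He : 0 < eps / 2) by (pose proof (cond_pos eps); lra).
  destruct (HC (mkposreal _ He)) as [P [[Q S HQ HS HQS] HP]].
  exists (fun ab => Q (fst ab) /\ S (snd ab)).
  split; [now exists Q S|]. intros [a b] [a' b'] [Ha Hb] [Ha' Hb']. simpl in *.
  assert (Hga := HP _ _ (HQS a' b Ha' Hb) (HQS a b Ha Hb)).
  assert (Hgb := HP _ _ (HQS a' b Ha' Hb) (HQS a' b' Ha' Hb')).
  change (Rabs (RInt g a b - RInt g a' b) < eps / 2) in Hga.
  change (Rabs (RInt g a' b' - RInt g a' b) < eps / 2) in Hgb.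
  assert (Chasles : forall p q r, RInt g p q + RInt g q r = RInt g p r).
  { intros p q r. exact (RInt_Chasles g p q r (Hg p q) (Hg q r)). }
  rewrite <- (Chasles a a' b), Rplus_minus_r in Hga.
  rewrite <- (Chasles a' b b'), Rplus_minus_l in Hgb.
  rewrite <- (RInt_Chasles f a a' b), <- (RInt_Chasles f a' b b') by auto.
  refine (norm_compat1 (V := V) _ _ _ _). simpl.
  apply Rle_lt_trans with (Rabs (RInt g a a') + Rabs (RInt g b b')); [|lra].
  exact (norm_minus_plus_is_RInt_le f g a a' b b' _ _ _ _ _ Hfg (RInt_correct _ _ _ (Hf _ _))
    (RInt_correct _ _ _ (Hf _ _)) (RInt_correct _ _ _ (Hg _ _)) (RInt_correct _ _ _ (Hg _ _))).
Qed.

(** * Integrals over the real line *)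

Notation is_RInt_line f l :=
  (is_RInt_gen (V := C_R_NormedModule) f (Rbar_locally m_infty) (Rbar_locally p_infty) l).

Lemma is_RInt_line_unique (f : R -> C) (l m : C) : is_RInt_line f l -> is_RInt_line f m -> l = m.
Proof.
  intros Hl Hm. rewrite <- (is_RInt_gen_unique (V := C_R_CompleteNormedModule) f l Hl).
  now apply (is_RInt_gen_unique (V := C_R_CompleteNormedModule)).
Qed.

Lemma is_RInt_line_ext (f g : R -> C) (l : C) :
  (forall x, f x = g x) -> is_RInt_line f l -> is_RInt_line g l.
Proof.
  intros H. apply is_RInt_gen_ext. apply filter_forall. auto.
Qed.

Lemma is_RInt_line_plus (f g : R -> C) (l m : C) :
  is_RInt_line f l -> is_RInt_line g m -> is_RInt_line (fun x => f x + g x)%C (l + m)%C.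
Proof. exact (is_RInt_gen_plus (V := C_R_NormedModule) f g l m). Qed.

Lemma is_RInt_line_minus (f g : R -> C) (l m : C) :
  is_RInt_line f l -> is_RInt_line g m -> is_RInt_line (fun x => f x - g x)%C (l - m)%C.
Proof. exact (is_RInt_gen_minus (V := C_R_NormedModule) f g l m). Qed.

Lemma is_RInt_line_Cmult_l (k : C) (f : R -> C) (l : C) :
  is_RInt_line f l -> is_RInt_line (fun x => k * f x)%C (k * l)%C.
Proof.
  apply (is_RInt_gen_map (V := C_R_NormedModule) (W := C_R_NormedModule) (Cmult k)).
  - apply (continuous_Cmult (fun _ => k) (fun z : C => z));
      [apply continuous_const|apply continuous_id].
  - intros. now apply is_RInt_Cmult_l.
Qed.

Lemma is_RInt_line_conj (f : R -> C) (l : C) :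
  is_RInt_line f l -> is_RInt_line (fun x => Cconj (f x)) (Cconj l).
Proof.
  apply (is_RInt_gen_map (V := C_R_NormedModule) (W := C_R_NormedModule) Cconj).
  - apply continuous_Cconj.
  - apply is_RInt_Cconj.
Qed.

Lemma filterlim_plus_m_infty (k : R) :
  filterlim (fun x => x + k) (Rbar_locally m_infty) (Rbar_locally m_infty).
Proof. intros P [M HM]. exists (M - k). intros x Hx. apply HM. lra. Qed.

Lemma filterlim_plus_p_infty (k : R) :
  filterlim (fun x => x + k) (Rbar_locally p_infty) (Rbar_locally p_infty).
Proof. intros P [M HM]. exists (M - k). intros x Hx. apply HM. lra. Qed.

Lemma filterlim_INR_plus_p_infty (k : R) :
  filterlim (fun n => INR n + k) eventually (Rbar_locally p_infty).
Proof.
  apply (filterlim_comp _ _ _ INR (fun x => x + k) _ (Rbar_locally p_infty));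
    [apply is_lim_seq_INR|apply filterlim_plus_p_infty].
Qed.

Lemma is_RInt_line_shift_real (f : R -> C) (k : R) (l : C) :
  is_RInt_line f l -> is_RInt_line (fun x => f (x + k)) l.
Proof.
  apply is_RInt_gen_comp with (u := fun x => x + k);
    [apply filterlim_plus_m_infty|apply filterlim_plus_p_infty|].
  apply filter_forall. intros [a b] y. apply is_RInt_comp_plus.
Qed.

Lemma is_RInt_line_scale (f : R -> C) (k : R) (l : C) : 0 < k ->
  is_RInt_line f l -> is_RInt_line (fun x => RtoC k * f (k * x)%R)%C l.
Proof.
  intros Hk. apply is_RInt_gen_comp with (u := fun x => k * x).
  - intros P [M HM]. exists (M / k). intros x Hx. apply Rlt_div_r in Hx; [|exact Hk].
    apply HM. lra.
  - intros P [M HM]. exists (M / k). intros x Hx. apply Rlt_div_l in Hx; [|exact Hk].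
    apply HM. lra.
  - apply filter_forall. intros [a b] y Hy. simpl in *.
    apply is_RInt_C_ext with (fun x => scal (V := C_R_NormedModule) k (f (k * x + 0))).
    { intros x. now rewrite Rplus_0_r, scal_R_Cmult. }
    apply (is_RInt_comp_lin (V := C_R_NormedModule)). now rewrite !Rplus_0_r.
Qed.

Lemma is_RInt_line_reflect (f : R -> C) (l : C) :
  is_RInt_line f l -> is_RInt_line (fun x => f (- x)) l.
Proof.
  intros H. apply is_RInt_gen_swap, is_RInt_gen_opp in H; try apply Rbar_locally_filter.
  rewrite opp_opp in H. revert H.
  apply is_RInt_gen_comp with (u := Ropp).
  - exact (filterlim_Rbar_opp m_infty).
  - exact (filterlim_Rbar_opp p_infty).
  - apply filter_forall. intros [a b] y Hy. simpl in *.
    apply is_RInt_comp_opp in Hy. apply is_RInt_ext with (2 := Hy). intros x _. apply opp_opp.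
Qed.

Lemma Cmod_is_RInt_line_le (f : R -> C) (g : R -> R) (l : C) (m : R) :
  (forall x, Cmod (f x) <= g x) -> is_RInt_line f l ->
  is_RInt_gen g (Rbar_locally m_infty) (Rbar_locally p_infty) m -> Cmod l <= m.
Proof.
  intros Hfg Hf Hg. rewrite <- norm_C_R.
  apply (RInt_gen_norm (V := C_R_CompleteNormedModule)
    (Fa := Rbar_locally m_infty) (Fb := Rbar_locally p_infty) f g l m); auto.
  - exists (fun a => a < 0) (fun b => 0 < b); [now exists 0|now exists 0|]. simpl. intros. lra.
  - apply filter_forall. intros ab x _. rewrite norm_C_R. apply Hfg.
Qed.

Lemma is_RInt_exp_Rabs (c a b : R) : 0 < c -> a <= 0 <= b ->
  is_RInt (fun x => exp (- (c * Rabs x))) a b (2 / c - (exp (c * a) + exp (- (c * b))) / c).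
Proof.
  intros Hc Hab.
  replace (2 / c - (exp (c * a) + exp (- (c * b))) / c)
    with ((exp (c * 0) / c - exp (c * a) / c) + (- exp (- (c * b)) / c - - exp (- (c * 0)) / c)).
  2:{ rewrite Rmult_0_r, Ropp_0, exp_0. field. lra. }
  apply (is_RInt_Chasles (V := R_NormedModule) _ a 0 b).
  - apply is_RInt_ext with (fun x => exp (c * x)).
    { rewrite Rmin_left, Rmax_right by lra. intros x Hx. rewrite Rabs_left1 by lra. f_equal. ring. }
    apply (is_RInt_derive (fun x => exp (c * x) / c)); intros x _.
    + auto_derive; [lra|]. field. lra.
    + apply (ex_derive_continuous (V := R_NormedModule)). now auto_derive.
  - apply is_RInt_ext with (fun x => exp (- (c * x))).
    { rewrite Rmin_left, Rmax_right by lra. intros x Hx. now rewrite Rabs_pos_eq by lra. }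
    apply (is_RInt_derive (fun x => - exp (- (c * x)) / c)); intros x _.
    + auto_derive; [lra|]. field. lra.
    + apply (ex_derive_continuous (V := R_NormedModule)). now auto_derive.
Qed.

Lemma is_RInt_gen_exp_Rabs (c : R) : 0 < c ->
  is_RInt_gen (fun x => exp (- (c * Rabs x))) (Rbar_locally m_infty) (Rbar_locally p_infty) (2 / c).
Proof.
  intros Hc. apply (filterlimi_locally (U := R_UniformSpace)). intros eps.
  assert (He : 0 < eps * c / 2).
  { pose proof (cond_pos eps). apply Rdiv_lt_0_compat; [now apply Rmult_lt_0_compat|lra]. }
  set (M := ln (eps * c / 2) / c).
  assert (HM : forall x, x < M -> exp (c * x) < eps * c / 2).
  { intros x Hx. rewrite <- (exp_ln (eps * c / 2)) by exact He. apply exp_increasing.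
    unfold M in Hx. apply Rlt_div_r in Hx; lra. }
  exists (fun a => a < Rmin 0 M) (fun b => Rmax 0 (- M) < b);
    [now exists (Rmin 0 M)|now exists (Rmax 0 (- M))|].
  intros a b Ha Hb. simpl.
  pose proof (Rlt_le_trans _ _ _ Ha (Rmin_l _ _)).
  assert (HaM := Rlt_le_trans _ _ _ Ha (Rmin_r _ _)).
  pose proof (Rle_lt_trans _ _ _ (Rmax_l _ _) Hb).
  pose proof (Rle_lt_trans _ _ _ (Rmax_r _ _) Hb).
  exists (2 / c - (exp (c * a) + exp (- (c * b))) / c). split; [apply is_RInt_exp_Rabs; lra|].
  pose proof (HM a HaM). assert (Hexp_b := HM (- b) ltac:(lra)).
  rewrite Ropp_mult_distr_r_reverse in Hexp_b.
  pose proof (exp_pos (c * a)). pose proof (exp_pos (- (c * b))).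
  change (Rabs (2 / c - (exp (c * a) + exp (- (c * b))) / c - 2 / c) < eps).
  replace (2 / c - (exp (c * a) + exp (- (c * b))) / c - 2 / c)
    with (- ((exp (c * a) + exp (- (c * b))) / c)) by (field; lra).
  rewrite Rabs_Ropp, Rabs_pos_eq by (apply Rdiv_le_0_compat; lra). apply Rlt_div_l; lra.
Qed.

Lemma ex_RInt_line_exp_bound (f : R -> C) (K c : R) : 0 < c -> (forall x, continuous f x) ->
  (forall x, Cmod (f x) <= K * exp (- (c * Rabs x))) ->
  exists l, is_RInt_line f l /\ Cmod l <= K * (2 / c).
Proof.
  intros Hc Hf HK. set (g := fun x => scal K (exp (- (c * Rabs x)))).
  assert (Hg : is_RInt_gen g (Rbar_locally m_infty) (Rbar_locally p_infty) (scal K (2 / c))).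
  { exact (is_RInt_gen_scal (V := R_NormedModule) _ K _ (is_RInt_gen_exp_Rabs c Hc)). }
  assert (Hex : exists l, is_RInt_line f l).
  { apply (ex_RInt_gen_dominated (V := C_R_CompleteNormedModule) f g).
    - intros a b. apply (ex_RInt_continuous (V := C_R_CompleteNormedModule)). auto.
    - intros a b. apply (ex_RInt_continuous (V := R_CompleteNormedModule)). intros x _.
      apply (continuous_scal_r (V := R_NormedModule) K), continuous_comp; [|apply continuous_exp].
      apply (continuous_opp (V := R_NormedModule)), (continuous_scal_r (V := R_NormedModule) c).
      apply continuous_Rabs.
    - intros x. change (norm (V := C_R_NormedModule) (f x) <= g x). rewrite norm_C_R. apply HK.
    - now exists (scal K (2 / c)). }
  destruct Hex as [l Hl]. exists l. split; [exact Hl|].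
  now apply (Cmod_is_RInt_line_le f g).
Qed.

Lemma ex_RInt_line_exp_decay (f : R -> C) (T K c : R) : 0 < c -> (forall x, continuous f x) ->
  (forall x, T <= Rabs x -> Cmod (f x) <= K * exp (- (c * Rabs x))) ->
  exists l : C, is_RInt_line f l.
Proof.
  intros Hc Hf HK.
  destruct (bounded_continuity (V := C_R_NormedModule) f (- T) T) as [M HM];
    [intros x _; apply Hf|].
  destruct (ex_RInt_line_exp_bound f (Rabs K + Rabs M * exp (c * T)) c Hc Hf) as [l [Hl _]].
  2: now exists l.
  intros x. rewrite Rmult_plus_distr_r.
  pose proof (exp_pos (- (c * Rabs x))). pose proof (exp_pos (c * T)).
  pose proof (Rle_abs K). pose proof (Rle_abs M).
  pose proof (Rabs_pos K). pose proof (Rabs_pos M).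
  destruct (Rle_lt_dec T (Rabs x)) as [Hx|Hx].
  - specialize (HK x Hx). assert (0 <= Rabs M * exp (c * T) * exp (- (c * Rabs x))).
    { repeat apply Rmult_le_pos; lra. }
    nra.
  - assert (Hx' := Rlt_le _ _ Hx). apply Rabs_le_between in Hx'.
    specialize (HM x Hx'). rewrite norm_C_R in HM.
    assert (Hge1 : 1 <= exp (c * T) * exp (- (c * Rabs x))).
    { rewrite <- exp_plus, <- exp_0. apply exp_le_compat. nra. }
    assert (0 <= Rabs K * exp (- (c * Rabs x))) by (apply Rmult_le_pos; lra).
    rewrite Rmult_assoc. nra.
Qed.

(** * Shifting the line of integration *)

Definition vanishes_in_strip (f : C -> C) (c d : R) : Prop :=
  forall eps, 0 < eps -> exists T, forall z, T <= Rabs (Re z) -> c <= Im z <= d ->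
    Cmod (f z) <= eps.

Lemma exp_decay_vanishes_in_strip (f : C -> C) (c d T K k : R) : 0 < k ->
  (forall z, T <= Rabs (Re z) -> c <= Im z <= d -> Cmod (f z) <= K * exp (- (k * Rabs (Re z)))) ->
  vanishes_in_strip f c d.
Proof.
  intros Hk Hf eps He. pose proof (Rabs_pos K). pose proof (Rle_abs K).
  assert (He' : 0 < eps / (Rabs K + 1)) by (apply Rdiv_lt_0_compat; lra).
  exists (Rmax T (- ln (eps / (Rabs K + 1)) / k)). intros z Hz Hz_strip.
  pose proof (Rle_trans _ _ _ (Rmax_l _ _) Hz).
  assert (Hz_far := Rle_trans _ _ _ (Rmax_r _ _) Hz).
  apply Rle_div_l in Hz_far; [|exact Hk].
  assert (Hexp : exp (- (k * Rabs (Re z))) <= eps / (Rabs K + 1)).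
  { rewrite <- (exp_ln _ He'). apply exp_le_compat. lra. }
  apply Rle_div_r in Hexp; [|lra]. pose proof (exp_pos (- (k * Rabs (Re z)))).
  eapply Rle_trans; [now apply Hf|]. nra.
Qed.

Lemma is_RInt_line_rect_int (f : C -> C) (c d T : R) (k : C) : c <= d ->
  (forall z, c <= Im z <= d -> T <= Rabs (Re z) \/ Im z = c \/ Im z = d -> continuous f z) ->
  vanishes_in_strip f c d ->
  (forall a b, a <= - T -> T <= b -> a <= b -> rect_int f a b c d = k) ->
  is_RInt_line (fun u : R => f (u, c) - f (u, d))%C k.
Proof.
  intros Hcd Hf Hvan Hk.
  assert (Hex : forall y, y = c \/ y = d -> forall a b, ex_RInt_C (fun u : R => f (u, y)) a b).
  { intros y Hy a b. apply (ex_RInt_continuous (V := C_R_CompleteNormedModule)).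
    intros u _. apply continuous_horizontal, Hf; simpl; lra. }
  apply (is_RInt_gen_filterlim (V := C_R_CompleteNormedModule)).
  { intros a b. apply (ex_RInt_minus (V := C_R_NormedModule)); auto. }
  apply filterlim_C_Cmod. intros eps He. set (e := eps / (2 * (d - c) + 1)).
  assert (Hp : 0 < e) by (apply Rdiv_lt_0_compat; lra).
  destruct (Hvan e Hp) as [T0 HT0].
  assert (Hside : forall x, Rabs T + Rabs T0 <= Rabs x ->
    Cmod (RInt_C (fun y : R => f (x, y)) c d) <= (d - c) * e).
  { intros x Hx. assert (PT := Rabs_pos T). assert (PT1 := Rabs_pos T0).
    assert (LT := Rle_abs T). pose proof (Rle_abs T0).
    apply Cmod_RInt_le_const; [exact Hcd| |].
    - apply ex_RInt_vertical; [exact Hcd|]. intros y Hy. apply Hf; simpl; lra.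
    - intros y Hy. apply HT0; simpl; lra. }
  pose proof (Rabs_pos T). pose proof (Rabs_pos T0). pose proof (Rle_abs T).
  exists (fun a => a < - (Rabs T + Rabs T0)) (fun b => Rabs T + Rabs T0 < b).
  { now exists (- (Rabs T + Rabs T0)). }
  { now exists (Rabs T + Rabs T0). }
  intros a b Ha Hb. simpl. rewrite RInt_Cminus by auto.
  pose proof (Hside a ltac:(rewrite (Rabs_left1 a); lra)).
  pose proof (Hside b ltac:(rewrite (Rabs_pos_eq b); lra)).
  rewrite <- (Hk a b) by lra. unfold rect_int.
  set (right := RInt_C (fun y : R => f (b, y)) c d) in *.
  set (left := RInt_C (fun y : R => f (a, y)) c d) in *.
  match goal with |- Cmod ?x < _ => replace x with (- (Ci * (right - left)))%C by ring end.
  rewrite Cmod_opp, Cmod_mult, Cmod_Ci, Rmult_1_l.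
  eapply Rle_lt_trans; [apply Cmod_triangle_minus|].
  apply Rle_lt_trans with (2 * (d - c) * e); [lra|].
  replace eps with ((2 * (d - c) + 1) * e) by (unfold e; field; lra). lra.
Qed.

Theorem is_RInt_line_residue (f : C -> C) (z0 A : C) (c d : R) : c < Im z0 < d ->
  (forall z, c <= Im z <= d -> z <> z0 -> ex_derive f z) -> is_simple_residue f z0 A ->
  vanishes_in_strip f c d ->
  is_RInt_line (fun u : R => f (u, c) - f (u, d))%C (two_PI_i * A)%C.
Proof.
  intros Hz0 Hf HA Hvan. apply is_RInt_line_rect_int with (Rabs (Re z0) + 1); try lra;
    [|exact Hvan|].
  - intros z Hz Hside. apply ex_derive_continuous_C, Hf; [exact Hz|]. intros ->. lra.
  - intros a b Ha Hb _. pose proof (Rle_abs (Re z0)). assert (Hneg := Rle_abs (- Re z0)).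
    rewrite Rabs_Ropp in Hneg. apply rect_int_residue with z0; [lra|exact Hz0| |exact HA].
    intros z [_ Hz]. now apply Hf.
Qed.

Theorem is_RInt_line_shift (f : C -> C) (c d : R) (l : C) :
  (forall z, Rmin c d <= Im z <= Rmax c d -> ex_derive f z) ->
  vanishes_in_strip f (Rmin c d) (Rmax c d) ->
  is_RInt_line (fun u : R => f (u, c)) l -> is_RInt_line (fun u : R => f (u, d)) l.
Proof.
  intros Hf Hvan Hl.
  assert (Hdiff : is_RInt_line (fun u : R => f (u, Rmin c d) - f (u, Rmax c d))%C (RtoC 0)).
  { assert (Hcd : Rmin c d <= Rmax c d) by apply Rminmax.
    apply is_RInt_line_rect_int with 0; try exact Hvan; [exact Hcd| |].
    - intros z Hz _. now apply ex_derive_continuous_C, Hf.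
    - intros a b _ _ Hab. apply Goursat; auto. intros z [_ Hz]. auto. }
  destruct (Rle_dec c d) as [Hcd|Hcd].
  - rewrite Rmin_left, Rmax_right in Hdiff by lra.
    apply is_RInt_line_ext with (fun u : R => f (u, c) - (f (u, c) - f (u, d)))%C;
      [intros u; ring|].
    replace l with (l - 0)%C by ring. now apply is_RInt_line_minus.
  - rewrite Rmin_right, Rmax_left in Hdiff by lra.
    apply is_RInt_line_ext with (fun u : R => f (u, c) + (f (u, d) - f (u, c)))%C;
      [intros u; ring|].
    replace l with (l + 0)%C by ring. now apply is_RInt_line_plus.
Qed.

(** * Poisson summation *)

Definition periodic_exp (z : C) : C := cexp (two_PI_i * z).

Lemma periodic_exp_plus (z w : C) : periodic_exp (z + w) = (periodic_exp z * periodic_exp w)%C.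
Proof. unfold periodic_exp. rewrite <- cexp_plus. f_equal. ring. Qed.

Lemma Cmod_periodic_exp (z : C) : Cmod (periodic_exp z) = exp (- (2 * PI * Im z)).
Proof. destruct z. unfold periodic_exp. rewrite Cmod_cexp. f_equal. simpl. ring. Qed.

Lemma periodic_exp_INR (n : nat) : periodic_exp (INR n) = 1.
Proof.
  unfold periodic_exp, cexp.
  replace (Re (two_PI_i * INR n)) with 0 by (unfold two_PI_i; simpl; ring).
  replace (Im (two_PI_i * INR n)) with (0 + 2 * INR n * PI) by (unfold two_PI_i; simpl; ring).
  rewrite cos_period, sin_period, exp_0, cos_0, sin_0. apply injective_projections; simpl; ring.
Qed.

Lemma periodic_exp_IZR (k : Z) : periodic_exp (IZR k) = 1.
Proof.
  destruct (Z_le_dec 0 k) as [Hk|Hk].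
  - rewrite <- (Z2Nat.id k), <- INR_IZR_INZ by exact Hk. apply periodic_exp_INR.
  - assert (Hopp : periodic_exp (IZR (- k)) = 1).
    { rewrite <- (Z2Nat.id (- k)), <- INR_IZR_INZ by lia. apply periodic_exp_INR. }
    assert (Hsum : periodic_exp (IZR k + IZR (- k)) = 1).
    { rewrite <- RtoC_plus, <- plus_IZR, Z.add_opp_diag_r. exact (periodic_exp_INR 0). }
    rewrite periodic_exp_plus, Hopp in Hsum. now rewrite Cmult_1_r in Hsum.
Qed.

Lemma periodic_exp_plus_IZR (z : C) (k : Z) : periodic_exp (z + IZR k) = periodic_exp z.
Proof. rewrite periodic_exp_plus, periodic_exp_IZR. apply Cmult_1_r. Qed.

Lemma is_derive_periodic_exp (z : C) :
  is_derive periodic_exp z (two_PI_i * periodic_exp z)%C.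
Proof. apply is_derive_cexp_linear. Qed.

Lemma cos_eq_1_small (u : R) : - PI <= u <= PI -> cos u = 1 -> u = 0.
Proof.
  intros Hu Hc. replace u with (2 * (u / 2)) in Hc by field. rewrite cos_2a_sin in Hc.
  assert (Hsin : sin (u / 2) = 0) by nra. pose proof PI_RGT_0.
  destruct (Rtotal_order u 0) as [Hu0|[Hu0|Hu0]]; [exfalso|exact Hu0|exfalso].
  - assert (Hpos := sin_gt_0 (- (u / 2)) ltac:(lra) ltac:(lra)). rewrite sin_neg in Hpos. lra.
  - pose proof (sin_gt_0 (u / 2) ltac:(lra) ltac:(lra)). lra.
Qed.

Lemma cexp_eq_1_small (z : C) : - PI <= Im z <= PI -> cexp z = 1 -> z = 0.
Proof.
  intros Hz Hz1. assert (Hmod := Cmod_cexp z). rewrite Hz1, Cmod_1, <- exp_0 in Hmod.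
  apply exp_inv in Hmod.
  destruct z as [x y]. simpl in *. subst x. unfold cexp in Hz1. injection Hz1. simpl.
  rewrite exp_0. intros _ Hc. rewrite Rmult_1_l in Hc. apply cos_eq_1_small in Hc; [|exact Hz].
  now subst y.
Qed.

Lemma periodic_exp_neq_1 (z : C) : - / 2 <= Re z <= / 2 -> z <> 0 -> (periodic_exp z - 1)%C <> 0.
Proof.
  intros Hz Hne Heq. apply Hne. apply Ceq_minus in Heq. apply cexp_eq_1_small in Heq.
  - replace z with (two_PI_i * z / two_PI_i)%C.
    + rewrite Heq. unfold Cdiv. ring.
    + field. exact two_PI_i_neq_0.
  - pose proof PI_RGT_0. destruct z. simpl in *. nra.
Qed.

Lemma Cmod_periodic_exp_minus_1_ge (z : C) :
  1 - exp (- (2 * PI * Rabs (Im z))) <= Cmod (periodic_exp z - 1).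
Proof.
  assert (Hmod := Cmod_periodic_exp z). destruct (Rle_dec 0 (Im z)) as [Hz|Hz].
  - rewrite Rabs_pos_eq, Cmod_minus_sym by exact Hz. eapply Rle_trans; [|apply Cmod_triangle_inv].
    rewrite Hmod, Cmod_1. apply Rle_refl.
  - rewrite Rabs_left1 by lra. eapply Rle_trans; [|apply Cmod_triangle_inv]. rewrite Hmod, Cmod_1.
    replace (2 * PI * - Im z) with (- (2 * PI * Im z)) by ring. rewrite exp_Ropp.
    set (y := exp (- (2 * PI * Im z))). assert (Hy : 0 < y) by apply exp_pos.
    assert (Hsq := Rle_0_sqr (y - 1)). unfold Rsqr in Hsq.
    apply Rmult_le_reg_r with (1 := Hy). rewrite Rmult_minus_distr_r, Rinv_l; lra.
Qed.

Lemma Cmod_periodic_exp_minus_1_vertical (y : R) (k : Z) :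
  1 <= Cmod (periodic_exp (IZR k + / 2, y)%R - 1).
Proof.
  replace ((IZR k + / 2, y)%R : C) with ((/ 2, y)%R + IZR k)%C
    by (apply injective_projections; simpl; ring).
  rewrite periodic_exp_plus_IZR. eapply Rle_trans; [|apply re_le_Cmod].
  assert (HIm : Im (two_PI_i * (/ 2, y)%R) = PI) by (unfold two_PI_i; simpl; field).
  set (r := exp (Re (two_PI_i * (/ 2, y)%R))). assert (Hr : 0 < r) by apply exp_pos.
  change (1 <= Rabs (r * cos (Im (two_PI_i * (/ 2, y)%R)) - 1)).
  rewrite HIm, cos_PI, Rabs_left1; lra.
Qed.

Fixpoint bilateral_sum (a : Z -> C) (n : nat) : C :=
  match n with
  | O => a 0%Z
  | S m => (bilateral_sum a m + (a (Z.of_nat n) + a (- Z.of_nat n)%Z))%C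
  end.

(* Summing over the poles at the integers, the integral of [f z / (exp (2 pi i z) - 1)] between
   the lines [Im z = -h] and [Im z = h] is the sum of the [f k]; expanding the kernel in powers of
   [exp (2 pi i z)] on these lines turns it into the sum of the Fourier coefficients. *)
Section Poisson.

Variables (f : C -> C) (fhat : Z -> C) (h K c : R).
Hypothesis Hh : 0 < h.
Hypothesis Hc : 0 < c.
Hypothesis Hf : forall z, Rabs (Im z) <= h -> ex_derive f z.
Hypothesis Hdecay : forall z, Rabs (Im z) <= h -> Cmod (f z) <= K * exp (- (c * Rabs (Re z))).
Hypothesis Hfhat : forall k,
  is_RInt_line (fun u : R => f (u, 0%R) * periodic_exp (- (IZR k * (u, 0%R))))%C (fhat k).

Let kernel (k : Z) (z : C) : C := (periodic_exp (- (IZR k * z)) / (periodic_exp z - 1))%C.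

Lemma Poisson_kernel_0 (z : C) : kernel 0 z = (1 / (periodic_exp z - 1))%C.
Proof. unfold kernel. rewrite Cmult_0_l, Copp_0. f_equal. exact (periodic_exp_INR 0). Qed.

Lemma ex_derive_Poisson_kernel (k : Z) (z : C) :
  (periodic_exp z - 1)%C <> 0 -> ex_derive (kernel k) z.
Proof. intros Hz. unfold kernel, periodic_exp in *. auto 20 with holomorphic. Qed.

Lemma Poisson_decay_const_nonneg : 0 <= K.
Proof.
  assert (Hdecay0 := Hdecay 0). simpl in Hdecay0.
  rewrite Rabs_R0, Rmult_0_r, Ropp_0, exp_0 in Hdecay0.
  pose proof (Cmod_ge_0 (f 0)). specialize (Hdecay0 ltac:(lra)). lra.
Qed.

Lemma Rabs_strip_boundary (y : R) : y = - h \/ y = h -> Rabs y = h.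
Proof. intros [-> | ->]; [rewrite Rabs_left1|rewrite Rabs_pos_eq]; lra. Qed.

Lemma Poisson_gap_pos : 0 < 1 - exp (- (2 * PI * h)).
Proof.
  apply Rlt_0_minus. rewrite <- exp_0. apply exp_increasing.
  assert (HPI := PI_RGT_0). pose proof (Rmult_lt_0_compat _ _ HPI Hh). lra.
Qed.

Lemma periodic_exp_neq_1_strip_boundary (z : C) : Rabs (Im z) = h -> (periodic_exp z - 1)%C <> 0.
Proof.
  intros Hz. apply Cmod_gt_0. eapply Rlt_le_trans; [|apply Cmod_periodic_exp_minus_1_ge].
  rewrite Hz. apply Poisson_gap_pos.
Qed.

Lemma continuous_Poisson_kernel (k : Z) (z : C) : Rabs (Im z) <= h -> (periodic_exp z - 1)%C <> 0 ->
  continuous (fun z => f z * kernel k z)%C z.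
Proof.
  intros Hz Hne. apply ex_derive_continuous_C, ex_derive_Cmult; [now apply Hf|].
  now apply ex_derive_Poisson_kernel.
Qed.

Lemma continuous_Poisson_kernel_strip_boundary (k : Z) (x y : R) : Rabs y = h ->
  continuous (fun z => f z * kernel k z)%C (x, y).
Proof.
  intros Hy. apply continuous_Poisson_kernel; [simpl; lra|].
  now apply periodic_exp_neq_1_strip_boundary.
Qed.

Lemma rect_int_Poisson_kernel_unit (k : Z) :
  rect_int (fun z => f z * kernel 0 z)%C (IZR k - / 2) (IZR k + / 2) (- h) h = f (IZR k).
Proof.
  assert (Hk : periodic_exp (IZR k) = 1) by apply periodic_exp_IZR.
  rewrite (rect_int_residue _ (IZR k) (f (IZR k) / two_PI_i)).
  - field. exact two_PI_i_neq_0.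
  - simpl. lra.
  - simpl. lra.
  - intros z [Hzx Hzy] Hne. apply ex_derive_Cmult; [apply Hf, Rabs_le; lra|].
    apply ex_derive_Poisson_kernel.
    replace z with (z - IZR k + IZR k)%C by ring. rewrite periodic_exp_plus_IZR.
    apply periodic_exp_neq_1; [rewrite re_minus; simpl; lra|now apply Cminus_eq_contra].
  - apply (filterlim_ext (fun z => f z / (periodic_exp z - 1) * (z - IZR k))%C).
    { intros z. rewrite Poisson_kernel_0. unfold Cdiv. ring. }
    apply is_simple_residue_div.
    + apply ex_derive_continuous_C, Hf. simpl. rewrite Rabs_R0. lra.
    + assert (Hder := is_derive_periodic_exp (IZR k)). rewrite Hk, Cmult_1_r in Hder.
      now apply is_derive_Cminus_const.
    + rewrite Hk. ring.
    + apply two_PI_i_neq_0.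
Qed.

Lemma rect_int_Poisson_kernel (n : nat) :
  rect_int (fun z => f z * kernel 0 z)%C (- (INR n + / 2)) (INR n + / 2) (- h) h =
  bilateral_sum (fun k => f (IZR k)) n.
Proof.
  assert (Hcont : forall x y, y = - h \/ y = h -> continuous (fun z => f z * kernel 0 z)%C (x, y)).
  { intros x y Hy. now apply continuous_Poisson_kernel_strip_boundary, Rabs_strip_boundary. }
  induction n as [|n IH].
  - simpl. rewrite <- (rect_int_Poisson_kernel_unit 0). f_equal; ring.
  - pose proof (pos_INR n). cbn [bilateral_sum]. rewrite <- IH.
    rewrite <- (rect_int_Poisson_kernel_unit (Z.of_nat (S n))),
      <- (rect_int_Poisson_kernel_unit (- Z.of_nat (S n))).
    rewrite opp_IZR, <- INR_IZR_INZ, S_INR.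
    rewrite (rect_int_split_x _ _ (- (INR n + / 2))),
      (rect_int_split_x _ (- (INR n + / 2)) (INR n + / 2)) by (auto; lra).
    replace (- (INR n + 1) - / 2) with (- (INR n + 1 + / 2)) by ring.
    replace (- (INR n + 1) + / 2) with (- (INR n + / 2)) by field.
    replace (INR n + 1 - / 2) with (INR n + / 2) by field. ring.
Qed.

Lemma Cmod_Poisson_kernel_vertical_le (n : nat) (x y : R) :
  x = INR n + / 2 \/ x = - (INR n + / 2) -> - h <= y <= h ->
  continuous (fun z => f z * kernel 0 z)%C (x, y) /\
  Cmod (f (x, y) * kernel 0 (x, y)) <= K * exp (- (c * (INR n + / 2))).
Proof.
  intros Hx Hy. pose proof (pos_INR n).
  assert (Hy' : Rabs (Im (x, y)) <= h) by (apply Rabs_le; simpl; lra).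
  assert (Hge : 1 <= Cmod (periodic_exp (x, y) - 1)).
  { destruct Hx as [-> | ->].
    - rewrite INR_IZR_INZ. apply Cmod_periodic_exp_minus_1_vertical.
    - replace (- (INR n + / 2)) with (IZR (- Z.of_nat (S n)) + / 2).
      + apply Cmod_periodic_exp_minus_1_vertical.
      + rewrite opp_IZR, <- INR_IZR_INZ, S_INR. field. }
  assert (Hne : (periodic_exp (x, y) - 1)%C <> 0) by (apply Cmod_gt_0; lra).
  split; [now apply continuous_Poisson_kernel|].
  rewrite Cmod_mult, <- (Rmult_1_r (K * _)). apply Rmult_le_compat; try apply Cmod_ge_0.
  - eapply Rle_trans; [now apply Hdecay|]. simpl. replace (Rabs x) with (INR n + / 2); [lra|].
    destruct Hx as [-> | ->]; [rewrite Rabs_pos_eq|rewrite Rabs_left1]; lra.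
  - rewrite Poisson_kernel_0, Cmod_div, Cmod_1 by exact Hne.
    apply Rle_div_l; lra.
Qed.

Lemma ex_RInt_Poisson_kernel_strip_boundary (k : Z) (y a b : R) : Rabs y = h ->
  ex_RInt_C (fun u : R => f (u, y) * kernel k (u, y))%C a b.
Proof.
  intros Hy. apply (ex_RInt_continuous (V := C_R_CompleteNormedModule)). intros u _.
  apply (continuous_horizontal (fun z => f z * kernel k z)%C).
  now apply continuous_Poisson_kernel_strip_boundary.
Qed.

Lemma Cmod_RInt_Poisson_kernel_vertical_le (n : nat) (x : R) :
  x = INR n + / 2 \/ x = - (INR n + / 2) ->
  Cmod (RInt_C (fun y : R => f (x, y) * kernel 0 (x, y))%C (- h) h) <=
  2 * h * K * exp (- (c * (INR n + / 2))).
Proof.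
  intros Hx.
  replace (2 * h * K * exp (- (c * (INR n + / 2))))
    with ((h - - h) * (K * exp (- (c * (INR n + / 2))))) by ring.
  apply Cmod_RInt_le_const; [lra| |].
  - apply (ex_RInt_vertical (fun z => f z * kernel 0 z)%C); [lra|].
    intros y Hy. now apply (Cmod_Poisson_kernel_vertical_le n).
  - intros y Hy. now apply (Cmod_Poisson_kernel_vertical_le n).
Qed.

Lemma filterlim_bilateral_sum_f (S : C) :
  is_RInt_line (fun u : R =>
    f (u, Ropp h) * kernel 0 (u, Ropp h) - f (u, h) * kernel 0 (u, h))%C S ->
  filterlim (bilateral_sum (fun k => f (IZR k))) eventually (locally S).
Proof.
  intros HS. pose proof (Rabs_strip_boundary (- h) (or_introl eq_refl)).
  pose proof (Rabs_strip_boundary h (or_intror eq_refl)).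
  apply (is_RInt_gen_filterlim (V := C_R_CompleteNormedModule)) in HS.
  2:{ intros a b. apply (ex_RInt_minus (V := C_R_NormedModule));
        now apply ex_RInt_Poisson_kernel_strip_boundary. }
  assert (Hpair : filterlim (fun n => (- (INR n + / 2), INR n + / 2)) eventually
    (filter_prod (Rbar_locally m_infty) (Rbar_locally p_infty))).
  { apply filterlim_pair; [|apply filterlim_INR_plus_p_infty].
    apply (filterlim_comp _ _ _ (fun n => INR n + / 2) Ropp _ (Rbar_locally p_infty));
      [apply filterlim_INR_plus_p_infty|exact (filterlim_Rbar_opp p_infty)]. }
  assert (Hlim := filterlim_comp _ _ _ _ _ _ _ _ Hpair HS). cbv beta in Hlim.
  simpl fst in Hlim. simpl snd in Hlim.
  set (side := fun x => RInt_C (fun y : R => f (x, y) * kernel 0 (x, y))%C (- h) h).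
  replace S with (S + 0)%C by ring.
  eapply filterlim_ext; [|apply (filterlim_Cplus _
    (fun n => Ci * (side (INR n + / 2)%R - side (- (INR n + / 2))%R))%C _ _ Hlim)].
  - intros n. cbv beta. rewrite <- rect_int_Poisson_kernel. unfold rect_int. f_equal.
    apply RInt_Cminus; now apply ex_RInt_Poisson_kernel_strip_boundary.
  - apply filterlim_C_0_le with (fun n => 4 * h * K * exp (- (c * (INR n + / 2)))).
    + intros n. rewrite Cmod_mult, Cmod_Ci, Rmult_1_l.
      eapply Rle_trans; [apply Cmod_triangle_minus|].
      pose proof (Cmod_RInt_Poisson_kernel_vertical_le n _ (or_introl eq_refl)).
      pose proof (Cmod_RInt_Poisson_kernel_vertical_le n _ (or_intror eq_refl)).
      unfold side. lra.
    + apply filterlim_exp_decay; [exact Hc|apply filterlim_INR_plus_p_infty].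
Qed.

Let remainder (k : Z) (y : R) : C :=
  RInt_gen (V := C_R_CompleteNormedModule) (fun u : R => f (u, y) * kernel k (u, y))%C
    (Rbar_locally m_infty) (Rbar_locally p_infty).

Let remainder_bound : R := 2 * K / ((1 - exp (- (2 * PI * h))) * c).

Lemma is_RInt_Poisson_remainder (k : Z) (y : R) : Rabs y = h ->
  is_RInt_line (fun u : R => f (u, y) * kernel k (u, y))%C (remainder k y) /\
  Cmod (remainder k y) <= remainder_bound * exp (2 * PI * IZR k * y).
Proof.
  intros Hy. pose proof Poisson_decay_const_nonneg. pose proof Poisson_gap_pos.
  destruct (ex_RInt_line_exp_bound (fun u : R => f (u, y) * kernel k (u, y))%C
    (K / (1 - exp (- (2 * PI * h))) * exp (2 * PI * IZR k * y)) c Hc) as [l [Hl Hle]].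
  - intros u. apply (continuous_horizontal (fun z => f z * kernel k z)%C).
    now apply continuous_Poisson_kernel_strip_boundary.
  - intros u. rewrite Cmod_mult. unfold kernel.
    rewrite Cmod_div, Cmod_periodic_exp by now apply periodic_exp_neq_1_strip_boundary.
    replace (- (2 * PI * Im (- (IZR k * (u, y))))) with (2 * PI * IZR k * y) by (simpl; ring).
    assert (Hfu := Hdecay (u, y) ltac:(simpl; lra)). simpl in Hfu.
    assert (Hden := Cmod_periodic_exp_minus_1_ge (u, y)). simpl Im in Hden. rewrite Hy in Hden.
    replace (K / (1 - exp (- (2 * PI * h))) * exp (2 * PI * IZR k * y) * exp (- (c * Rabs u)))
      with (K * exp (- (c * Rabs u)) * (exp (2 * PI * IZR k * y) * / (1 - exp (- (2 * PI * h)))))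
      by (field; lra).
    apply Rmult_le_compat; auto using Cmod_ge_0.
    + apply Rdiv_le_0_compat; [apply Rlt_le, exp_pos|lra].
    + apply Rmult_le_compat_l; [apply Rlt_le, exp_pos|]. now apply Rinv_le_contravar.
  - unfold remainder. rewrite (is_RInt_gen_unique (V := C_R_CompleteNormedModule) _ l Hl).
    split; [exact Hl|]. eapply Rle_trans; [exact Hle|]. right. unfold remainder_bound. field. lra.
Qed.

Lemma is_RInt_line_Fourier_shift (k : Z) (y : R) : Rabs y <= h ->
  is_RInt_line (fun u : R => f (u, y) * periodic_exp (- (IZR k * (u, y))))%C (fhat k).
Proof.
  intros Hy.
  assert (Hstrip : forall z, Rmin 0 y <= Im z <= Rmax 0 y -> Rabs (Im z) <= h).
  { intros z Hz. apply Rabs_le. apply Rabs_le_between in Hy. revert Hz.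
    unfold Rmin, Rmax. destruct Rle_dec; lra. }
  apply (is_RInt_line_shift (fun z => f z * periodic_exp (- (IZR k * z)))%C 0 y); [| |apply Hfhat].
  - intros z Hz. apply ex_derive_Cmult; [auto|]. unfold periodic_exp. auto 10 with holomorphic.
  - apply exp_decay_vanishes_in_strip with 0 (K * exp (2 * PI * Rabs (IZR k) * h)) c; [exact Hc|].
    intros z _ Hz. specialize (Hstrip z Hz). rewrite Cmod_mult, Cmod_periodic_exp.
    replace (K * exp (2 * PI * Rabs (IZR k) * h) * exp (- (c * Rabs (Re z))))
      with (K * exp (- (c * Rabs (Re z))) * exp (2 * PI * Rabs (IZR k) * h)) by ring.
    apply Rmult_le_compat; auto using Cmod_ge_0, Rlt_le, exp_pos. apply exp_le_compat.
    replace (- (2 * PI * Im (- (IZR k * z)))) with (2 * PI * (IZR k * Im z))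
      by (destruct z; simpl; ring).
    rewrite (Rmult_assoc (2 * PI)). apply Rmult_le_compat_l; [pose proof PI_RGT_0; lra|].
    eapply Rle_trans; [apply Rle_abs|]. rewrite Rabs_mult.
    apply Rmult_le_compat_l; [apply Rabs_pos|exact Hstrip].
Qed.

Lemma Poisson_remainder_succ (k : Z) (y : R) : Rabs y = h ->
  remainder k y = (remainder (k + 1) y + fhat (k + 1))%C.
Proof.
  intros Hy. apply is_RInt_line_unique with (fun u : R => f (u, y) * kernel k (u, y))%C.
  - now apply is_RInt_Poisson_remainder.
  - apply is_RInt_line_ext with (fun u : R => f (u, y) * kernel (k + 1) (u, y) +
      f (u, y) * periodic_exp (- (IZR (k + 1) * (u, y))))%C.
    + intros u. assert (Hne := periodic_exp_neq_1_strip_boundary (u, y) Hy). unfold kernel.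
      replace (- (IZR k * (u, y)))%C with (- (IZR (k + 1) * (u, y)) + (u, y))%C
        by (rewrite plus_IZR, RtoC_plus; ring).
      rewrite periodic_exp_plus. field. exact Hne.
    + apply is_RInt_line_plus; [now apply is_RInt_Poisson_remainder|].
      apply is_RInt_line_Fourier_shift. lra.
Qed.

Lemma bilateral_sum_fhat (n : nat) :
  bilateral_sum fhat n = (remainder 0 (- h) - remainder 0 h -
    (remainder (Z.of_nat n) (- h) - remainder (- Z.of_nat n - 1) h))%C.
Proof.
  assert (Hbot := Rabs_strip_boundary (- h) (or_introl eq_refl)).
  assert (Htop := Rabs_strip_boundary h (or_intror eq_refl)).
  induction n as [|n IH].
  - simpl. rewrite (Poisson_remainder_succ (-1) h Htop). simpl. ring.
  - cbn [bilateral_sum]. rewrite IH, (Poisson_remainder_succ (Z.of_nat n) (- h) Hbot).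
    replace (Z.of_nat n + 1)%Z with (Z.of_nat (S n)) by lia.
    rewrite (Poisson_remainder_succ (- Z.of_nat (S n) - 1) h Htop).
    replace (- Z.of_nat (S n) - 1 + 1)%Z with (- Z.of_nat n - 1)%Z by lia.
    replace (- Z.of_nat (S n))%Z with (- Z.of_nat n - 1)%Z by lia. ring.
Qed.

Lemma Cmod_Poisson_remainder_difference_le (n : nat) :
  Cmod (remainder (Z.of_nat n) (- h) - remainder (- Z.of_nat n - 1) h) <=
  2 * remainder_bound * exp (- (2 * PI * h * (INR n + 0))).
Proof.
  assert (Hbot := Rabs_strip_boundary (- h) (or_introl eq_refl)).
  assert (Htop := Rabs_strip_boundary h (or_intror eq_refl)).
  pose proof (Rmult_lt_0_compat _ _ PI_RGT_0 Hh).
  eapply Rle_trans; [apply Cmod_triangle_minus|].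
  assert (Hlow := proj2 (is_RInt_Poisson_remainder (Z.of_nat n) (- h) Hbot)).
  assert (Hupp := proj2 (is_RInt_Poisson_remainder (- Z.of_nat n - 1) h Htop)).
  assert (Hbound : 0 <= remainder_bound).
  { apply Rdiv_le_0_compat; [|apply Rmult_lt_0_compat; [apply Poisson_gap_pos|exact Hc]].
    pose proof Poisson_decay_const_nonneg. lra. }
  rewrite minus_IZR, opp_IZR, <- INR_IZR_INZ in Hupp. rewrite <- INR_IZR_INZ in Hlow.
  replace (2 * PI * INR n * - h) with (- (2 * PI * h * (INR n + 0))) in Hlow by ring.
  assert (Hexp : exp (2 * PI * (- INR n - 1) * h) <= exp (- (2 * PI * h * (INR n + 0)))).
  { apply exp_le_compat. lra. }
  apply Rmult_le_compat_l with (1 := Hbound) in Hexp. lra.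
Qed.

Theorem Poisson_summation : exists S : C,
  filterlim (bilateral_sum (fun k => f (IZR k))) eventually (locally S) /\
  filterlim (bilateral_sum fhat) eventually (locally S).
Proof.
  pose proof (Rmult_lt_0_compat _ _ PI_RGT_0 Hh).
  exists (remainder 0 (- h) - remainder 0 h)%C. split.
  - apply filterlim_bilateral_sum_f.
    apply is_RInt_line_minus; apply is_RInt_Poisson_remainder, Rabs_strip_boundary; auto.
  - apply (filterlim_ext _ _ (fun n => eq_sym (bilateral_sum_fhat n))).
    replace (remainder 0 (- h) - remainder 0 h)%C
      with (remainder 0 (- h) - remainder 0 h + - 0)%C at 1 by ring.
    apply filterlim_Cplus; [apply filterlim_const|].
    rewrite Copp_0. apply filterlim_C_0_le with (1 := fun n =>
      Rle_trans _ _ _ (Req_le _ _ (Cmod_opp _)) (Cmod_Poisson_remainder_difference_le n)).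
    apply filterlim_exp_decay; [lra|apply filterlim_INR_plus_p_infty].
Qed.

End Poisson.

(** * The theta function *)

Lemma PI_mult_pos (x : R) : 0 < x -> 0 < PI * x.
Proof. apply Rmult_lt_0_compat, PI_RGT_0. Qed.

Definition gauss (x : R) (z : C) : C := cexp (- (RtoC (PI * x) * (z * z))).

Lemma gauss_RtoC (x u : R) : gauss x (RtoC u) = RtoC (exp (- (PI * x * (u * u)))).
Proof.
  unfold gauss. rewrite <- cexp_RtoC. f_equal. apply injective_projections; simpl; ring.
Qed.

Lemma ex_derive_gauss (x : R) (z : C) : ex_derive (gauss x) z.
Proof. unfold gauss. auto 10 with holomorphic. Qed.

Lemma Cmod_gauss_le (x B : R) (z : C) : 0 < x -> Rabs (Im z) <= B ->
  Cmod (gauss x z) <= exp (PI * x * (B * B + 1)) * exp (- (PI * x * Rabs (Re z))).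
Proof.
  intros Hx HB. unfold gauss. rewrite Cmod_cexp, <- exp_plus. apply exp_le_compat.
  replace (Re (- (RtoC (PI * x) * (z * z)))) with (PI * x * (Im z * Im z - Re z * Re z))
    by (destruct z; simpl; ring).
  pose proof (PI_mult_pos x Hx).
  assert (HI : Im z * Im z <= B * B).
  { apply Rsqr_le_abs_1. apply Rle_trans with (1 := HB), Rle_abs. }
  assert (HR : Rabs (Re z) - 1 <= Re z * Re z).
  { assert (Hsqr := Rsqr_abs (Re z)). assert (Hsq := Rle_0_sqr (Rabs (Re z) - 1)).
    unfold Rsqr in Hsqr, Hsq. pose proof (Rabs_pos (Re z)). lra. }
  rewrite <- Ropp_mult_distr_r_reverse, <- Rmult_plus_distr_l. apply Rmult_le_compat_l; lra.
Qed.

Lemma ex_gauss_integral (x : R) : 0 < x ->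
  exists J : C, is_RInt_line (fun u : R => gauss x (RtoC u)) J.
Proof.
  intros Hx. destruct (ex_RInt_line_exp_bound (fun u : R => gauss x (RtoC u))
    (exp (PI * x * (0 * 0 + 1))) (PI * x)) as [J [HJ _]].
  - now apply PI_mult_pos.
  - intros u. apply (continuous_horizontal (gauss x)), ex_derive_continuous_C, ex_derive_gauss.
  - intros u. apply (Cmod_gauss_le x 0 (RtoC u) Hx). simpl. rewrite Rabs_R0. lra.
  - now exists J.
Qed.

Lemma is_RInt_line_gauss_scale (x : R) (J : C) : 0 < x ->
  is_RInt_line (fun u : R => gauss 1 (RtoC u)) J ->
  is_RInt_line (fun u : R => gauss x (RtoC u)) (RtoC (/ sqrt x) * J)%C.
Proof.
  intros Hx HJ. assert (Hs := sqrt_lt_R0 x Hx).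
  apply (is_RInt_line_scale _ (sqrt x) _ Hs), (is_RInt_line_Cmult_l (RtoC (/ sqrt x))) in HJ.
  apply is_RInt_line_ext with (2 := HJ). intros u.
  rewrite Cmult_assoc, <- RtoC_mult, Rinv_l, Cmult_1_l, !gauss_RtoC by lra.
  do 3 f_equal. rewrite <- (sqrt_sqrt x) at 3 by lra. ring.
Qed.

(* Completing the square moves the line of integration to height [k / x]. *)
Lemma is_RInt_line_gauss_Fourier (x k : R) (J : C) : 0 < x ->
  is_RInt_line (fun u : R => gauss x (RtoC u)) J ->
  is_RInt_line (fun u : R => gauss x (RtoC u) * periodic_exp (- (RtoC k * RtoC u)))%C
    (J * gauss (/ x) (RtoC k))%C.
Proof.
  intros Hx HJ.
  apply (is_RInt_line_shift (gauss x) 0 (k / x)) in HJ.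
  - apply (is_RInt_line_Cmult_l (gauss (/ x) (RtoC k))) in HJ. rewrite Cmult_comm.
    apply is_RInt_line_ext with (2 := HJ). intros u. unfold gauss, periodic_exp.
    rewrite <- !cexp_plus. f_equal. apply injective_projections; unfold two_PI_i; simpl; field; lra.
  - intros z _. apply ex_derive_gauss.
  - apply exp_decay_vanishes_in_strip
      with 0 (exp (PI * x * (Rabs (k / x) * Rabs (k / x) + 1))) (PI * x).
    + now apply PI_mult_pos.
    + intros z _ Hz. apply Cmod_gauss_le; [exact Hx|]. revert Hz.
      unfold Rabs, Rmin, Rmax. destruct Rle_dec, Rcase_abs, Rcase_abs; lra.
Qed.

Definition theta_term (x : R) (n : nat) : R := exp (- (PI * x * (INR (S n) * INR (S n)))).

Definition omega (x : R) : R := Series (theta_term x).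

Lemma theta_term_pos (x : R) (n : nat) : 0 < theta_term x n.
Proof. apply exp_pos. Qed.

Lemma theta_term_le (x y : R) (n : nat) : x <= y -> theta_term y n <= theta_term x n.
Proof.
  intros Hxy. apply exp_le_compat, Ropp_le_contravar, Rmult_le_compat_r; [apply Rle_0_sqr|].
  apply Rmult_le_compat_l; [pose proof PI_RGT_0; lra|exact Hxy].
Qed.

Lemma theta_term_decr (x : R) (n : nat) : 0 < x -> theta_term x (S n) <= theta_term x n.
Proof.
  intros Hx. apply exp_le_compat, Ropp_le_contravar, Rmult_le_compat_l.
  - now apply Rlt_le, PI_mult_pos.
  - pose proof (le_INR (S n) (S (S n)) ltac:(lia)). pose proof (pos_INR (S n)).
    apply Rmult_le_compat; auto.
Qed.

Lemma theta_term_le_geom (x : R) (n : nat) : 0 < x ->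
  theta_term x n <= exp (- (PI * x)) * exp (- (PI * x)) ^ n.
Proof.
  intros Hx. pose proof (PI_mult_pos x Hx).
  change (theta_term x n <= exp (- (PI * x)) ^ S n).
  rewrite <- Rpower_pow by apply exp_pos. unfold Rpower. rewrite ln_exp. apply exp_le_compat.
  assert (Hn : 1 <= INR (S n)) by (rewrite S_INR; pose proof (pos_INR n); lra).
  replace (INR (S n) * - (PI * x)) with (- (PI * x * (INR (S n) * 1))) by ring.
  apply Ropp_le_contravar, Rmult_le_compat_l; [lra|]. apply Rmult_le_compat_l; lra.
Qed.

Lemma is_series_theta_majorant (x : R) : 0 < x ->
  is_series (fun n => exp (- (PI * x)) * exp (- (PI * x)) ^ n) (/ (exp (PI * x) - 1)).
Proof.
  intros Hx. pose proof (PI_mult_pos x Hx).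
  assert (Hexp : 1 < exp (PI * x)) by (rewrite <- exp_0; now apply exp_increasing).
  replace (/ (exp (PI * x) - 1)) with (exp (- (PI * x)) * / (1 - exp (- (PI * x))))
    by (rewrite exp_Ropp; field; lra).
  apply (is_series_scal (V := R_NormedModule)), is_series_geom.
  rewrite Rabs_pos_eq by apply Rlt_le, exp_pos. rewrite <- exp_0. apply exp_increasing. lra.
Qed.

Lemma ex_series_theta_term (x : R) : 0 < x -> ex_series (theta_term x).
Proof.
  intros Hx. apply (ex_series_le (K := R_AbsRing) (V := R_CompleteNormedModule)) with
    (fun n => exp (- (PI * x)) * exp (- (PI * x)) ^ n).
  - intros n. change (Rabs (theta_term x n) <= exp (- (PI * x)) * exp (- (PI * x)) ^ n).
    rewrite Rabs_pos_eq by apply Rlt_le, theta_term_pos. now apply theta_term_le_geom.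
  - eexists. now apply is_series_theta_majorant.
Qed.

Lemma omega_nonneg (x : R) : 0 < x -> 0 <= omega x.
Proof.
  intros Hx. unfold omega. rewrite <- (Rmult_0_l (Series (theta_term x))), <- Series_scal_l.
  apply Series_le; [|now apply ex_series_theta_term]. intros n.
  pose proof (theta_term_pos x n). lra.
Qed.

Lemma omega_le_inv (x : R) : 0 < x -> omega x <= / x.
Proof.
  intros Hx. pose proof PI2_1. apply Rle_trans with (/ (exp (PI * x) - 1)).
  - unfold omega. rewrite <- (is_series_unique _ _ (is_series_theta_majorant x Hx)).
    apply Series_le; [|eexists; now apply is_series_theta_majorant].
    intros n. split; [apply Rlt_le, theta_term_pos|now apply theta_term_le_geom].
  - apply Rinv_le_contravar; [exact Hx|].
    pose proof (exp_ineq1 (PI * x) ltac:(nra)). nra.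
Qed.

Lemma Series_minus_sum_n (a : nat -> R) (n : nat) : ex_series a ->
  Series a - sum_n a n = Series (fun k => a (S n + k)%nat).
Proof.
  intros Ha. rewrite (Series_incr_n a (S n)) by (auto; lia).
  rewrite <- sum_n_Reals. simpl pred. ring.
Qed.

Lemma continuous_Series {T : UniformSpace} (f : nat -> T -> R) (M : nat -> R) (x : T) :
  (forall n, continuous (f n) x) -> locally x (fun y => forall n, Rabs (f n y) <= M n) ->
  ex_series M -> continuous (fun y => Series (fun n => f n y)) x.
Proof.
  intros Hf HM HexM.
  apply (continuous_locally_uniform_limit (V := R_NormedModule)
    (fun n y => sum_n (fun k => f k y) n)).
  - intros n. induction n as [|n IH].
    + apply continuous_ext with (2 := Hf O). intros y. now rewrite sum_O.
    + apply continuous_ext with (fun y => plus (sum_n (fun k => f k y) n) (f (S n) y)).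
      { intros y. now rewrite sum_Sn. }
      now apply (continuous_plus (V := R_NormedModule)).
  - intros eps. destruct (proj1 (filterlim_locally _ _) (Series_correct M HexM) eps) as [n Hn].
    exists n. apply filter_imp with (2 := HM). intros y Hy.
    assert (Habs : ex_series (fun k => Rabs (f k y))).
    { apply (ex_series_le (K := R_AbsRing) (V := R_CompleteNormedModule)) with M; [|exact HexM].
      intros k. change (Rabs (Rabs (f k y)) <= M k). now rewrite Rabs_Rabsolu. }
    change (Rabs (sum_n (fun k => f k y) n - Series (fun k => f k y)) < eps).
    rewrite Rabs_minus_sym, Series_minus_sum_n by now apply ex_series_Rabs.
    apply Rle_lt_trans with (Series (fun k => Rabs (f (S n + k)%nat y))).
    { apply Series_Rabs.
      now apply (ex_series_incr_n (V := R_NormedModule)) with (n := S n) in Habs. }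
    apply Rle_lt_trans with (Series (fun k => M (S n + k)%nat)).
    + apply Series_le; [intros k; split; [apply Rabs_pos|apply Hy]|].
      now apply (ex_series_incr_n (V := R_NormedModule) M).
    + specialize (Hn n (le_n n)). change (Rabs (sum_n M n - Series M) < eps) in Hn.
      rewrite <- Series_minus_sum_n by exact HexM. apply Rabs_def2 in Hn. lra.
Qed.

Lemma continuous_omega (x : R) : 0 < x -> continuous omega x.
Proof.
  intros Hx. apply (continuous_Series (fun n y => theta_term y n) (theta_term (x / 2))).
  - intros n. unfold theta_term. apply (ex_derive_continuous (V := R_NormedModule)).
    now auto_derive.
  - exists (mkposreal _ (is_pos_div_2 (mkposreal x Hx))). intros y Hy n.
    change (Rabs (y - x) < x / 2) in Hy. apply Rabs_def2 in Hy.
    rewrite Rabs_pos_eq by apply Rlt_le, theta_term_pos. apply theta_term_le. lra.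
  - apply ex_series_theta_term. lra.
Qed.

Lemma bilateral_sum_gauss (x : R) (n : nat) :
  bilateral_sum (fun k => gauss x (RtoC (IZR k))) (S n) = RtoC (1 + 2 * sum_n (theta_term x) n).
Proof.
  assert (Hstep : forall m,
    (gauss x (RtoC (IZR (Z.of_nat (S m)))) + gauss x (RtoC (IZR (- Z.of_nat (S m)))))%C =
    RtoC (2 * theta_term x m)).
  { intros m. rewrite opp_IZR, <- INR_IZR_INZ, !gauss_RtoC, Rmult_opp_opp, <- RtoC_plus.
    unfold theta_term. f_equal. ring. }
  induction n as [|n IH].
  - cbn [bilateral_sum]. rewrite (Hstep O), sum_O, gauss_RtoC, !Rmult_0_r, Ropp_0, exp_0.
    now rewrite RtoC_plus.
  - cbn [bilateral_sum] in *. rewrite IH, (Hstep (S n)), <- RtoC_plus, sum_Sn. f_equal.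
    change plus with Rplus. ring.
Qed.

Lemma filterlim_bilateral_sum_gauss (x : R) : 0 < x ->
  filterlim (bilateral_sum (fun k => gauss x (RtoC (IZR k)))) eventually
    (locally (RtoC (1 + 2 * omega x))).
Proof.
  intros Hx. assert (Hsum : is_series (theta_term x) (omega x))
    by now apply Series_correct, ex_series_theta_term.
  assert (Hlim : filterlim (fun n => RtoC (1 + 2 * sum_n (theta_term x) n)) eventually
    (locally (RtoC (1 + 2 * omega x)))).
  { apply (filterlim_comp _ _ _ _ (fun y => RtoC (1 + 2 * y)) _ _ _ Hsum).
    apply (continuous_RtoC (fun y => 1 + 2 * y) (omega x)),
      (ex_derive_continuous (V := R_NormedModule)). now auto_derive. }
  intros P HP. destruct (Hlim P HP) as [N HN]. exists (S N). intros [|n] Hn; [lia|].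
  rewrite bilateral_sum_gauss. apply HN. lia.
Qed.

Lemma bilateral_sum_Cmult_l (k : C) (a : Z -> C) (n : nat) :
  bilateral_sum (fun j => k * a j)%C n = (k * bilateral_sum a n)%C.
Proof. induction n as [|n IH]; [reflexivity|]. cbn [bilateral_sum]. rewrite IH. ring. Qed.

Lemma theta_Poisson (x : R) (J : C) : 0 < x -> is_RInt_line (fun u : R => gauss x (RtoC u)) J ->
  RtoC (1 + 2 * omega x) = (J * RtoC (1 + 2 * omega (/ x)))%C.
Proof.
  intros Hx HJ. pose proof (Rinv_0_lt_compat x Hx).
  destruct (Poisson_summation (gauss x) (fun k => J * gauss (/ x) (RtoC (IZR k)))%C
    1 (exp (PI * x * (1 * 1 + 1))) (PI * x)) as [S [Hsum Hsum_hat]].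
  - exact Rlt_0_1.
  - now apply PI_mult_pos.
  - intros z _. apply ex_derive_gauss.
  - intros z Hz. now apply Cmod_gauss_le.
  - intros k. now apply is_RInt_line_gauss_Fourier.
  - pose proof (filterlim_locally_unique _ _ _ Hsum (filterlim_bilateral_sum_gauss x Hx)).
    subst S. apply (filterlim_locally_unique _ _ _ Hsum_hat).
    apply (filterlim_ext _ _ (fun n => eq_sym (bilateral_sum_Cmult_l J _ n))).
    apply filterlim_Cmult; [apply filterlim_const|now apply filterlim_bilateral_sum_gauss].
Qed.

(* The normalization [J 1 = 1] of the Gaussian integral is the case [x = 1] of Poisson summation. *)
Theorem theta_modular (x : R) : 0 < x -> sqrt x * (1 + 2 * omega x) = 1 + 2 * omega (/ x).
Proof.
  intros Hx. destruct (ex_gauss_integral 1 Rlt_0_1) as [J HJ].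
  assert (HJ1 : J = RtoC 1).
  { assert (Hpoisson := theta_Poisson 1 J Rlt_0_1 HJ). rewrite Rinv_1 in Hpoisson.
    assert (Hne : RtoC (1 + 2 * omega 1) <> 0)
      by (apply RtoC_neq_0; pose proof (omega_nonneg 1 Rlt_0_1); lra).
    replace J with (J * RtoC (1 + 2 * omega 1) / RtoC (1 + 2 * omega 1))%C by (field; exact Hne).
    rewrite <- Hpoisson. field. exact Hne. }
  subst J. assert (Hpoisson := theta_Poisson x _ Hx (is_RInt_line_gauss_scale x _ Hx HJ)).
  rewrite Cmult_1_r, <- RtoC_mult in Hpoisson. apply RtoC_inj in Hpoisson. rewrite Hpoisson.
  rewrite <- Rmult_assoc, Rinv_r, Rmult_1_l; [reflexivity|]. pose proof (sqrt_lt_R0 x Hx). lra.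
Qed.

(** * Alternating series and the zeta function *)

Notation is_series_C := (is_series (K := C_AbsRing) (V := C_NormedModule)).

(* Twice the sum of [a n, ..., a m] exceeds [a n] by [a n + a (n+1)] plus what twice the sum of
   [a (n+1), ..., a m] exceeds [a (n+1)], so these excesses telescope. *)
Lemma Cmod_alternating_sum_le (a : nat -> C) (A : nat -> R) :
  (forall n, Cmod (a n) <= A n) -> (forall n, Cmod (a n + a (S n)) <= A n - A (S n)) ->
  forall p n, Cmod (sum_n_m a n (n + p)) <= A n.
Proof.
  intros Ha Haa.
  assert (Hdouble : forall p n, Cmod (2 * sum_n_m a n (n + p) - a n) <= A n).
  { induction p as [|p IH]; intros n.
    - rewrite Nat.add_0_r, sum_n_n. replace (2 * a n - a n)%C with (a n) by ring. apply Ha.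
    - rewrite sum_Sn_m, <- Nat.add_succ_comm by lia.
      change plus with Cplus.
      replace (2 * (a n + sum_n_m a (S n) (S n + p)) - a n)%C
        with ((a n + a (S n)) + (2 * sum_n_m a (S n) (S n + p) - a (S n)))%C by ring.
      eapply Rle_trans; [apply Cmod_triangle|]. specialize (IH (S n)). specialize (Haa n). lra. }
  intros p n. specialize (Hdouble p n). specialize (Ha n).
  assert (Hmod : Cmod (2 * sum_n_m a n (n + p)) = 2 * Cmod (sum_n_m a n (n + p))).
  { rewrite Cmod_mult, Cmod_R, Rabs_pos_eq by lra. reflexivity. }
  pose proof (Cmod_triangle_inv (2 * sum_n_m a n (n + p)) (a n)). lra.
Qed.

Lemma ex_series_alternating (a : nat -> C) (A : nat -> R) :
  (forall n, Cmod (a n) <= A n) -> (forall n, Cmod (a n + a (S n)) <= A n - A (S n)) ->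
  is_lim_seq A 0 -> exists l, is_series_C a l /\ forall n, Cmod (sum_n a n - l) <= A (S n).
Proof.
  intros Ha Haa HA.
  assert (Hsum : forall n m, (n <= m)%nat -> Cmod (sum_n_m a n m) <= A n).
  { intros n m Hnm. replace m with (n + (m - n))%nat by lia. now apply Cmod_alternating_sum_le. }
  assert (Hex : ex_series (V := C_NormedModule) a).
  { apply (ex_series_Cauchy (V := C_CompleteNormedModule)). intros eps.
    destruct (proj1 (filterlim_locally A 0) HA eps) as [N HN]. exists N. intros n m Hn Hm.
    specialize (HN n Hn). change (Rabs (A n - 0) < eps) in HN. apply Rabs_def2 in HN.
    change (Cmod (sum_n_m a n m) < eps). destruct (le_lt_dec n m) as [Hnm|Hnm].
    - specialize (Hsum n m Hnm). lra.
    - rewrite sum_n_m_zero by lia. change (Cmod 0 < eps). rewrite Cmod_0. apply cond_pos. }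
  destruct Hex as [l Hl]. exists l. split; [exact Hl|]. intros n.
  rewrite Cmod_minus_sym. apply (Cmod_filterlim_le (sum_n a)) with (1 := Hl).
  exists (S n). intros m Hm. unfold sum_n. rewrite (sum_n_m_Chasles a 0 n m) by lia.
  assert (Hcancel : forall u v : C, Cmod (plus u v - u) = Cmod v)
    by (intros u v; f_equal; change plus with Cplus; ring).
  rewrite Hcancel. now apply Hsum.
Qed.

Lemma CSeries_unique (a : nat -> C) (l : C) : is_series_C a l -> CSeries a = l.
Proof.
  intros Hsum. unfold CSeries.
  assert (Hfst : forall n, Re (sum_n a n) = sum_n (fun k => Re (a k)) n).
  { induction n as [|n IH]; [now rewrite !sum_O|]. rewrite !sum_Sn, <- IH. reflexivity. }
  assert (Hsnd : forall n, Im (sum_n a n) = sum_n (fun k => Im (a k)) n).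
  { induction n as [|n IH]; [now rewrite !sum_O|]. rewrite !sum_Sn, <- IH. reflexivity. }
  apply injective_projections; apply is_series_unique.
  - apply (filterlim_ext _ _ Hfst). apply (filterlim_comp _ _ _ (sum_n a) fst _ _ _ Hsum).
    destruct l. apply continuous_fst.
  - apply (filterlim_ext _ _ Hsnd). apply (filterlim_comp _ _ _ (sum_n a) snd _ _ _ Hsum).
    destruct l. apply continuous_snd.
Qed.

Lemma CSeries_conj (a : nat -> C) : CSeries (fun n => Cconj (a n)) = Cconj (CSeries a).
Proof.
  unfold CSeries. apply injective_projections; simpl; [reflexivity|]. apply Series_opp.
Qed.

Lemma Rcpow_conj (b : R) (z : C) : Rcpow b (Cconj z) = Cconj (Rcpow b z).
Proof. unfold Rcpow. now rewrite cexp_conj, Cmult_conj, Cconj_RtoC. Qed.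

Lemma ex_derive_Rcpow (b : R) (f : C -> C) (z : C) : ex_derive f z ->
  ex_derive (fun w => Rcpow b (f w)) z.
Proof. intros Hf. unfold Rcpow. auto with holomorphic. Qed.

Hint Resolve ex_derive_Rcpow : holomorphic.

Lemma Cmod_Rcpow (b : R) (z : C) : Cmod (Rcpow b z) = exp (Re z * ln b).
Proof. destruct z. unfold Rcpow. rewrite Cmod_cexp. f_equal. simpl. ring. Qed.

Lemma Cmod_cexp_opp_minus_le (s : C) (a b : R) : 0 < Re s -> a <= b ->
  Cmod (cexp (- s * RtoC a) - cexp (- s * RtoC b)) <=
  Cmod s / Re s * (exp (- (Re s * a)) - exp (- (Re s * b))).
Proof.
  intros Hs Hab. rewrite Cmod_minus_sym, !(Cmult_comm (- s)).
  apply (Cmod_is_RInt_le _ (fun v => Cmod s * exp (- (Re s * v))) a b)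
    with (3 := is_RInt_cexp (- s) a b); [exact Hab| |].
  - intros v _. rewrite Cmod_mult, Cmod_opp, Cmod_cexp. right. do 2 f_equal. destruct s.
    simpl. ring.
  - replace (Cmod s / Re s * (exp (- (Re s * a)) - exp (- (Re s * b))))
      with (- Cmod s / Re s * exp (- (Re s * b)) - - Cmod s / Re s * exp (- (Re s * a)))
        by (field; lra).
    apply (is_RInt_derive (fun v => - Cmod s / Re s * exp (- (Re s * v)))); intros v _.
    + auto_derive; [exact I|]. field. lra.
    + apply (ex_derive_continuous (V := R_NormedModule)). now auto_derive.
Qed.

Definition eta_term (s : C) (n : nat) : C := (RtoC ((-1) ^ n) * Rcpow (INR (S n)) (- s))%C.

Lemma filterlim_ln_INR_S : filterlim (fun n => ln (INR (S n))) eventually (Rbar_locally p_infty).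
Proof.
  apply (filterlim_comp _ _ _ (fun n => INR (S n)) ln _ (Rbar_locally p_infty)).
  - apply (is_lim_seq_incr_1 INR), is_lim_seq_INR.
  - exact is_lim_ln_p.
Qed.

Lemma is_series_eta (s : C) : 0 < Re s ->
  is_series_C (eta_term s) (eta s) /\
  forall n, Cmod (sum_n (eta_term s) n - eta s) <=
    Cmod s / Re s * exp (- (Re s * ln (INR (S (S n))))).
Proof.
  intros Hs.
  destruct (ex_series_alternating (eta_term s)
    (fun n => Cmod s / Re s * exp (- (Re s * ln (INR (S n)))))) as [l [Hl Hle]].
  - intros n. unfold eta_term. rewrite Cmod_mult, Cmod_R, pow_1_abs, Rmult_1_l, Cmod_Rcpow.
    replace (Re (- s) * ln (INR (S n))) with (- (Re s * ln (INR (S n))))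
      by (destruct s; simpl; ring).
    rewrite <- (Rmult_1_l (exp _)) at 1. apply Rmult_le_compat_r; [apply Rlt_le, exp_pos|].
    apply Rle_div_r; [exact Hs|]. rewrite Rmult_1_l. apply Re_le_Cmod.
  - intros n. unfold eta_term, Rcpow.
    assert (Hsign : forall u v : C, (RtoC ((-1) ^ n) * u + RtoC ((-1) ^ S n) * v)%C =
      (RtoC ((-1) ^ n) * (u - v))%C) by (intros; simpl pow; rewrite RtoC_mult; ring).
    rewrite Hsign, Cmod_mult, Cmod_R, pow_1_abs, Rmult_1_l, <- Rmult_minus_distr_l.
    apply Cmod_cexp_opp_minus_le; [exact Hs|]. apply ln_le; [apply lt_0_INR; lia|apply le_INR; lia].
  - apply (filterlim_exp_decay (F := eventually)); [exact Hs|apply filterlim_ln_INR_S].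
  - assert (Heta : eta s = l) by now apply CSeries_unique. now rewrite Heta.
Qed.

Lemma Cmod_eta_le (s : C) : 0 < Re s -> Cmod (eta s) <= 2 * (Cmod s / Re s).
Proof.
  intros Hs. destruct (is_series_eta s Hs) as [_ Hrem]. specialize (Hrem O).
  assert (Hfirst : sum_n (eta_term s) 0 = RtoC 1).
  { rewrite sum_O. unfold eta_term, Rcpow. change (INR 1) with 1. rewrite ln_1, Cmult_0_r, cexp_0.
    simpl pow. apply Cmult_1_r. }
  rewrite Hfirst in Hrem. assert (Hexp : exp (- (Re s * ln (INR 2))) <= 1).
  { rewrite <- exp_0. apply exp_le_compat. pose proof ln_lt_2. change (INR 2) with 2. nra. }
  assert (Hratio : 1 <= Cmod s / Re s).
  { apply Rle_div_r; [exact Hs|]. rewrite Rmult_1_l. apply Re_le_Cmod. }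
  assert (Htri := Cmod_triangle_inv (eta s) 1). rewrite Cmod_minus_sym, Cmod_1 in Htri.
  pose proof (exp_pos (- (Re s * ln (INR 2)))). nra.
Qed.

Lemma ex_derive_eta_sum (n : nat) (s : C) : ex_derive (fun z => sum_n (eta_term z) n) s.
Proof.
  induction n as [|n IH].
  - apply ex_derive_ext with (fun z => eta_term z O); [intros z; now rewrite sum_O|].
    unfold eta_term. auto with holomorphic.
  - apply ex_derive_ext with (fun z => sum_n (eta_term z) n + eta_term z (S n))%C;
      [intros z; now rewrite sum_Sn|].
    unfold eta_term at 2. auto 10 with holomorphic.
Qed.

Lemma uniform_limit_eta (d M : R) : 0 < d ->
  uniform_limit_on (fun z => d <= Re z /\ Cmod z <= M) (fun n z => sum_n (eta_term z) n) eta.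
Proof.
  intros Hd eps He.
  assert (Hlim := filterlim_exp_decay (F := eventually) (M / d) d (fun n => ln (INR (S n)))
    Hd filterlim_ln_INR_S).
  destruct (proj1 (filterlim_locally _ 0) Hlim (mkposreal eps He)) as [N HN].
  exists N. intros n z Hn [HRe HM]. specialize (HN (S n) ltac:(lia)).
  change (Rabs (M / d * exp (- (d * ln (INR (S (S n))))) - 0) < eps) in HN.
  apply Rabs_def2 in HN. rewrite Rminus_0_r in HN.
  eapply Rle_lt_trans; [apply is_series_eta; lra|]. eapply Rle_lt_trans; [|apply HN].
  apply Rmult_le_compat; auto using Rlt_le, exp_pos.
  - apply Rdiv_le_0_compat; [apply Cmod_ge_0|lra].
  - apply Rmult_le_compat; auto using Cmod_ge_0; [apply Rlt_le, Rinv_0_lt_compat; lra|].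
    apply Rinv_le_contravar; lra.
  - apply exp_le_compat, Ropp_le_contravar, Rmult_le_compat_r; [|exact HRe].
    rewrite <- ln_1. apply ln_le; [lra|]. change 1 with (INR 1). apply le_INR. lia.
Qed.

Lemma ex_derive_eta (s : C) : 0 < Re s -> ex_derive eta s.
Proof.
  intros Hs. set (r := Re s / 2). assert (Hr : 0 < r) by (unfold r; lra).
  apply (uniform_limit_ex_derive (fun n z => sum_n (eta_term z) n) eta s r Hr).
  - intros n z _. apply ex_derive_eta_sum.
  - apply uniform_limit_on_subset with (2 := uniform_limit_eta r (Cmod s + r) Hr).
    intros z Hz. split.
    + assert (HRe := Re_le_Cmod (s - z)). rewrite re_minus, Cmod_minus_sym in HRe.
      unfold r in *. lra.
    + replace z with (s + (z - s))%C by ring. eapply Rle_trans; [apply Cmod_triangle|lra].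
Qed.

Lemma eta_conj (s : C) : eta (Cconj s) = Cconj (eta s).
Proof.
  unfold eta. rewrite <- CSeries_conj. unfold CSeries.
  f_equal; apply Series_ext; intros n;
    now rewrite Cmult_conj, Cconj_RtoC, <- Rcpow_conj, Copp_conj.
Qed.

Lemma Cmod_zeta_denominator_ge (s : C) : Re s < 1 -> (1 - Re s) / 2 <= Cmod (1 - Rcpow 2 (1 - s)).
Proof.
  intros Hs. rewrite Cmod_minus_sym. eapply Rle_trans; [|apply Cmod_triangle_inv].
  rewrite Cmod_Rcpow, Cmod_1, re_minus. simpl. pose proof ln_lt_2.
  pose proof (exp_ineq1_le ((1 - Re s) * ln 2)). nra.
Qed.

Lemma zeta_denominator_neq_0 (s : C) : Re s < 1 -> (1 - Rcpow 2 (1 - s))%C <> 0.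
Proof.
  intros Hs. apply Cmod_gt_0. pose proof (Cmod_zeta_denominator_ge s Hs). lra.
Qed.

Lemma ex_derive_zeta (s : C) : 0 < Re s < 1 -> ex_derive zeta s.
Proof.
  intros Hs. apply ex_derive_Cdiv; [now apply ex_derive_eta| |now apply zeta_denominator_neq_0].
  auto with holomorphic.
Qed.

Lemma Cmod_zeta_le (d : R) (s : C) : 0 < d -> d <= Re s <= 1 - d ->
  Cmod (zeta s) <= 4 / (d * d) * Cmod s.
Proof.
  intros Hd Hs. unfold zeta. rewrite Cmod_div by (apply zeta_denominator_neq_0; lra).
  pose proof (Cmod_zeta_denominator_ge s ltac:(lra)).
  replace (4 / (d * d) * Cmod s) with (2 * (Cmod s * / d) * / (d / 2)) by (field; lra).
  apply Rmult_le_compat; [apply Cmod_ge_0| | |apply Rinv_le_contravar; lra].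
  { apply Rlt_le, Rinv_0_lt_compat. lra. }
  eapply Rle_trans; [apply Cmod_eta_le; lra|]. apply Rmult_le_compat_l; [lra|].
  apply Rmult_le_compat_l; [apply Cmod_ge_0|]. apply Rinv_le_contravar; lra.
Qed.

Lemma zeta_conj (s : C) : Re s < 1 -> zeta (Cconj s) = Cconj (zeta s).
Proof.
  intros Hs. unfold zeta.
  rewrite Cdiv_conj by (apply zeta_denominator_neq_0; lra). rewrite eta_conj.
  now rewrite !Cminus_conj, <- Rcpow_conj, Cminus_conj, !Cconj_RtoC.
Qed.

(** * Mellin transforms and the functional equation *)

(* The substitution [x = exp v] in the integral of [g (ln x) * x^(s-1)] over [x > 0]. *)
Definition is_Mellin (g : R -> R) (s l : C) : Prop :=
  is_RInt_line (fun v : R => cexp (s * RtoC v) * RtoC (g v))%C l.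

Lemma is_Mellin_unique (g : R -> R) (s l m : C) : is_Mellin g s l -> is_Mellin g s m -> l = m.
Proof. exact (is_RInt_line_unique _ l m). Qed.

Lemma is_Mellin_ext (g h : R -> R) (s l : C) :
  (forall v, g v = h v) -> is_Mellin g s l -> is_Mellin h s l.
Proof. intros Hgh. unfold is_Mellin. apply is_RInt_line_ext. intros v. now rewrite Hgh. Qed.

Lemma is_Mellin_plus (g h : R -> R) (s l m : C) :
  is_Mellin g s l -> is_Mellin h s m -> is_Mellin (fun v => g v + h v) s (l + m).
Proof.
  unfold is_Mellin. intros Hg Hh.
  apply is_RInt_line_ext with (2 := is_RInt_line_plus _ _ _ _ Hg Hh).
  intros v. rewrite RtoC_plus. ring.
Qed.

Lemma is_Mellin_minus (g h : R -> R) (s l m : C) :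
  is_Mellin g s l -> is_Mellin h s m -> is_Mellin (fun v => g v - h v) s (l - m).
Proof.
  unfold is_Mellin. intros Hg Hh.
  apply is_RInt_line_ext with (2 := is_RInt_line_minus _ _ _ _ Hg Hh).
  intros v. rewrite RtoC_minus. ring.
Qed.

Lemma is_Mellin_scal (k : R) (g : R -> R) (s l : C) :
  is_Mellin g s l -> is_Mellin (fun v => k * g v) s (RtoC k * l).
Proof.
  unfold is_Mellin. intros Hg.
  apply is_RInt_line_ext with (2 := is_RInt_line_Cmult_l (RtoC k) _ _ Hg).
  intros v. rewrite RtoC_mult. ring.
Qed.

Lemma is_Mellin_shift (k : R) (g : R -> R) (s l : C) :
  is_Mellin g s l -> is_Mellin (fun v => g (v + k)) s (cexp (- (s * RtoC k)) * l).
Proof.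
  unfold is_Mellin. intros Hg.
  apply is_RInt_line_ext with (2 := is_RInt_line_Cmult_l _ _ _ (is_RInt_line_shift_real _ k _ Hg)).
  intros v. rewrite Cmult_assoc, <- cexp_plus, RtoC_plus. do 2 f_equal. ring.
Qed.

Lemma is_Mellin_reflect (g : R -> R) (s l : C) :
  is_Mellin g s l -> is_Mellin (fun v => g (- v)) (- s) l.
Proof.
  unfold is_Mellin. intros Hg. apply is_RInt_line_ext with (2 := is_RInt_line_reflect _ _ Hg).
  intros v. rewrite RtoC_opp. do 2 f_equal. ring.
Qed.

Lemma is_Mellin_exp_mult (k : R) (g : R -> R) (s l : C) :
  is_Mellin (fun v => exp (k * v) * g v) s l -> is_Mellin g (s + RtoC k) l.
Proof.
  unfold is_Mellin. apply is_RInt_line_ext. intros v.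
  rewrite RtoC_mult, <- cexp_RtoC, Cmult_assoc, <- cexp_plus, RtoC_mult. do 2 f_equal. ring.
Qed.

Lemma is_Mellin_conj (g : R -> R) (s l : C) : is_Mellin g s l -> is_Mellin g (Cconj s) (Cconj l).
Proof.
  unfold is_Mellin. intros Hg. apply is_RInt_line_ext with (2 := is_RInt_line_conj _ _ Hg).
  intros v. now rewrite Cmult_conj, cexp_conj, Cmult_conj, !Cconj_RtoC.
Qed.

Lemma Cmod_is_Mellin_le (g h : R -> R) (s l m : C) : (forall v, Rabs (g v) <= h v) ->
  is_Mellin g s l -> is_Mellin h (RtoC (Re s)) m -> Cmod l <= Cmod m.
Proof.
  unfold is_Mellin. intros Hgh Hg Hh. apply Rle_trans with (Re m).
  - apply (Cmod_is_RInt_line_le _ (fun v => Re (cexp (RtoC (Re s) * RtoC v) * RtoC (h v))))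
      with (2 := Hg).
    + intros v. rewrite <- RtoC_mult, cexp_RtoC, <- RtoC_mult, Cmod_mult, Cmod_cexp, Cmod_R.
      replace (Re (s * RtoC v)) with (Re s * v) by (destruct s; simpl; ring).
      apply Rmult_le_compat_l; [apply Rlt_le, exp_pos|apply Hgh].
    + apply (is_RInt_gen_map (V := C_R_NormedModule) (W := R_NormedModule) Re) with (3 := Hh).
      * destruct m. apply continuous_fst.
      * apply is_RInt_C_Re.
  - apply Re_le_Cmod.
Qed.

Lemma continuous_Mellin_integrand (g : R -> R) (s : C) (v : R) :
  continuous g v -> continuous (fun v : R => cexp (s * RtoC v) * RtoC (g v))%C v.
Proof.
  intros Hg. apply continuous_Cmult; [|now apply continuous_RtoC].
  apply (continuous_horizontal (fun w => cexp (s * w))), ex_derive_continuous_C.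
  auto with holomorphic.
Qed.

Lemma ex_Mellin_exp_bound (g : R -> R) (s : C) (K c : R) : 0 < c -> (forall v, continuous g v) ->
  (forall v, exp (Re s * v) * Rabs (g v) <= K * exp (- (c * Rabs v))) ->
  exists l : C, is_Mellin g s l.
Proof.
  intros Hc Hg HK. destruct (ex_RInt_line_exp_bound
    (fun v : R => cexp (s * RtoC v) * RtoC (g v))%C K c Hc) as [l [Hl _]].
  - intros v. now apply continuous_Mellin_integrand.
  - intros v. rewrite Cmod_mult, Cmod_cexp, Cmod_R.
    now replace (Re (s * RtoC v)) with (Re s * v) by (destruct s; simpl; ring).
  - now exists l.
Qed.

Lemma mult_minus_exp_le (a v : R) : 0 < a -> a * v - exp v <= a * (ln a - 1).
Proof.
  intros Ha. pose proof (exp_ineq1_le (v - ln a)).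
  replace (exp v) with (a * exp (v - ln a)); [nra|].
  rewrite <- (exp_ln a) at 1 by exact Ha. rewrite <- exp_plus. f_equal. ring.
Qed.

Lemma continuous_exp_opp_exp (v : R) : continuous (fun v => exp (- exp v)) v.
Proof. apply (ex_derive_continuous (V := R_NormedModule)). now auto_derive. Qed.

Lemma ex_Mellin_exp_opp_exp (z : C) : 0 < Re z ->
  exists l : C, is_Mellin (fun v => exp (- exp v)) z l.
Proof.
  intros Hz. set (a := Re z + 1). set (M := Rmax 0 (a * (ln a - 1))).
  apply ex_Mellin_exp_bound with (exp M) (Rmin 1 (Re z)).
  - apply Rmin_pos; lra.
  - exact continuous_exp_opp_exp.
  - intros v. rewrite Rabs_pos_eq, <- !exp_plus by apply Rlt_le, exp_pos. apply exp_le_compat.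
    pose proof (exp_pos v). pose proof (mult_minus_exp_le a v ltac:(unfold a; lra)).
    assert (HM := Rmax_l 0 (a * (ln a - 1))). assert (HMa := Rmax_r 0 (a * (ln a - 1))).
    fold M in HM, HMa.
    pose proof (Rmin_l 1 (Re z)). pose proof (Rmin_r 1 (Re z)).
    destruct (Rle_dec 0 v) as [Hv|Hv].
    + rewrite Rabs_pos_eq by exact Hv. unfold a in *. nra.
    + rewrite Rabs_left1 by lra. nra.
Qed.

Lemma is_Mellin_Gamma (z : C) : 0 < Re z -> is_Mellin (fun v => exp (- exp v)) z (CGamma z).
Proof.
  intros Hz. destruct (ex_Mellin_exp_opp_exp z Hz) as [l Hl].
  replace (CGamma z) with l; [exact Hl|]. symmetry.
  unfold CGamma. apply (is_RInt_gen_unique (V := C_R_CompleteNormedModule)).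
  revert Hl. unfold is_Mellin. apply is_RInt_gen_comp with (u := ln);
    [exact is_lim_ln_0|exact is_lim_ln_p|].
  exists (fun a => 0 < a) (fun b => 0 < b).
  { exists (mkposreal 1 Rlt_0_1). auto. }
  { now exists 0. }
  intros a b Ha Hb y Hy. simpl in *.
  rewrite <- (is_RInt_C_unique _ _ _ _ Hy).
  apply is_RInt_ext with (fun u => scal (V := C_R_NormedModule) (/ u)%R
    (cexp (z * RtoC (ln u)) * RtoC (exp (- exp (ln u)))))%C.
  - intros u Hu. assert (Hu_pos : 0 < u) by (assert (Hmin := Rmin_pos a b Ha Hb); lra).
    unfold Rcpow. rewrite scal_R_Cmult, exp_ln by exact Hu_pos.
    replace (/ u) with (exp (- ln u)) by (rewrite exp_Ropp, exp_ln; auto).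
    rewrite <- cexp_RtoC, Cmult_assoc, <- cexp_plus, RtoC_opp. do 2 f_equal. ring.
  - apply (is_RInt_comp (V := C_R_CompleteNormedModule)
      (fun v : R => cexp (z * RtoC v) * RtoC (exp (- exp v)))%C ln).
    + intros u _. apply continuous_Mellin_integrand, continuous_exp_opp_exp.
    + intros u Hu. assert (Hu_pos : 0 < u) by (pose proof (Rmin_pos a b Ha Hb); lra). split.
      * now apply is_derive_ln.
      * apply (ex_derive_continuous (V := R_NormedModule)). auto_derive. lra.
Qed.

Lemma is_Mellin_Gamma_scale (z : C) (k : R) : 0 < Re z -> 0 < k ->
  is_Mellin (fun v => exp (- (k * exp v))) z (Rcpow k (- z) * CGamma z).
Proof.
  intros Hz Hk. unfold Rcpow. replace (- z * RtoC (ln k))%C with (- (z * RtoC (ln k)))%C by ring.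
  apply is_Mellin_ext with (2 := is_Mellin_shift (ln k) _ _ _ (is_Mellin_Gamma z Hz)).
  intros v. now rewrite exp_plus, exp_ln, (Rmult_comm k).
Qed.

Lemma CGamma_conj (z : C) : 0 < Re z -> CGamma (Cconj z) = Cconj (CGamma z).
Proof.
  intros Hz. apply is_Mellin_unique with (fun v => exp (- exp v)) (Cconj z).
  - now apply is_Mellin_Gamma.
  - now apply is_Mellin_conj, is_Mellin_Gamma.
Qed.

(* [omega x] minus its leading behaviour [1 / (2 sqrt x)] at [0], in the variable [v = ln x]. *)
Definition theta_log (v : R) : R := omega (exp v) - exp (- v / 2) / 2.

Lemma theta_log_opp (v : R) : theta_log (- v) = exp (v / 2) * theta_log v.
Proof.
  assert (Hsqrt : sqrt (exp v) = exp (v / 2)).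
  { rewrite <- (sqrt_square (exp (v / 2))), <- exp_plus by apply Rlt_le, exp_pos.
    do 2 f_equal. field. }
  assert (Hmod := theta_modular (exp v) (exp_pos v)). rewrite Hsqrt, <- exp_Ropp in Hmod.
  assert (Hinv : exp (v / 2) * exp (- v / 2) = 1)
    by (rewrite <- exp_plus, <- exp_0; f_equal; field).
  unfold theta_log. replace (- - v / 2) with (v / 2) by field. nra.
Qed.

Lemma Rabs_theta_log_le (v : R) : Rabs (theta_log v) <= exp (- (Rmax 0 v / 2)).
Proof.
  assert (Hpos : forall u, 0 <= u -> Rabs (theta_log u) <= exp (- u / 2)).
  { intros u Hu. pose proof (omega_nonneg _ (exp_pos u)).
    assert (Homega_le := omega_le_inv _ (exp_pos u)).
    rewrite <- exp_Ropp in Homega_le. pose proof (exp_le_compat (- u) (- u / 2) ltac:(lra)).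
    unfold theta_log. apply Rabs_le. lra. }
  destruct (Rle_dec 0 v) as [Hv|Hv].
  - rewrite Rmax_right by exact Hv. replace (- (v / 2)) with (- v / 2) by field. now apply Hpos.
  - rewrite Rmax_left by lra. rewrite <- (Ropp_involutive v), theta_log_opp, Rabs_mult.
    rewrite Rabs_pos_eq by apply Rlt_le, exp_pos.
    apply Rle_trans with (exp (- v / 2) * exp (- - v / 2)).
    + apply Rmult_le_compat_l; [apply Rlt_le, exp_pos|]. apply Hpos. lra.
    + rewrite <- exp_plus. apply exp_le_compat. lra.
Qed.

Lemma continuous_theta_log (v : R) : continuous theta_log v.
Proof.
  apply (continuous_minus (V := R_NormedModule)).
  - apply continuous_comp; [apply continuous_exp|apply continuous_omega, exp_pos].
  - apply (ex_derive_continuous (V := R_NormedModule)). now auto_derive.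
Qed.

Lemma ex_Mellin_theta_log (s : C) : 0 < Re s < / 2 -> exists F : C, is_Mellin theta_log s F.
Proof.
  intros Hs. apply ex_Mellin_exp_bound with 1 (Rmin (Re s) (/ 2 - Re s)).
  - apply Rmin_pos; lra.
  - exact continuous_theta_log.
  - intros v. rewrite Rmult_1_l.
    eapply Rle_trans; [apply Rmult_le_compat_l; [apply Rlt_le, exp_pos|apply Rabs_theta_log_le]|].
    rewrite <- exp_plus. apply exp_le_compat.
    pose proof (Rmin_l (Re s) (/ 2 - Re s)). pose proof (Rmin_r (Re s) (/ 2 - Re s)).
    destruct (Rle_dec 0 v) as [Hv|Hv].
    + rewrite Rmax_right, Rabs_pos_eq by lra. nra.
    + rewrite Rmax_left, Rabs_left1 by lra. nra.
Qed.

Lemma is_Mellin_theta_log_reflect (s F : C) :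
  is_Mellin theta_log s F -> is_Mellin theta_log (RtoC (/ 2) - s) F.
Proof.
  intros HF. replace (RtoC (/ 2) - s)%C with (- s + RtoC (/ 2))%C by ring.
  apply is_Mellin_exp_mult. apply is_Mellin_ext with (2 := is_Mellin_reflect _ _ _ HF).
  intros v. rewrite theta_log_opp. do 2 f_equal. field.
Qed.

Lemma theta_term_odd (x : R) (m : nat) : theta_term x (2 * m + 1) = theta_term (4 * x) m.
Proof.
  unfold theta_term. f_equal. replace (S (2 * m + 1)) with (2 * S m)%nat by lia.
  rewrite mult_INR. change (INR 2) with 2. ring.
Qed.

Lemma sum_n_RtoC (u : nat -> R) (n : nat) : sum_n (fun k => RtoC (u k)) n = RtoC (sum_n u n).
Proof.
  induction n as [|n IH]; [now rewrite !sum_O|]. rewrite !sum_Sn, IH. symmetry. apply RtoC_plus.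
Qed.

Lemma sum_alternating_theta (x : R) (m : nat) :
  sum_n (theta_term x) (2 * m + 1) - 2 * sum_n (theta_term (4 * x)) m =
  sum_n (fun k => (-1) ^ k * theta_term x k) (2 * m + 1).
Proof.
  induction m as [|m IH].
  - assert (Hodd : theta_term x 1 = theta_term (4 * x) 0) by exact (theta_term_odd x 0).
    change (2 * 0 + 1)%nat with 1%nat. rewrite !sum_Sn, !sum_O, <- Hodd.
    change plus with Rplus. ring.
  - replace (2 * S m + 1)%nat with (S (S (2 * m + 1))) by lia.
    assert (Hodd : theta_term x (S (S (2 * m + 1))) = theta_term (4 * x) (S m)).
    { rewrite <- theta_term_odd. f_equal. lia. }
    assert (Hpow : (-1) ^ (2 * m + 1) = -1) by (rewrite Nat.add_1_r; apply pow_1_odd).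
    rewrite !sum_Sn, <- IH, Hodd, <- !tech_pow_Rmult, Hpow. change plus with Rplus. ring.
Qed.

Lemma Rabs_alternating_theta_le (x : R) (n : nat) : 0 < x ->
  Rabs (sum_n (fun k => (-1) ^ k * theta_term x k) n - (omega x - 2 * omega (4 * x))) <=
    theta_term x (S n).
Proof.
  intros Hx.
  destruct (ex_series_alternating (fun k => RtoC ((-1) ^ k * theta_term x k)) (theta_term x))
    as [l [Hl Hle]].
  - intros k. rewrite Cmod_R, Rabs_mult, pow_1_abs, Rmult_1_l.
    apply Req_le, Rabs_pos_eq, Rlt_le, theta_term_pos.
  - intros k. rewrite <- RtoC_plus, Cmod_R.
    replace ((-1) ^ k * theta_term x k + (-1) ^ S k * theta_term x (S k))
      with ((-1) ^ k * (theta_term x k - theta_term x (S k))) by (simpl pow; ring).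
    rewrite Rabs_mult, pow_1_abs, Rmult_1_l. apply Req_le, Rabs_pos_eq, Rge_le, Rge_minus, Rle_ge.
    now apply theta_term_decr.
  - apply ex_series_lim_0, ex_series_theta_term, Hx.
  - specialize (Hle n). rewrite sum_n_RtoC in Hle.
    replace l with (RtoC (omega x - 2 * omega (4 * x))) in Hle;
      [now rewrite <- RtoC_minus, Cmod_R in Hle|].
    assert (Hodd : filterlim (fun m => (2 * m + 1)%nat) eventually eventually).
    { apply eventually_subseq. intros m. lia. }
    assert (Hsum : is_lim_seq (fun m => sum_n (theta_term x) (2 * m + 1)) (omega x)).
    { apply (filterlim_comp _ _ _ _ (sum_n (theta_term x)) _ _ _ Hodd).
      now apply Series_correct, ex_series_theta_term. }
    assert (Hsum4 : is_lim_seq (sum_n (theta_term (4 * x))) (omega (4 * x))).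
    { apply Series_correct, ex_series_theta_term. lra. }
    assert (Hdiff := is_lim_seq_minus' _ _ _ _ Hsum (is_lim_seq_scal_l _ 2 _ Hsum4)).
    assert (Hlim := filterlim_comp _ _ _ _ _ _ _ _ Hodd Hl).
    symmetry. apply (filterlim_locally_unique _ _ _ Hlim).
    apply (filterlim_ext _ _ (fun m =>
      eq_trans (f_equal RtoC (sum_alternating_theta x m)) (eq_sym (sum_n_RtoC _ _)))).
    apply (filterlim_comp _ _ _ _ RtoC _ _ _ Hdiff).
    apply (continuous_RtoC (fun y => y)), continuous_id.
Qed.

Definition gamma_factor (s : C) : C := (Rcpow PI (- (s / RtoC 2)) * CGamma (s / RtoC 2))%C.

Lemma Re_half (s : C) : Re (s / RtoC 2) = Re s / 2.
Proof. destruct s. simpl. field. Qed.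

Lemma gamma_factor_conj (s : C) : 0 < Re s -> gamma_factor (Cconj s) = Cconj (gamma_factor s).
Proof.
  intros Hs. unfold gamma_factor.
  replace (Cconj s / RtoC 2)%C with (Cconj (s / RtoC 2))
    by (destruct s; apply injective_projections; simpl; field).
  rewrite <- Copp_conj, Rcpow_conj, CGamma_conj, Cmult_conj by (rewrite Re_half; lra). reflexivity.
Qed.

Lemma is_Mellin_theta_term (s : C) (n : nat) : 0 < Re s ->
  is_Mellin (fun v => theta_term (exp v) n) (s / RtoC 2) (gamma_factor s * Rcpow (INR (S n)) (- s)).
Proof.
  intros Hs. assert (Hn : 0 < INR (S n)) by (apply lt_0_INR; lia). pose proof PI_RGT_0.
  assert (Hpow : Rcpow (PI * (INR (S n) * INR (S n))) (- (s / RtoC 2)) =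
    (Rcpow PI (- (s / RtoC 2)) * Rcpow (INR (S n)) (- s))%C).
  { unfold Rcpow. rewrite <- cexp_plus, !ln_mult, !RtoC_plus by auto using Rmult_lt_0_compat.
    f_equal. field. }
  unfold gamma_factor. rewrite (Cmult_comm (_ * _)), Cmult_assoc,
    (Cmult_comm (Rcpow (INR _) _)), <- Hpow.
  eapply is_Mellin_ext; [|apply is_Mellin_Gamma_scale].
  - intros v. unfold theta_term. do 2 f_equal. ring.
  - rewrite Re_half. lra.
  - auto using Rmult_lt_0_compat.
Qed.

Lemma is_Mellin_alternating_theta_sum (s : C) (n : nat) : 0 < Re s ->
  is_Mellin (fun v => sum_n (fun k => (-1) ^ k * theta_term (exp v) k) n) (s / RtoC 2)
    (gamma_factor s * sum_n (eta_term s) n).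
Proof.
  intros Hs.
  assert (Hterm : forall k, is_Mellin (fun v => (-1) ^ k * theta_term (exp v) k) (s / RtoC 2)
    (gamma_factor s * eta_term s k)%C).
  { intros k. unfold eta_term. rewrite (Cmult_assoc (gamma_factor s)),
      (Cmult_comm (gamma_factor s)), <- Cmult_assoc.
    now apply is_Mellin_scal, is_Mellin_theta_term. }
  induction n as [|n IH].
  - rewrite sum_O. apply is_Mellin_ext with (2 := Hterm O). intros v. now rewrite sum_O.
  - rewrite sum_Sn. change plus with Cplus. rewrite Cmult_plus_distr_l.
    apply is_Mellin_ext with (2 := is_Mellin_plus _ _ _ _ _ IH (Hterm (S n))). intros v.
    now rewrite sum_Sn.
Qed.

Lemma Mellin_alternating_theta (s F : C) : 0 < Re s ->
  is_Mellin (fun v => omega (exp v) - 2 * omega (4 * exp v)) (s / RtoC 2) F ->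
  F = (gamma_factor s * eta s)%C.
Proof.
  intros Hs HF. set (d := RtoC (Re s)).
  assert (Hdiff : forall n, Cmod (gamma_factor s * sum_n (eta_term s) n - F) <=
    Cmod (gamma_factor d) * exp (- (Re s * ln (INR (S (S n)))))).
  { intros n. replace (exp (- (Re s * ln (INR (S (S n))))))
      with (Cmod (Rcpow (INR (S (S n))) (- d)))
      by (rewrite Cmod_Rcpow; f_equal; simpl; ring).
    rewrite <- Cmod_mult.
    apply (Cmod_is_Mellin_le) with
      (2 := is_Mellin_minus _ _ _ _ _ (is_Mellin_alternating_theta_sum s n Hs) HF)
      (h := fun v => theta_term (exp v) (S n)).
    - intros v. apply Rabs_alternating_theta_le, exp_pos.
    - rewrite Re_half, RtoC_div by lra. now apply (is_Mellin_theta_term d). }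
  assert (Heta : filterlim (fun n => gamma_factor s * sum_n (eta_term s) n)%C eventually
    (locally (gamma_factor s * eta s)%C)).
  { apply filterlim_Cmult; [apply filterlim_const|now apply is_series_eta]. }
  assert (HF' : filterlim (fun n => gamma_factor s * sum_n (eta_term s) n)%C eventually
    (locally (0 + F)%C)).
  { apply (filterlim_ext (fun n => gamma_factor s * sum_n (eta_term s) n - F + F)%C);
      [intros n; ring|].
    apply filterlim_Cplus; [|apply filterlim_const]. apply (filterlim_C_0_le _ _ Hdiff).
    apply filterlim_exp_decay; [exact Hs|]. apply (is_lim_seq_incr_1 (fun n => ln (INR (S n)))).
    exact filterlim_ln_INR_S. }
  rewrite Cplus_0_l in HF'. exact (filterlim_locally_unique _ _ _ HF' Heta).
Qed.

Lemma alternating_theta_log (v : R) :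
  theta_log v - 2 * theta_log (v + 2 * ln 2) = omega (exp v) - 2 * omega (4 * exp v).
Proof.
  unfold theta_log. replace (- (v + 2 * ln 2) / 2) with (- v / 2 + - ln 2) by field.
  replace (v + 2 * ln 2) with (ln 2 + ln 2 + v) by ring.
  rewrite !exp_plus, exp_Ropp, !exp_ln by lra. replace (2 * 2) with 4 by ring. field.
Qed.

Lemma Mellin_theta_log (s F : C) : 0 < Re s < 1 ->
  is_Mellin theta_log (s / RtoC 2) F -> F = (gamma_factor s * zeta s)%C.
Proof.
  intros Hs HF. assert (Hden := zeta_denominator_neq_0 s (proj2 Hs)).
  assert (Heta : ((1 - Rcpow 2 (1 - s)) * F)%C = (gamma_factor s * eta s)%C).
  { apply Mellin_alternating_theta; [apply Hs|].
    replace ((1 - Rcpow 2 (1 - s)) * F)%C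
      with (F - RtoC 2 * (cexp (- (s / RtoC 2 * RtoC (2 * ln 2))) * F))%C.
    - apply (is_Mellin_ext _ _ _ _ alternating_theta_log).
      apply is_Mellin_minus; [exact HF|]. now apply is_Mellin_scal, is_Mellin_shift.
    - unfold Rcpow. replace ((1 - s) * RtoC (ln 2))%C
        with (RtoC (ln 2) + - (s / RtoC 2 * RtoC (2 * ln 2)))%C by (rewrite RtoC_mult; field).
      rewrite cexp_plus, cexp_RtoC, exp_ln by lra. ring. }
  unfold zeta, Cdiv. rewrite Cmult_assoc, <- Heta. field. exact Hden.
Qed.

Theorem zeta_functional_equation (s : C) : 0 < Re s < 1 ->
  (gamma_factor s * zeta s)%C = (gamma_factor (1 - s) * zeta (1 - s))%C.
Proof.
  intros Hs. destruct (ex_Mellin_theta_log (s / RtoC 2)) as [F HF]; [rewrite Re_half; lra|].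
  rewrite <- (Mellin_theta_log s F Hs HF). apply Mellin_theta_log.
  - rewrite re_minus. simpl. lra.
  - replace ((1 - s) / RtoC 2)%C with (RtoC (/ 2) - s / RtoC 2)%C
      by (destruct s; apply injective_projections; simpl; field).
    now apply is_Mellin_theta_log_reflect.
Qed.

(** * The Riemann-Siegel theta function *)

Lemma Cinv_0 : (/ RtoC 0)%C = RtoC 0.
Proof. apply injective_projections; simpl; unfold Rdiv; rewrite ?Ropp_0; apply Rmult_0_l. Qed.

Lemma Csqr_eq_1 (z : C) : (z * z)%C = 1 -> z = 1 \/ z = (- (1))%C.
Proof.
  intros Hsq. destruct (Ceq_dec z 1) as [Hz|Hz]; [now left|right].
  apply Cminus_eq_contra in Hz. replace z with ((z * z - 1) / (z - 1) - 1)%C by (field; exact Hz).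
  rewrite Hsq. field. exact Hz.
Qed.

Lemma continuous_square_root_of_1 (q : R -> C) :
  (forall x, 0 <= x <= 1 -> continuous q x) -> (forall x, 0 <= x <= 1 -> (q x * q x)%C = 1) ->
  q 0 = 1 -> q 1 = 1.
Proof.
  intros Hq Hsq Hstart.
  destruct (Csqr_eq_1 _ (Hsq 1 ltac:(lra))) as [Hend|Hend]; [exact Hend|exfalso].
  destruct (f_interv_is_interv (fun x => - Re (q x)) 0 1 0) as [x [Hx Hroot]].
  - lra.
  - rewrite Hstart, Hend. simpl. lra.
  - intros x Hx. apply continuity_pt_filterlim.
    apply (continuous_opp (V := R_NormedModule) (fun y => Re (q y)) x), (continuous_comp q Re);
      [now apply Hq|].
    destruct (q x). apply continuous_fst.
  - destruct (Csqr_eq_1 _ (Hsq x Hx)) as [Hpm|Hpm]; rewrite Hpm in Hroot; simpl in Hroot; lra.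
Qed.

Definition critical (z : C) : C := (RtoC (/ 2) + Ci * z)%C.

Lemma Re_critical (z : C) : Re (critical z) = / 2 - Im z.
Proof. destruct z. simpl. ring. Qed.

Lemma strip_critical (z : C) : strip z -> 0 < Re (critical z) < 1.
Proof. unfold strip. rewrite Re_critical. intros Hz. apply Rabs_def2 in Hz. lra. Qed.

Lemma critical_conj (z : C) : Cconj (critical z) = (1 - critical (Cconj z))%C.
Proof. destruct z. apply injective_projections; simpl; field. Qed.

Lemma strip_conj (z : C) : strip z -> strip (Cconj z).
Proof. unfold strip. rewrite im_conj, Rabs_Ropp. auto. Qed.

Lemma strip_scale (x : R) (z : C) : 0 <= x <= 1 -> strip z -> strip (RtoC x * z).
Proof.
  unfold strip. intros Hx Hz. replace (Im (RtoC x * z)) with (x * Im z)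
    by (destruct z; simpl; ring).
  rewrite Rabs_mult, Rabs_pos_eq by lra. pose proof (Rabs_pos (Im z)). nra.
Qed.

Section Riemann_Siegel.

Variable th : C -> C.
Hypothesis Hth : is_RS_theta th.

Definition phase (z : C) : C := cexp (Ci * th z).

Definition Hardy_Z (z : C) : C := (phase z * zeta (critical z))%C.

Lemma ex_derive_phase (z : C) : strip z -> ex_derive phase z.
Proof. intros Hz. pose proof (proj1 Hth z Hz). unfold phase. auto with holomorphic. Qed.

Lemma phase_0 : phase 0 = 1.
Proof. unfold phase. rewrite (proj1 (proj2 Hth)), Cmult_0_r. apply cexp_0. Qed.

Lemma phase_sq_Gamma (z : C) : strip z ->
  (phase z * phase z)%C = (Rcpow PI (- (Ci * z)) *
    (CGamma (critical z / RtoC 2) / CGamma ((1 - critical z) / RtoC 2)))%C.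
Proof.
  intros Hz.
  replace (critical z / RtoC 2)%C with (RtoC (/ 4) + Ci * z / RtoC 2)%C
    by (destruct z; apply injective_projections; simpl; field).
  replace ((1 - critical z) / RtoC 2)%C with (RtoC (/ 4) - Ci * z / RtoC 2)%C
    by (destruct z; apply injective_projections; simpl; field).
  exact (proj2 (proj2 Hth) z Hz).
Qed.

(* Division by [0] gives [0], so a vanishing Gamma factor would contradict [phase_sq_Gamma]. *)
Lemma gamma_factor_critical_neq_0 (z : C) : strip z ->
  gamma_factor (critical z) <> 0 /\ gamma_factor (1 - critical z) <> 0.
Proof.
  intros Hz. assert (Hne : (phase z * phase z)%C <> 0) by (apply Cmult_neq_0; apply cexp_neq_0).
  rewrite phase_sq_Gamma in Hne by exact Hz.
  split; (apply Cmult_neq_0; [apply cexp_neq_0|]); intros HGamma; apply Hne; rewrite HGamma;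
    unfold Cdiv; rewrite ?Cinv_0; ring.
Qed.

Lemma phase_sq (z : C) : strip z ->
  (phase z * phase z)%C = (gamma_factor (critical z) / gamma_factor (1 - critical z))%C.
Proof.
  intros Hz. rewrite phase_sq_Gamma by exact Hz.
  destruct (gamma_factor_critical_neq_0 z Hz) as [_ Hne]. unfold gamma_factor in *.
  assert (Hpow : Rcpow PI (- (Ci * z)) =
    (Rcpow PI (- (critical z / RtoC 2)) / Rcpow PI (- ((1 - critical z) / RtoC 2)))%C).
  { unfold Rcpow. rewrite <- cexp_minus. f_equal. destruct z.
    apply injective_projections; simpl; field. }
  rewrite Hpow. field. split; intros Hvanish; apply Hne; rewrite Hvanish; ring.
Qed.

Lemma phase_sq_zeta (z : C) : strip z ->
  (phase z * phase z * zeta (critical z))%C = zeta (1 - critical z).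
Proof.
  intros Hz. destruct (gamma_factor_critical_neq_0 z Hz) as [_ Hne].
  rewrite phase_sq by exact Hz.
  replace (gamma_factor (critical z) / gamma_factor (1 - critical z) * zeta (critical z))%C
    with (gamma_factor (critical z) * zeta (critical z) / gamma_factor (1 - critical z))%C
    by (field; exact Hne).
  rewrite zeta_functional_equation by now apply strip_critical. field. exact Hne.
Qed.

Lemma phase_conj_sq (z : C) : strip z ->
  (phase (Cconj z) * Cconj (phase z) * (phase (Cconj z) * Cconj (phase z)))%C = 1.
Proof.
  intros Hz. assert (Hz' := strip_conj z Hz).
  destruct (gamma_factor_critical_neq_0 z Hz) as [_ Hne].
  destruct (gamma_factor_critical_neq_0 (Cconj z) Hz') as [Hne1 Hne2].
  transitivity (phase (Cconj z) * phase (Cconj z) * Cconj (phase z * phase z))%C;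
    [rewrite Cmult_conj; ring|].
  pose proof (strip_critical z Hz).
  rewrite !phase_sq, Cdiv_conj, <- !gamma_factor_conj, Cminus_conj, Cconj_RtoC, critical_conj
    by (auto; rewrite ?re_minus; simpl in *; lra).
  replace (1 - (1 - critical (Cconj z)))%C with (critical (Cconj z)) by ring. field. auto.
Qed.

Lemma phase_conj (z : C) : strip z -> (phase (Cconj z) * Cconj (phase z))%C = 1.
Proof.
  intros Hz. set (q := fun x : R => (phase (Cconj (RtoC x * z)) * Cconj (phase (RtoC x * z)))%C).
  assert (Hq1 : q 1 = 1).
  { apply continuous_square_root_of_1.
    - intros x Hx. pose proof (strip_scale x z Hx Hz).
      assert (Hline : continuous (fun x : R => RtoC x * z)%C x).
      { apply continuous_Cmult;
          [apply (continuous_RtoC (fun x => x)), continuous_id|apply continuous_const]. }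
      apply continuous_Cmult.
      + apply (continuous_comp _ phase).
        * apply (continuous_comp _ Cconj); [exact Hline|apply continuous_Cconj].
        * apply ex_derive_continuous_C, ex_derive_phase. now apply strip_conj.
      + apply (continuous_comp (fun x : R => phase (RtoC x * z)) Cconj); [|apply continuous_Cconj].
        apply (continuous_comp _ phase); [exact Hline|].
        now apply ex_derive_continuous_C, ex_derive_phase.
    - intros x Hx. now apply phase_conj_sq, strip_scale.
    - unfold q. rewrite Cmult_0_l, Cconj_RtoC, phase_0, Cconj_RtoC. apply Cmult_1_l. }
  unfold q in Hq1. now rewrite Cmult_1_l in Hq1.
Qed.

Lemma Hardy_Z_conj (z : C) : strip z -> Cconj (Hardy_Z z) = Hardy_Z (Cconj z).
Proof.
  intros Hz. unfold Hardy_Z. rewrite Cmult_conj, <- zeta_conj, critical_conj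
    by now apply strip_critical.
  rewrite <- phase_sq_zeta by now apply strip_conj.
  replace (phase (Cconj z) * zeta (critical (Cconj z)))%C
    with (phase (Cconj z) * Cconj (phase z) * (phase (Cconj z) * zeta (critical (Cconj z))))%C
    by (rewrite phase_conj by exact Hz; ring).
  ring.
Qed.

Lemma ex_derive_Hardy_Z (z : C) : strip z -> ex_derive Hardy_Z z.
Proof.
  intros Hz. apply ex_derive_Cmult; [now apply ex_derive_phase|].
  apply (ex_derive_Ccomp zeta critical); [now apply ex_derive_zeta, strip_critical|].
  unfold critical. auto with holomorphic.
Qed.

Lemma Cmod_Hardy_Z_le (d : R) (z : C) : 0 < d -> Rabs (Im z) <= / 2 - d ->
  Cmod (Hardy_Z z) <= 4 / (d * d) * (1 + Cmod z).
Proof.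
  intros Hd Hz. assert (Hstrip : strip z) by (unfold strip; lra).
  assert (HC : 0 <= 4 / (d * d)) by (apply Rdiv_le_0_compat; [lra|nra]).
  assert (Hz' := Hz). apply Rabs_le_between in Hz'.
  assert (Hs : Cmod (critical z) <= 1 + Cmod z).
  { eapply Rle_trans; [apply Cmod_triangle|].
    rewrite Cmod_mult, Cmod_Ci, Cmod_R, Rabs_pos_eq; lra. }
  assert (Hs' : Cmod (1 - critical z) <= 1 + Cmod z).
  { replace (1 - critical z)%C with (RtoC (/ 2) - Ci * z)%C
      by (destruct z; apply injective_projections; simpl; field).
    eapply Rle_trans; [apply Cmod_triangle_minus|].
    rewrite Cmod_mult, Cmod_Ci, Cmod_R, Rabs_pos_eq; lra. }
  assert (Hzeta := Cmod_zeta_le d (critical z) Hd ltac:(rewrite Re_critical; lra)).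
  assert (Hzeta' : Cmod (zeta (1 - critical z)) <= 4 / (d * d) * Cmod (1 - critical z)).
  { apply (Cmod_zeta_le d); [exact Hd|]. rewrite re_minus, Re_critical. simpl. lra. }
  pose proof (Cmod_ge_0 z).
  apply Rsqr_incr_0_var; [|apply Rmult_le_pos; lra]. unfold Rsqr.
  rewrite <- Cmod_mult. unfold Hardy_Z.
  replace (phase z * zeta (critical z) * (phase z * zeta (critical z)))%C
    with (phase z * phase z * zeta (critical z) * zeta (critical z))%C by ring.
  rewrite phase_sq_zeta, Cmod_mult by exact Hstrip.
  apply Rmult_le_compat; try apply Cmod_ge_0.
  - eapply Rle_trans; [exact Hzeta'|]. now apply Rmult_le_compat_l.
  - eapply Rle_trans; [exact Hzeta|]. now apply Rmult_le_compat_l.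
Qed.

End Riemann_Siegel.

(** * The kernel [pi / (2 sinh (pi x / 2))] *)

Definition two_csinh (x : C) : C := (RtoC 2 * csinh (RtoC PI * x / RtoC 2))%C.

Lemma two_csinh_cexp (x : C) :
  two_csinh x = (cexp (RtoC (PI / 2) * x) - cexp (RtoC (- (PI / 2)) * x))%C.
Proof.
  unfold two_csinh, csinh.
  replace (RtoC PI * x / RtoC 2)%C with (RtoC (PI / 2) * x)%C.
  2:{ destruct x. apply injective_projections; simpl; field. }
  replace (- (RtoC (PI / 2) * x))%C with (RtoC (- (PI / 2)) * x)%C by (rewrite RtoC_opp; ring).
  field.
Qed.

Lemma two_csinh_conj (x : C) : two_csinh (Cconj x) = Cconj (two_csinh x).
Proof. now rewrite !two_csinh_cexp, Cminus_conj, !cexp_conj, !Cmult_conj, !Cconj_RtoC. Qed.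

Lemma two_csinh_0 : two_csinh 0 = 0.
Proof. rewrite two_csinh_cexp, !Cmult_0_r. ring. Qed.

Lemma is_derive_two_csinh (x : C) : is_derive two_csinh x
  (RtoC (PI / 2) * cexp (RtoC (PI / 2) * x) - RtoC (- (PI / 2)) * cexp (RtoC (- (PI / 2)) * x))%C.
Proof.
  apply (is_derive_ext (fun x => cexp (RtoC (PI / 2) * x) - cexp (RtoC (- (PI / 2)) * x))%C).
  { intros y. symmetry. apply two_csinh_cexp. }
  apply (is_derive_minus (V := C_NormedModule)); apply is_derive_cexp_linear.
Qed.

Lemma is_derive_two_csinh_0 : is_derive two_csinh (RtoC 0) (RtoC PI).
Proof.
  assert (Hder := is_derive_two_csinh 0).
  rewrite !Cmult_0_r, cexp_0, !Cmult_1_r, <- RtoC_minus in Hder.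
  now replace (PI / 2 - - (PI / 2)) with PI in Hder by field.
Qed.

Lemma two_csinh_neq_0 (x : C) : strip x -> x <> 0 -> two_csinh x <> 0.
Proof.
  intros Hx Hne Hzero. rewrite two_csinh_cexp in Hzero. apply Ceq_minus in Hzero.
  pose proof PI_RGT_0. unfold strip in Hx. apply Rabs_def2 in Hx.
  assert (Hperiod : cexp (RtoC PI * x) = 1).
  { replace (RtoC PI * x)%C with (RtoC (PI / 2) * x - RtoC (- (PI / 2)) * x)%C
      by (destruct x; apply injective_projections; simpl; field).
    rewrite cexp_minus, Hzero. field. apply cexp_neq_0. }
  apply cexp_eq_1_small in Hperiod.
  - apply Hne. replace x with (RtoC PI * x / RtoC PI)%C by (field; apply RtoC_neq_0; lra).
    rewrite Hperiod. unfold Cdiv. apply Cmult_0_l.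
  - destruct x. simpl in *. nra.
Qed.

Lemma Cmod_two_csinh_ge (x : C) : 1 <= Rabs (Re x) ->
  exp (PI / 2 * Rabs (Re x)) / 2 <= Cmod (two_csinh x).
Proof.
  intros Hx. rewrite two_csinh_cexp. pose proof PI2_1.
  assert (Hmod : forall k, Cmod (cexp (RtoC k * x)) = exp (k * Re x)).
  { intros k. rewrite Cmod_cexp. f_equal. destruct x. simpl. ring. }
  assert (Hle : exp (- (PI / 2 * Rabs (Re x))) <= exp (PI / 2 * Rabs (Re x)) / 2).
  { pose proof (exp_ineq1_le (PI / 2 * Rabs (Re x))).
    rewrite exp_Ropp. set (y := exp (PI / 2 * Rabs (Re x))) in *.
    assert (Hy : 2 <= y) by nra. apply Rle_div_r; [lra|]. rewrite Rmult_comm.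
    apply Rle_div_l; [lra|]. nra. }
  destruct (Rle_dec 0 (Re x)) as [Hre|Hre].
  - rewrite Rabs_pos_eq in * by exact Hre. eapply Rle_trans; [|apply Cmod_triangle_inv].
    rewrite !Hmod, Ropp_mult_distr_l_reverse. lra.
  - rewrite Rabs_left1 in * by lra. rewrite Cmod_minus_sym.
    eapply Rle_trans; [|apply Cmod_triangle_inv].
    rewrite !Hmod. rewrite Ropp_mult_distr_r_reverse, Ropp_involutive in Hle.
    rewrite Ropp_mult_distr_r_reverse, <- Ropp_mult_distr_l in *. lra.
Qed.

Section Hardy_kernel.

Variable th : C -> C.
Hypothesis Hth : is_RS_theta th.
Variables sigma t : R.
Hypothesis Hsigma : 0 < sigma < / 2.

Definition Hardy_kernel (x : C) : C := (RtoC PI * Hardy_Z th (RtoC t + x) / two_csinh x)%C.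

Lemma strip_shift (x : C) : Rabs (Im x) <= sigma -> strip (RtoC t + x).
Proof.
  unfold strip. intros Hx. replace (Im (RtoC t + x)) with (Im x) by (destruct x; simpl; ring). lra.
Qed.

Lemma ex_derive_Hardy_kernel (x : C) : Rabs (Im x) <= sigma -> x <> 0 -> ex_derive Hardy_kernel x.
Proof.
  intros Hx Hne. apply ex_derive_Cdiv.
  - apply ex_derive_Cmult; [apply ex_derive_C_const|].
    apply (ex_derive_Ccomp (Hardy_Z th)); [now apply ex_derive_Hardy_Z, strip_shift|].
    auto with holomorphic.
  - eexists. apply is_derive_two_csinh.
  - apply two_csinh_neq_0; [unfold strip; lra|exact Hne].
Qed.

Lemma Hardy_kernel_residue : is_simple_residue Hardy_kernel 0 (Hardy_Z th (RtoC t)).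
Proof.
  assert (HPI : RtoC PI <> 0) by apply RtoC_neq_0, PI_neq0.
  replace (Hardy_Z th (RtoC t)) with (RtoC PI * Hardy_Z th (RtoC t + 0) / RtoC PI)%C
    by (rewrite Cplus_0_r; field; exact HPI).
  apply (is_simple_residue_div (fun x => RtoC PI * Hardy_Z th (RtoC t + x))%C).
  - apply ex_derive_continuous_C, ex_derive_Cmult; [apply ex_derive_C_const|].
    apply (ex_derive_Ccomp (Hardy_Z th)); [|auto with holomorphic].
    apply ex_derive_Hardy_Z, strip_shift; [exact Hth|]. simpl. rewrite Rabs_R0. lra.
  - exact is_derive_two_csinh_0.
  - exact two_csinh_0.
  - exact HPI.
Qed.

Lemma Hardy_kernel_conj (x : C) : Rabs (Im x) <= sigma -> x <> 0 ->
  Cconj (Hardy_kernel x) = Hardy_kernel (Cconj x).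
Proof.
  intros Hx Hne. unfold Hardy_kernel.
  rewrite Cdiv_conj by (apply two_csinh_neq_0; [unfold strip; lra|exact Hne]).
  rewrite Cmult_conj, Cconj_RtoC, Hardy_Z_conj, Cplus_conj, Cconj_RtoC, two_csinh_conj
    by now try apply strip_shift.
  reflexivity.
Qed.

Lemma Hardy_kernel_decay : exists K, forall x, 1 <= Rabs (Re x) -> Rabs (Im x) <= sigma ->
  Cmod (Hardy_kernel x) <= K * exp (- ((PI / 2 - 1) * Rabs (Re x))).
Proof.
  set (d := / 2 - sigma). set (B := 4 / (d * d)).
  pose proof PI_RGT_0. assert (Hd : 0 < d) by (unfold d; lra).
  assert (HB : 0 <= B) by (apply Rdiv_le_0_compat; [lra|nra]).
  exists (PI * (B * (2 + Rabs t)) * 2). intros x Hre Him. unfold Hardy_kernel.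
  pose proof (Cmod_two_csinh_ge x Hre). pose proof (exp_pos (PI / 2 * Rabs (Re x))).
  assert (Hne : two_csinh x <> 0) by (apply Cmod_gt_0; lra).
  rewrite Cmod_div, Cmod_mult, Cmod_R, (Rabs_pos_eq PI) by (try exact Hne; lra).
  assert (HZ : Cmod (Hardy_Z th (RtoC t + x)) <= B * (2 + Rabs t) * exp (Rabs (Re x))).
  { eapply Rle_trans; [apply (Cmod_Hardy_Z_le th Hth d); [exact Hd|]|].
    - replace (Im (RtoC t + x)) with (Im x) by (destruct x; simpl; ring). unfold d. lra.
    - rewrite Rmult_assoc. apply Rmult_le_compat_l; [exact HB|].
      assert (Htri := Cmod_triangle (RtoC t) x). rewrite Cmod_R in Htri.
      pose proof (Cmod_le_Re_Im x). pose proof (exp_ineq1_le (Rabs (Re x))).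
      pose proof (Rabs_pos t). nra. }
  replace (PI * (B * (2 + Rabs t)) * 2 * exp (- ((PI / 2 - 1) * Rabs (Re x))))
    with (PI * (B * (2 + Rabs t) * exp (Rabs (Re x))) * / (exp (PI / 2 * Rabs (Re x)) / 2)).
  2:{ replace (- ((PI / 2 - 1) * Rabs (Re x)))
        with (Rabs (Re x) + - (PI / 2 * Rabs (Re x))) by field.
      rewrite exp_plus, exp_Ropp. field. lra. }
  apply Rmult_le_compat.
  - apply Rmult_le_pos; [lra|apply Cmod_ge_0].
  - apply Rlt_le, Rinv_0_lt_compat. lra.
  - now apply Rmult_le_compat_l; [lra|].
  - apply Rinv_le_contravar; lra.
Qed.

Lemma ex_Hardy_kernel_integral :
  exists I : C, is_RInt_line (fun u : R => Hardy_kernel (u, Ropp sigma)) I.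
Proof.
  destruct Hardy_kernel_decay as [K HK]. pose proof PI2_1.
  assert (Hlow : Rabs (- sigma) <= sigma) by (rewrite Rabs_Ropp, Rabs_pos_eq; lra).
  apply (ex_RInt_line_exp_decay _ 1 K (PI / 2 - 1)).
  - lra.
  - intros u. apply (continuous_horizontal Hardy_kernel), ex_derive_continuous_C.
    apply ex_derive_Hardy_kernel; [exact Hlow|]. intros Heq. injection Heq. lra.
  - intros u Hu. now apply (HK (u, Ropp sigma)).
Qed.

Lemma Hardy_kernel_integral_minus_conj (I : C) :
  is_RInt_line (fun u : R => Hardy_kernel (u, Ropp sigma)) I ->
  (I - Cconj I)%C = (two_PI_i * Hardy_Z th (RtoC t))%C.
Proof.
  intros HI. destruct Hardy_kernel_decay as [K HK]. pose proof PI2_1.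
  assert (Hlow : Rabs (- sigma) <= sigma) by (rewrite Rabs_Ropp, Rabs_pos_eq; lra).
  apply is_RInt_line_unique
    with (fun u : R => Hardy_kernel (u, Ropp sigma) - Hardy_kernel (u, sigma))%C.
  - apply is_RInt_line_minus; [exact HI|].
    apply is_RInt_line_ext with (2 := is_RInt_line_conj _ _ HI). intros u.
    rewrite Hardy_kernel_conj; [|exact Hlow|intros Heq; injection Heq; lra].
    f_equal. apply injective_projections; simpl; ring.
  - apply (is_RInt_line_residue Hardy_kernel 0); [simpl; lra| |exact Hardy_kernel_residue|].
    + intros x Hx. now apply ex_derive_Hardy_kernel, Rabs_le.
    + apply exp_decay_vanishes_in_strip with 1 K (PI / 2 - 1); [lra|].
      intros x Hre Him. now apply HK, Rabs_le.
Qed.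

Lemma phase_mult_U (I : C) : is_RInt_line (fun u : R => Hardy_kernel (u, Ropp sigma)) I ->
  (phase th (RtoC t) * U th sigma t)%C = (I / two_PI_i)%C.
Proof.
  intros HI. assert (Hne : phase th (RtoC t) <> 0) by apply cexp_neq_0.
  unfold U. rewrite (is_RInt_gen_unique (V := C_R_CompleteNormedModule) _
    (/ phase th (RtoC t) * I)%C).
  { fold two_PI_i. field. split; [exact two_PI_i_neq_0|exact Hne]. }
  apply is_RInt_line_ext with (2 := is_RInt_line_Cmult_l _ _ _ HI). intros u. cbv zeta.
  assert (Hx : two_csinh (u, Ropp sigma) <> 0).
  { apply two_csinh_neq_0; [|intros Heq; injection Heq; lra]. unfold strip. simpl.
    rewrite Rabs_Ropp, Rabs_pos_eq; lra. }
  rewrite cexp_minus. fold (phase th (RtoC t)). fold (phase th (RtoC t + (u, Ropp sigma))%C).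
  unfold Hardy_kernel, Hardy_Z. fold (critical (RtoC t + (u, Ropp sigma))%C).
  fold (two_csinh (u, Ropp sigma)). field. auto.
Qed.

End Hardy_kernel.

Lemma two_Re_div_two_PI_i (z : C) : RtoC (2 * Re (z / two_PI_i)) = ((z - Cconj z) / two_PI_i)%C.
Proof.
  assert (HPI := PI_neq0). unfold two_PI_i. destruct z.
  apply injective_projections; simpl; field; exact HPI.
Qed.

Theorem mainTheorem1 :
  forall (th : C -> C), is_RS_theta th ->
  forall (sigma : R), 0 < sigma < / 2 ->
  forall t : R,
    Zfun th t = RtoC (2 * Re (cexp (Ci * th (RtoC t)) * U th sigma t)%C).
Proof.
  intros th Hth sigma Hsigma t.
  destruct (ex_Hardy_kernel_integral th Hth sigma t Hsigma) as [I HI].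
  change (Hardy_Z th (RtoC t) = RtoC (2 * Re (phase th (RtoC t) * U th sigma t)%C)).
  rewrite (phase_mult_U th sigma t Hsigma I HI), two_Re_div_two_PI_i.
  rewrite (Hardy_kernel_integral_minus_conj th Hth sigma t Hsigma I HI).
  field. exact two_PI_i_neq_0.
Qed.
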